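(* Let $A=\oplus_{h\in H}A_h$ be a weakly basic graded algebra with enough idempotents. Consider the following assertions: 1. $A\text{-}Gr$ and $Gr\text{-}A$ are Frobenius categories. 2. $D({}_AA)$ and $D(A_A)$ are projective graded $A$-modules (i.e. projective objects of $Gr\text{-}A$ and $A\text{-}Gr$, respectively). 3. The finitely generated projective objects and the finitely cogenerated injective objects coincide in $A\text{-}Gr$ (resp. in $Gr\text{-}A$). [Assertion 3 has two versions, one for $A\text{-}Gr$ and one for $Gr\text{-}A$; what follows holds for either version.] 4. There exists a graded Nakayama form $(-,-):A\times A\longrightarrow K$. Then $1)\Longrightarrow 2)\Longrightarrow 3)\Longleftrightarrow 4)$. When $A$ is graded locally bounded, also $4)\Longrightarrow 2)$ holds. Finally, if $A$ is graded locally Noetherian, then the four assertions are equivalent.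
   Context: $K$ is a fixed field and $H$ a fixed abelian group, written additively. Algebras are associative $K$-algebras, not necessarily unital. A *graded algebra with enough idempotents* is an $H$-graded algebra $A=\oplus_{h\in H}A_h$ having a family $(e_i)_{i\in I}$ of nonzero orthogonal idempotents, homogeneous of degree $0$, with $\oplus_{i\in I}e_iA=A=\oplus_{i\in I}Ae_i$ (a *distinguished family* ). Modules are unital ($AM=M$, resp. $MA=M$). $A\text{-}Gr$ (resp. $Gr\text{-}A$) is the category of $H$-graded left (resp. right) unital $A$-modules with graded homomorphisms of degree $0$. $A$ is *locally finite dimensional* if $\dim_K e_iA_he_j<\infty$ for all $i,j\in I$, $h\in H$. The graded Jacobson radical $J^{gr}(A)$ is the intersection of all maximal graded left ideals of $A$ (equivalently, of all maximal graded right ideals). A locally finite dimensional graded algebra with enough idempotents is *weakly basic* if it has a distinguished family $(e_i)_{i\in I}$ (a *weakly basic* family, which we fix) such that each $e_iA_0e_i$ is a local algebra and $e_iAe_j\subseteq J^{gr}(A)$ for all $i\neq j$. Dual: for a graded left $A$-module $M$, $D(M)$ is the space of linear forms $f:M\to K$ with $f(e_iM_h)=0$ for all but finitely many $(i,h)\in I\times H$; it is a graded right $A$-module via $(fa)(x)=f(ax)$ and $D(M)_h=\{f\in D(M): f(M_k)=0\ \forall k\neq -h\}$. The dual of a graded right module is the graded left module defined symmetrically. ${}_AA$ and $A_A$ denote $A$ as a left and as a right graded module over itself. For graded $K$-vector spaces $V,W$ with finite dimensional homogeneous components, put $D(V)=\oplus_h\mathrm{Hom}_K(V_h,K)$. A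 bilinear form $V\times W\to K$ is *of degree $d\in H$* if $(V_h,W_k)\neq 0$ implies $h+k=d$; such a form is *nondegenerate* if the induced maps $W\to D(V)$, $w\mapsto(-,w)$, and $V\to D(W)$, $v\mapsto (v,-)$, are bijective. A *graded Nakayama form* for a weakly basic $A$ is a bilinear form $(-,-):A\times A\to K$ such that: (i) $(ab,c)=(a,bc)$ for all $a,b,c\in A$; (ii) for each $i\in I$ there is a unique $\nu(i)\in I$ with $(e_iA,Ae_{\nu(i)})\neq 0$, and $\nu:I\to I$ is a bijection; (iii) there is a map $\mathbf h:I\to H$ such that, for all $i,j\in I$, the induced form $e_iAe_j\times e_jAe_{\nu(i)}\to K$ is a nondegenerate graded bilinear form of degree $\mathbf h(i)$. $A$ is *graded locally bounded* if it is locally finite dimensional and for each $(i,h)\in I\times H$ the sets $\{j\in I: e_iA_he_j\neq 0\}$ and $\{j\in I:e_jA_he_i\neq 0\}$ are finite. $A$ is *graded locally Noetherian* if $Ae_i$ and $e_iA$ satisfy ACC on graded submodules for each $i\in I$. A graded module is *finitely cogenerated* if its graded socle is finitely generated and essential as a graded submodule. An abelian category is a *Frobenius category* if it has enough projectives and enough injectives and its projective and injective objects coincide. *)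

(* Defs.v *)
From HB Require Import structures.
From mathcomp Require Import all_boot all_algebra.
From mathcomp Require Import finmap all_classical.

Set Implicit Arguments.
Unset Strict Implicit.
Unset Printing Implicit Defensive.

Import GRing.Theory.
Local Open Scope classical_set_scope.
Local Open Scope ring_scope.

Record category := Category {
  obj :> Type;
  hom : obj -> obj -> Type;
  idm : forall X, hom X X;
  compm : forall X Y Z, hom Y Z -> hom X Y -> hom X Z;
  comp1m : forall X Y (f : hom X Y), compm (idm Y) f = f;
  compm1 : forall X Y (f : hom X Y), compm f (idm X) = f;
  compmA : forall X Y Z T (h : hom Z T) (g : hom Y Z) (f : hom X Y),
    compm h (compm g f) = compm (compm h g) f }.

Section CategoryTheory.
Variable C : category.

Definition monomorphism (X Y : C) (f : hom X Y) : Prop :=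
  forall (Z : C) (g h : hom Z X), compm f g = compm f h -> g = h.

Definition epimorphism (X Y : C) (f : hom X Y) : Prop :=
  forall (Z : C) (g h : hom Y Z), compm g f = compm h f -> g = h.

Definition projective (P : C) : Prop :=
  forall (X Y : C) (p : hom X Y) (f : hom P Y), epimorphism p ->
    exists g : hom P X, compm p g = f.

Definition injective_obj (E : C) : Prop :=
  forall (X Y : C) (m : hom X Y) (f : hom X E), monomorphism m ->
    exists g : hom Y E, compm g m = f.

Definition enough_projectives : Prop :=
  forall X : C, exists (P : C) (p : hom P X), projective P /\ epimorphism p.

Definition enough_injectives : Prop :=
  forall X : C, exists (E : C) (m : hom X E), injective_obj E /\ monomorphism m.

(* Meaningful for abelian categories, such as the categories [grmod_cat] of
   graded modules; abelianness is not part of the predicate. *)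
Definition frobenius : Prop :=
  [/\ enough_projectives, enough_injectives &
      forall X : C, projective X <-> injective_obj X].

End CategoryTheory.

Section Subspaces.
Variables (K : fieldType) (V : lmodType K).

Definition is_subspace (U : set V) : Prop :=
  U 0 /\ forall (a : K) u v, U u -> U v -> U (a *: u + v).

Definition finite_dim (U : set V) : Prop :=
  exists (n : nat) (b : 'I_n -> V), (forall k, U (b k)) /\
    forall v, U v -> exists c : 'I_n -> K, v = \sum_k c k *: b k.

Definition linear_form_on (U : set V) (phi : V -> K) : Prop :=
  forall (a : K) u v, U u -> U v -> phi (a *: u + v) = a * phi u + phi v.

Definition decomposes (I : choiceType) (U : I -> set V) (v : V) (f : I -> V) :
    Prop :=
  [/\ forall i, U i (f i), finite_set [set i | f i != 0] &
      v = \sum_(i \in [set: I]) f i].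

Definition direct_sum (I : choiceType) (U : I -> set V) : Prop :=
  (forall i, is_subspace (U i)) /\
  (forall v, exists! f : I -> V, decomposes U v f).

End Subspaces.

Record grspace (K : fieldType) (H : zmodType) := GrSpace {
  grspace_sort :> lmodType K;
  homog : H -> set grspace_sort;
  comp_direct : direct_sum homog }.

Record gralgebra (K : fieldType) (H : zmodType) := GrAlgebra {
  gralgebra_space :> grspace K H;
  mul : gralgebra_space -> gralgebra_space -> gralgebra_space;
  mul_assoc : forall a b c, mul a (mul b c) = mul (mul a b) c;
  mul_linl : forall b, linear (fun a => mul a b);
  mul_linr : forall a, linear (fun b => mul a b);
  mul_comp : forall h k a b, homog h a -> homog k b -> homog (h + k) (mul a b) }.

(* [sided_mul lside] is the product of A, [sided_mul rside] that of the
   opposite algebra; a right module is given by an action [act a x = x a], for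
   which associativity reads as in [act_assoc] below with s = rside. *)
Inductive side := lside | rside.

Definition opp_side (s : side) : side := if s is lside then rside else lside.

Definition sided_mul (K : fieldType) (H : zmodType) (A : gralgebra K H)
    (s : side) (a b : A) : A :=
  if s is lside then mul a b else mul b a.

Record distinguished_family (K : fieldType) (H : zmodType) (A : gralgebra K H)
    (I : choiceType) (e : I -> A) : Prop := DistinguishedFamily {
  df_neq0 : forall i, e i != 0;
  df_idem : forall i, mul (e i) (e i) = e i;
  df_orth : forall i j, i != j -> mul (e i) (e j) = 0;
  df_deg0 : forall i, homog 0 (e i);
  df_suml : direct_sum (fun i => [set mul (e i) a | a in [set: A]]);
  df_sumr : direct_sum (fun i => [set mul a (e i) | a in [set: A]]) }.

(* [grmod A lside] and [grmod A rside] are the unital graded left and right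
   modules. *)
Record grmod (K : fieldType) (H : zmodType) (A : gralgebra K H) (s : side) :=
GrMod {
  grmod_space :> grspace K H;
  act : A -> grmod_space -> grmod_space;
  act_assoc : forall a b x, act a (act b x) = act (sided_mul s a b) x;
  act_linl : forall x, linear (fun a => act a x);
  act_linr : forall a, linear (fun x => act a x);
  act_comp : forall h k a x, homog h a -> homog k x -> homog (h + k) (act a x);
  act_unital : forall x,
    exists (n : nat) (a : 'I_n -> A) (y : 'I_n -> grmod_space),
      x = \sum_k act (a k) (y k) }.

Section GradedModules.
Variables (K : fieldType) (H : zmodType) (A : gralgebra K H) (s : side).

Record grhom (M N : grmod A s) := GrHom {
  grhom_fun :> M -> N;
  grhom_lin : linear grhom_fun;
  grhom_act : forall a x, grhom_fun (act a x) = act a (grhom_fun x);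
  grhom_comp : forall h x, homog h x -> homog h (grhom_fun x) }.

Lemma grhomP (M N : grmod A s) (f g : grhom M N) :
  (forall x, f x = g x) -> f = g.
Proof.
case: f g => [f f1 f2 f3] [g g1 g2 g3] /= /funext fg.
by subst g; congr GrHom; exact: Prop_irrelevance.
Qed.

Lemma grhom_compose_lin (M N P : grmod A s) (g : grhom N P) (f : grhom M N) :
  linear (fun x => g (f x)).
Proof. by move=> a u v; rewrite !grhom_lin. Qed.

Lemma grhom_compose_act (M N P : grmod A s) (g : grhom N P) (f : grhom M N) a x :
  g (f (act a x)) = act a (g (f x)).
Proof. by rewrite !grhom_act. Qed.

Lemma grhom_compose_comp (M N P : grmod A s) (g : grhom N P) (f : grhom M N) h x :
  homog h x -> homog h (g (f x)).
Proof. by move=> hx; do 2!apply: grhom_comp. Qed.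

Definition grhom_id (M : grmod A s) : grhom M M :=
  @GrHom M M (fun x => x) (fun _ _ _ => erefl) (fun _ _ => erefl)
    (fun _ _ hx => hx).

Definition grhom_compose (M N P : grmod A s) (g : grhom N P) (f : grhom M N) :
    grhom M P :=
  @GrHom M P (fun x => g (f x)) (grhom_compose_lin g f) (grhom_compose_act g f)
    (@grhom_compose_comp _ _ _ g f).

Lemma grhom_comp1 (M N : grmod A s) (f : grhom M N) :
  grhom_compose (grhom_id N) f = f.
Proof. exact: grhomP. Qed.

Lemma grhom_1comp (M N : grmod A s) (f : grhom M N) :
  grhom_compose f (grhom_id M) = f.
Proof. exact: grhomP. Qed.

Lemma grhom_compA (M N P Q : grmod A s) (h : grhom P Q) (g : grhom N P)
    (f : grhom M N) :
  grhom_compose h (grhom_compose g f) = grhom_compose (grhom_compose h g) f.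
Proof. exact: grhomP. Qed.

Definition grmod_cat : category :=
  Category grhom_comp1 grhom_1comp grhom_compA.

End GradedModules.

Arguments grmod_cat {K H} A s.

Definition graded_subspace (K : fieldType) (H : zmodType) (V : grspace K H)
    (N : set V) : Prop :=
  is_subspace N /\
  forall x f, N x -> decomposes (@homog _ _ V) x f -> forall h, N (f h).

Section Submodules.
Variables (K : fieldType) (H : zmodType) (A : gralgebra K H) (s : side).
Variable M : grmod A s.

Definition graded_submodule (N : set M) : Prop :=
  graded_subspace N /\ forall a x, N x -> N (act a x).

Definition finitely_generated (N : set M) : Prop :=
  exists (n : nat) (x : 'I_n -> M), (forall k, N (x k)) /\
    forall y, N y -> exists a : 'I_n -> A, y = \sum_k act (a k) (x k).

Definition simple_graded_submodule (S : set M) : Prop :=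
  [/\ graded_submodule S, S <> [set 0] &
      forall N, graded_submodule N -> N `<=` S -> N = [set 0] \/ N = S].

Definition graded_socle : set M :=
  [set x | exists (n : nat) (y : 'I_n -> M),
    (forall k, exists2 S, simple_graded_submodule S & S (y k)) /\
    x = \sum_k y k].

Definition essential (N : set M) : Prop :=
  forall L, graded_submodule L -> L <> [set 0] -> L `&` N <> [set 0].

Definition finitely_cogenerated : Prop :=
  finitely_generated graded_socle /\ essential graded_socle.

End Submodules.

Arguments graded_socle {K H A s} M.
Arguments finitely_cogenerated {K H A s} M.

Section GradedAlgebras.
Variables (K : fieldType) (H : zmodType) (A : gralgebra K H).

Definition graded_left_ideal (N : set A) : Prop :=
  graded_subspace N /\ forall a x, N x -> N (mul a x).

Definition graded_right_ideal (N : set A) : Prop :=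
  graded_subspace N /\ forall a x, N x -> N (mul x a).

Definition maximal_graded_left_ideal (N : set A) : Prop :=
  [/\ graded_left_ideal N, N <> [set: A] &
      forall L, graded_left_ideal L -> N `<=` L -> L = N \/ L = [set: A]].

Definition graded_radical : set A :=
  [set x | forall N, maximal_graded_left_ideal N -> N x].

(* Left ideals of a (not necessarily graded) subring R of A; the identity of R
   need not be an identity of A. *)
Definition left_ideal_of (R m : set A) : Prop :=
  [/\ m `<=` R, m 0, forall x y, m x -> m y -> m (x - y) &
      forall r x, R r -> m x -> m (mul r x)].

Definition maximal_left_ideal_of (R m : set A) : Prop :=
  [/\ left_ideal_of R m, m <> R &
      forall n, left_ideal_of R n -> m `<=` n -> n = m \/ n = R].

Definition local_subring (R : set A) : Prop :=
  exists! m : set A, maximal_left_ideal_of R m.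

Variables (I : choiceType) (e : I -> A).

Definition rcorner (i : I) : set A := [set mul (e i) a | a in [set: A]].

Definition lcorner (j : I) : set A := [set mul a (e j) | a in [set: A]].

Definition corner (i j : I) : set A :=
  [set mul (mul (e i) a) (e j) | a in [set: A]].

Definition hcorner (i j : I) (h : H) : set A :=
  [set mul (mul (e i) a) (e j) | a in homog h].

Definition locally_finite_dimensional : Prop :=
  forall i j h, finite_dim (hcorner i j h).

Record weakly_basic : Prop := WeaklyBasic {
  wb_distinguished :> distinguished_family e;
  wb_lfd : locally_finite_dimensional;
  wb_local : forall i, local_subring (hcorner i i 0);
  wb_radical : forall i j, i != j -> corner i j `<=` graded_radical }.

Definition graded_locally_bounded : Prop :=
  locally_finite_dimensional /\
  forall i h, finite_set [set j | hcorner i j h <> [set 0]] /\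
              finite_set [set j | hcorner j i h <> [set 0]].

Definition ACC (P : set A -> Prop) : Prop :=
  forall N : nat -> set A, (forall n, P (N n)) ->
    (forall n, N n `<=` N n.+1) ->
    exists n0, forall n, (n0 <= n)%N -> N n = N n0.

Definition graded_locally_noetherian : Prop :=
  forall i,
    ACC (fun N => graded_left_ideal N /\ N `<=` lcorner i) /\
    ACC (fun N => graded_right_ideal N /\ N `<=` rcorner i).

(* An element of [D(V) = \oplus_h Hom_K(V_h, K)], as a family of linear forms;
   the values of [phi h] outside [V h] are irrelevant. *)
Definition graded_dual_element (V : H -> set A) (phi : H -> A -> K) : Prop :=
  (forall h, linear_form_on (V h) (phi h)) /\
  finite_set [set h | exists2 v, V h v & phi h v != 0].

(* A form on the graded subspaces [VT = \oplus_h V h] and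
   [WT = \oplus_h W h] of A. *)
Definition form_of_degree (V W : H -> set A) (B : A -> A -> K) (d : H) : Prop :=
  forall h k, (exists2 v, V h v & exists2 w, W k w & B v w != 0) -> h + k = d.

Definition nondegenerate_form (VT : set A) (V : H -> set A)
    (WT : set A) (W : H -> set A) (B : A -> A -> K) : Prop :=
  (forall phi, graded_dual_element V phi ->
     exists! w, WT w /\ forall h v, V h v -> B v w = phi h v) /\
  (forall phi, graded_dual_element W phi ->
     exists! v, VT v /\ forall h w, W h w -> B v w = phi h w).

Definition graded_nakayama_form (B : {biscalar A}) : Prop :=
  (forall a b c, B (mul a b) c = B a (mul b c)) /\
  exists nu : I -> I,
    [/\ bijective nu,
        forall i j, (exists2 a, rcorner i a & exists2 b, lcorner j b & B a b != 0)
                    <-> j = nu i &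
        exists hdeg : I -> H, forall i j,
          form_of_degree (hcorner i j) (hcorner j (nu i)) B (hdeg i) /\
          nondegenerate_form (corner i j) (hcorner i j)
            (corner j (nu i)) (hcorner j (nu i)) B].

End GradedAlgebras.

Section DirectSums.
Variables (K : fieldType) (V : lmodType K) (I : choiceType) (U : I -> set V).

Lemma decomposesP (v : V) (f : I -> V) :
  decomposes U v f <->
  (forall i, U i (f i)) /\
  exists2 X : {fset I}, (forall i, i \notin X -> f i = 0) &
    v = \sum_(i <- X) f i.
Proof.
split=> [[Uf /finite_fsetP[X fX] ->]|[Uf [X fX ->]]]; split=> //.
- have f0 i : i \notin X -> f i = 0.
    move=> iX; apply/eqP; apply: contraNT iX => fi.
    by have : [set` X] i by rewrite -fX.
  by exists X => //; rewrite (fsbigTE X).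
- apply: sub_finite_set (finite_fset X) => i /= fi.
  by apply: contraNT fi => /fX ->.
- by rewrite (fsbigTE X).
Qed.

Hypothesis dU : direct_sum U.

Definition dcomp (i : I) (v : V) : V := projT1 (cid (dU.2 v)) i.

Lemma dcompP v : decomposes U v (dcomp ^~ v).
Proof. by rewrite /dcomp; case: cid => f []. Qed.

Lemma dcompE v f i : decomposes U v f -> dcomp i v = f i.
Proof. by move=> vf; rewrite /dcomp; case: cid => g /= [_ /(_ f vf)] ->. Qed.

Lemma dcomp_in i v : U i (dcomp i v).
Proof. by case: (dcompP v). Qed.

Lemma dcomp_fin v :
  exists X : {fset I}, forall i, i \notin X -> dcomp i v = 0.
Proof. by have [_ [X X0 _]] := (decomposesP _ _).1 (dcompP v); exists X. Qed.

Lemma dcomp_sum v (X : {fset I}) : (forall i, i \notin X -> dcomp i v = 0) ->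
  v = \sum_(i <- X) dcomp i v.
Proof. by move=> X0; have [_ _ {1}->] := dcompP v; rewrite (fsbigTE X). Qed.

Lemma dcomp_linear i : linear (dcomp i).
Proof.
move=> a u v.
apply: (@dcompE _ (fun i => a *: dcomp i u + dcomp i v)); apply/decomposesP.
split=> [j|]; first by apply: (dU.1 j).2; exact: dcomp_in.
have [X X0] := dcomp_fin u; have [Y Y0] := dcomp_fin v.
exists (X `|` Y)%fset => [j|].
  by rewrite inE negb_or => /andP[/X0 -> /Y0 ->]; rewrite scaler0 addr0.
rewrite big_split -scaler_sumr -!dcomp_sum // => j.
- by rewrite inE negb_or => /andP[_ /Y0].
- by rewrite inE negb_or => /andP[/X0].
Qed.

Lemma subspace0 i : U i 0. Proof. exact: (dU.1 i).1. Qed.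

Lemma dcomp_homog i j v : U i v -> dcomp j v = if j == i then v else 0.
Proof.
move=> iv; apply: (@dcompE _ (fun j => if j == i then v else 0)).
apply/decomposesP; split=> [k|]; first by case: eqP => [->|_] //; exact: subspace0.
exists [fset i]%fset => [k|]; first by rewrite inE => /negPf ->.
by rewrite big_seq_fset1 eqxx.
Qed.

End DirectSums.

Section LinearFacts.
Variables (K : fieldType) (V W : lmodType K) (f : V -> W).
Hypothesis f_lin : linear f.

Lemma lin0 : f 0 = 0.
Proof. by have := f_lin (-1) 0 0; rewrite !scaleN1r addrC subrr addrC subrr. Qed.

Lemma linD x y : f (x + y) = f x + f y.
Proof. by have := f_lin 1 x y; rewrite !scale1r. Qed.

Lemma linZ a x : f (a *: x) = a *: f x.
Proof. by have := f_lin a x 0; rewrite lin0 !addr0. Qed.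

Lemma lin_sum (T : Type) (r : seq T) (g : T -> V) :
  f (\sum_(i <- r) g i) = \sum_(i <- r) f (g i).
Proof. exact: (big_morph f linD lin0). Qed.

End LinearFacts.

Section Regular.
Variables (K : fieldType) (H : zmodType) (A : gralgebra K H).
Variables (I : choiceType) (e : I -> A).
Hypothesis he : distinguished_family e.

Lemma sided_mul_assoc s a b c :
  sided_mul s a (sided_mul s b c) = sided_mul s (sided_mul s a b) c :> A.
Proof. by case: s; rewrite /= ?mul_assoc. Qed.

Lemma sided_mul_linl s b : linear (fun a : A => sided_mul s a b).
Proof. by case: s; [exact: mul_linl|exact: mul_linr]. Qed.

Lemma sided_mul_linr s a : linear (fun b : A => sided_mul s a b).
Proof. by case: s; [exact: mul_linr|exact: mul_linl]. Qed.

Lemma sided_mul_comp s h k (a b : A) :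
  homog h a -> homog k b -> homog (h + k) (sided_mul s a b).
Proof. by case: s => ah bk /=; [|rewrite addrC]; exact: mul_comp. Qed.

Lemma df_sum s : direct_sum (fun i => [set sided_mul s (e i) a | a in [set: A]]).
Proof. by case: s; [exact: df_suml|exact: df_sumr]. Qed.

Lemma sided_idem s i : sided_mul s (e i) (e i) = e i.
Proof. by case: s; exact: df_idem. Qed.

Lemma sided_orth s i j : i != j -> sided_mul s (e i) (e j) = 0.
Proof. by case: s => ij /=; rewrite df_orth // eq_sym. Qed.

Lemma dcomp_mul s i a : dcomp (df_sum s) i a = sided_mul s (e i) a.
Proof.
have [X X0] := dcomp_fin (df_sum s) a.
have ej j : sided_mul s (e j) (dcomp (df_sum s) j a) = dcomp (df_sum s) j a.
  have [b _ <-] := dcomp_in (df_sum s) j a.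
  by rewrite sided_mul_assoc sided_idem.
rewrite [in RHS](dcomp_sum X0) (lin_sum (sided_mul_linr _ _)).
rewrite [RHS](_ : _ = \sum_(j <- X) if j == i then dcomp (df_sum s) j a else 0).
  have [iX|iX] := boolP (i \in X).
    rewrite (big_fsetD1 i) //= eqxx big1_seq ?addr0 // => j.
    by case/andP=> _; rewrite !inE => /andP[/negPf ->].
  rewrite X0 // big1_seq // => j /= jX; case: eqP => // ji.
  by rewrite ji (negPf iX) in jX.
apply: eq_bigr => j _; case: eqP => [->|/eqP ji]; first exact: ej.
rewrite -ej sided_mul_assoc sided_orth 1?eq_sym //.
exact: (lin0 (sided_mul_linl _ _)).
Qed.

Lemma df_fin s a : exists X : {fset I},
  forall i, i \notin X -> sided_mul s (e i) a = 0.
Proof.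
have [X X0] := dcomp_fin (df_sum s) a.
by exists X => i; rewrite -dcomp_mul; exact: X0.
Qed.

Lemma df_expand s a (X : {fset I}) :
  (forall i, i \notin X -> sided_mul s (e i) a = 0) ->
  a = \sum_(i <- X) sided_mul s (e i) a.
Proof.
move=> X0; rewrite [LHS](@dcomp_sum _ _ _ _ (df_sum s) a X).
  by apply: eq_bigr => i _; rewrite dcomp_mul.
by move=> i; rewrite dcomp_mul; exact: X0.
Qed.

Lemma sided_mul_unital s (a : A) :
  exists (n : nat) (b c : 'I_n -> A), a = \sum_k sided_mul s (b k) (c k).
Proof.
have [X X0] := df_fin s a.
exists (size X), (fun k => e (tnth (in_tuple X) k)), (fun=> a).
by rewrite [LHS](df_expand X0) big_tnth.
Qed.

Definition regular (s : side) : grmod A s :=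
  @GrMod K H A s A (@sided_mul K H A s) (@sided_mul_assoc s)
    (@sided_mul_linl s) (@sided_mul_linr s) (@sided_mul_comp s)
    (@sided_mul_unital s).

End Regular.

Section DualForms.
Variables (K : fieldType) (H : zmodType) (A : gralgebra K H).
Variables (I : choiceType) (e : I -> A) (s : side) (M : grmod A s).

Definition is_dual_form (f : M -> K^o) : Prop :=
  linear f /\
  finite_set [set p : I * H | exists2 x, homog p.2 x & f (act (e p.1) x) != 0].

Definition dual_pred : {pred M -> K^o} := fun f => `[< is_dual_form f >].

Record dual_form := DualForm {
  dual_fun :> M -> K^o;
  dual_funP : dual_fun \in dual_pred }.

HB.instance Definition _ := [isSub for dual_fun].
HB.instance Definition _ := [Choice of dual_form by <:].

Lemma dual_submod_closed : submod_closed dual_pred.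
Proof.
split=> [|a f g /asboolP[f_lin f_fin] /asboolP[g_lin g_fin]]; apply/asboolP; split.
- by move=> b x y; rewrite scaler0 addr0.
- by apply: sub_finite_set (finite_set0 _) => p [x _] /=; rewrite eqxx.
- move=> b x y; change (a *: f (b *: x + y) + g (b *: x + y) =
    b *: (a *: f x + g x) + (a *: f y + g y)).
  rewrite f_lin g_lin !scalerDr !scalerA (mulrC b a) -!addrA; congr (_ + _).
  by rewrite addrCA.
- apply: sub_finite_set (_ : finite_set (_ `|` _)); last first.
    by rewrite finite_setU; split; [exact: f_fin|exact: g_fin].
  move=> p [x px fg]; have [fx|fx] := eqVneq (f (act (e p.1) x)) 0.
    right; exists x => //; apply: contraNneq fg => gx.
    change (a *: f (act (e p.1) x) + g (act (e p.1) x) == 0).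
    by rewrite fx gx scaler0 addr0.
  by left; exists x.
Qed.

HB.instance Definition _ := GRing.isSubmodClosed.Build _ _ dual_pred
  dual_submod_closed.
HB.instance Definition _ := [SubChoice_isSubLmodule of dual_form by <:].

Lemma dual_formP (f g : dual_form) : (forall x, f x = g x) -> f = g.
Proof. by move=> fg; apply: val_inj; apply/funext => x; exact: fg. Qed.

Lemma dual_lin (f : dual_form) : linear f.
Proof. by have /asboolP[] := dual_funP f. Qed.

Lemma dual_fin (f : dual_form) : exists X : {fset I * H},
  forall i h x, homog h x -> f (act (e i) x) != 0 -> (i, h) \in X.
Proof.
have /asboolP[_ /finite_fsetP[X fX]] := dual_funP f.
exists X => i h x hx fx; suff : [set` X] (i, h) by [].
by rewrite -fX; exists x.
Qed.

Lemma dualD (f g : dual_form) x : (f + g) x = f x + g x.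
Proof. by []. Qed.

Lemma dualZ a (f : dual_form) x : (a *: f) x = a * f x.
Proof. by []. Qed.

Lemma dual_sum (T : Type) (r : seq T) (g : T -> dual_form) x :
  (\sum_(i <- r) g i) x = \sum_(i <- r) g i x.
Proof. by elim/big_rec2: _ => // i y z _ <-. Qed.

Definition dual_comp (h : H) : set dual_form :=
  [set f | forall k x, k != - h -> homog k x -> f x = 0].

End DualForms.

Arguments dual_pred {K H A I} e {s} M f.
Arguments dual_comp {K H A I} e {s} M h.

Section Dual.
Variables (K : fieldType) (H : zmodType) (A : gralgebra K H).
Variables (I : choiceType) (e : I -> A) (s : side).
Hypothesis he : distinguished_family e.
Variable M : grmod A s.

Let fzero (x : M) (X : {fset I}) := forall i, i \notin X -> act (e i) x = 0.

Lemma act_expand (x : M) :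
  exists2 X : {fset I}, fzero x X & x = \sum_(i <- X) act (e i) x.
Proof.
pose P (x : M) := exists2 X : {fset I}, fzero x X &
  x = \sum_(i \in [set: I]) act (e i) x.
suff [X X0 xE] : P x by exists X => //; rewrite -(fsbigTE X) //; exact: X0.
have [n [a [y ->]]] := act_unital x; apply: (big_ind P).
- have z0 : fzero 0 fset0 by move=> i _; exact: lin0 (act_linr _).
  by exists fset0 => //; rewrite (fsbigTE fset0) ?big_seq_fset0.
- move=> u v [X X0 uE] [Y Y0 vE]; exists (X `|` Y)%fset => [i|].
    rewrite inE negb_or (linD (act_linr _)) => /andP[/X0 -> /Y0 ->].
    by rewrite addr0.
  rewrite (fsbigTE (X `|` Y)%fset) => [|i]; last first.
    rewrite inE negb_or (linD (act_linr _)) => /andP[/X0 -> /Y0 ->].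
    by rewrite addr0.
  rewrite (eq_bigr (fun i => act (e i) u + act (e i) v)) => [|i _]; last first.
    exact: (linD (act_linr _)).
  rewrite big_split {1}uE {1}vE; congr (_ + _); apply: fsbigTE => i.
  + by rewrite inE negb_or => /andP[/X0].
  + by rewrite inE negb_or => /andP[_ /Y0].
- move=> k _; have [X X0] := df_fin he s (a k).
  have Z0 : fzero (act (a k) (y k)) X.
    by move=> i iX; rewrite act_assoc X0 //; exact: lin0 (act_linl _).
  exists X => //; rewrite (fsbigTE X) // {1}(df_expand he X0).
  rewrite (lin_sum (act_linl _)).
  by apply: eq_bigr => i _; rewrite act_assoc.
Qed.

Lemma act_e_comp h i (x : M) : homog h x -> homog h (act (e i) x).
Proof. by move=> hx; rewrite -[h]add0r; apply: act_comp => //; exact: df_deg0. Qed.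

Lemma dual_neq0 (f : dual_form e M) (x : M) :
  f x != 0 -> exists i, f (act (e i) x) != 0.
Proof.
have [X _ {1}->] := act_expand x; rewrite (lin_sum (dual_lin f)) => fx.
apply: contrapT => /forallNP f0; move: fx; rewrite big1 ?eqxx // => i _.
by apply/eqP/negPn/negP; exact: f0.
Qed.

Lemma dual_fin_deg (f : dual_form e M) : exists X : {fset H},
  forall h (x : M), homog h x -> f x != 0 -> h \in X.
Proof.
have [X fX] := dual_fin f; exists [fset p.2 | p in X]%fset => h x hx fx.
have [i fi] := dual_neq0 fx.
by apply/imfsetP; exists (i, h) => //=; exact: fX fi.
Qed.

Definition gcomp (V : grspace K H) (h : H) : V -> V := dcomp (comp_direct V) h.

Lemma gcomp_in (V : grspace K H) h (x : V) : homog h (gcomp h x).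
Proof. exact: dcomp_in. Qed.

Lemma gcomp_lin (V : grspace K H) h : linear (@gcomp V h).
Proof. exact: dcomp_linear. Qed.

Lemma gcomp_act_e h i (x : M) : gcomp h (act (e i) x) = act (e i) (gcomp h x).
Proof.
apply: (@dcompE _ _ _ _ _ _ (fun h => act (e i) (gcomp h x))).
apply/decomposesP; split=> [k|]; first exact/act_e_comp/gcomp_in.
have [X X0] := dcomp_fin (comp_direct M) x; exists X => [k kX|].
  by rewrite /gcomp X0 //; exact: lin0 (act_linr _).
by rewrite -(lin_sum (act_linr _)) -dcomp_sum.
Qed.

Lemma dual_part_subproof (h : H) (f : dual_form e M) :
  (fun x => f (gcomp (- h) x)) \in dual_pred e M.
Proof.
apply/asboolP; split.
  by move=> a x y; rewrite gcomp_lin dual_lin.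
have [X fX] := dual_fin f; apply: sub_finite_set (finite_fset X) => -[i k].
move=> [x /= kx fx]; move: fx; rewrite gcomp_act_e /gcomp (dcomp_homog _ _ kx).
case: (- h =P k) => [_ fx|_]; first exact: fX kx fx.
by rewrite (lin0 (act_linr _)) (lin0 (dual_lin f)) eqxx.
Qed.

Definition dual_part h f : dual_form e M := DualForm (dual_part_subproof h f).

Lemma dual_comp_direct : direct_sum (dual_comp e M).
Proof.
split=> [h|f]; first split=> [k x _ _ //|a f g fh gh k x kh kx].
  by rewrite dualD dualZ (fh k) ?(gh k) // mulr0 addr0.
exists (fun h => dual_part h f); split.
  apply/decomposesP; split=> [h k x kh kx /=|].
    rewrite /gcomp (dcomp_homog _ _ kx) eq_sym (negPf kh).
    exact: lin0 (dual_lin f).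
  have [X fX] := dual_fin_deg f; exists [fset - h | h in X]%fset.
    move=> h hX; apply: dual_formP => x /=; apply/eqP; apply: contraNT hX => fx.
    apply/imfsetP; exists (- h); last by rewrite opprK.
    exact: fX (gcomp_in _ _) fx.
  apply: dual_formP => x; rewrite dual_sum big_imfset /=; last first.
    by move=> h k _ _; exact: oppr_inj.
  under eq_bigr do rewrite opprK.
  have [Y Y0] := dcomp_fin (comp_direct M) x.
  rewrite {1}(@dcomp_sum _ _ _ _ (comp_direct M) x (X `|` Y)%fset); last first.
    by move=> h; rewrite inE negb_or => /andP[_ /Y0].
  rewrite (lin_sum (dual_lin f)); apply/esym/big_fset_incl.
    exact: fsubsetUl.
  move=> h _ hX; apply/eqP; apply: contraNT hX => /fX; apply.
  exact: dcomp_in.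
move=> g /decomposesP[gh [X X0 ->]]; apply/funext => h; apply: dual_formP => x /=.
have gk k y l : homog l y -> k != - l -> g k y = 0.
  by move=> ly kl; apply: (gh k l) => //; apply: contraNneq kl => ->; rewrite opprK.
have [Y Y0] := dcomp_fin (comp_direct M) x.
rewrite dual_sum.
have -> : g h x = g h (gcomp (- h) x).
  rewrite {1}(@dcomp_sum _ _ _ _ (comp_direct M) x ([fset (- h)] `|` Y)%fset).
    rewrite (lin_sum (dual_lin _)) (big_fsetD1 (- h)%R) /=; last first.
      by rewrite !inE eqxx.
    rewrite big1_seq ?addr0 // => k /andP[_]; rewrite !inE => /andP[kh _].
    apply: gk (dcomp_in _ _ _) _.
    by apply: contraNneq kh => ->; rewrite opprK.
  by move=> k; rewrite inE negb_or => /andP[_ /Y0].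
have g0 k : k != h -> g k (gcomp (- h) x) = 0.
  by move=> kh; apply: gk (gcomp_in _ _) _; rewrite opprK.
have [hX|hX] := boolP (h \in X).
  rewrite (big_fsetD1 h) //= big1_seq ?addr0 // => k.
  by case/andP=> _; rewrite !inE => /andP[/g0].
rewrite X0 // big1_seq // => k /andP[_ kX]; apply: g0.
by apply: contraNneq hX => <-.
Qed.

Definition dual_space : grspace K H := GrSpace dual_comp_direct.

Lemma dual_act_subproof (a : A) (f : dual_form e M) :
  (fun x => f (act a x)) \in dual_pred e M.
Proof.
apply/asboolP; split.
  by move=> b x y; rewrite act_linr dual_lin.
have [X X0] := df_fin he (opp_side s) a; have [Y fY] := dual_fin_deg f.
have [Z Z0] := dcomp_fin (comp_direct A) a.
apply: sub_finite_set (finite_fset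
  (X `*` [fset y - z | y in Y, z in Z])%fset) => -[i h] [x /= hx fx].
rewrite in_fsetM /=; apply/andP; split.
  apply: contraNT fx => /X0 ei0; rewrite act_assoc.
  have -> : sided_mul s a (e i) = sided_mul (opp_side s) (e i) a by case: (s).
  by rewrite ei0 (lin0 (act_linl _)) (lin0 (dual_lin f)).
have [z zZ fz] : exists2 z, z \in Z &
    f (act (gcomp z a) (act (e i) x)) != 0.
  apply: contrapT => /forall2NP f0; move: fx.
  rewrite {1}(dcomp_sum Z0) (lin_sum (act_linl _)) (lin_sum (dual_lin f)).
  rewrite big1_seq ?eqxx // => z /andP[_ zZ].
  by case: (f0 z) => // /negP/negPn/eqP.
apply/imfset2P; exists (z + h); last by exists z => //; rewrite addrAC subrr add0r.
apply: fY fz; apply: act_comp (gcomp_in _ _) _; exact: act_e_comp.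
Qed.

Definition dual_act (a : A) (f : dual_space) : dual_space :=
  DualForm (dual_act_subproof a f).

Lemma dual_act_assoc a b f :
  dual_act a (dual_act b f) = dual_act (sided_mul (opp_side s) a b) f.
Proof.
have -> : sided_mul (opp_side s) a b = sided_mul s b a by case: (s).
by apply: dual_formP => x /=; rewrite act_assoc.
Qed.

Lemma dual_act_linl f : linear (fun a => dual_act a f).
Proof.
move=> c a b; apply: dual_formP => x; rewrite dualD dualZ /=.
by rewrite act_linl dual_lin.
Qed.

Lemma dual_act_linr a : linear (dual_act a).
Proof. by move=> c f g; apply: dual_formP. Qed.

Lemma dual_act_comp h k (a : A) (f : dual_space) :
  homog h a -> homog k f -> homog (h + k) (dual_act a f).
Proof.
move=> ha fk l x lh lx /=; apply: (fk (h + l)); last exact: act_comp.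
by apply: contraNneq lh => hl; rewrite opprD -hl addKr.
Qed.

Lemma dual_act_unital (f : dual_space) :
  exists (n : nat) (a : 'I_n -> A) (g : 'I_n -> dual_space),
    f = \sum_k dual_act (a k) (g k).
Proof.
have [X fX] := dual_fin f; pose Y := [fset p.1 | p in X]%fset.
exists (size Y), (fun k => e (tnth (in_tuple Y) k)), (fun=> f).
rewrite -(big_tnth _ _ Y xpredT (fun i => dual_act (e i) f)).
apply: dual_formP => x; rewrite dual_sum /=.
have f0 i : i \notin Y -> f (act (e i) x) = 0.
  move=> iY; apply/eqP; apply: contraNT iY => fx.
  have [Z Z0] := dcomp_fin (comp_direct M) x.
  have [h fh] : exists h, f (act (e i) (gcomp h x)) != 0.
    apply: contrapT => /forallNP fh; move: fx.
    rewrite (dcomp_sum Z0) (lin_sum (act_linr _)) (lin_sum (dual_lin f)).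
    rewrite big1 ?eqxx // => h _; by apply/eqP/negPn/negP; exact: fh.
  by apply/imfsetP; exists (i, h) => //=; apply: fX fh; exact: gcomp_in.
have [Z Z0 xE] := act_expand x.
rewrite {1}xE (lin_sum (dual_lin f)) -(fsbigTE Z) => [|i /Z0 ->]; last first.
  exact: lin0 (dual_lin f).
exact: fsbigTE.
Qed.

Definition dual : grmod A (opp_side s) :=
  @GrMod K H A (opp_side s) dual_space dual_act dual_act_assoc dual_act_linl
    dual_act_linr dual_act_comp dual_act_unital.

End Dual.

(* Main.v *)
From HB Require Import structures.
From mathcomp Require Import all_boot all_algebra finmap.
From mathcomp Require Import all_classical.
Require Import Defs.

Set Implicit Arguments.
Unset Strict Implicit.
Unset Printing Implicit Defensive.

Import GRing.Theory.
Local Open Scope classical_set_scope.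
Local Open Scope ring_scope.

(** Up to a shift, a homomorphism from A e_j to the dual D(e_i A) is a homogeneous
linear form lam on e_i A e_j. It is an isomorphism exactly when the pairing
(a, b) |-> lam (a b) of e_i A with A e_j is nondegenerate on both sides, because
the pieces e_i A_h e_k are finite dimensional. This is the notion [perfect]; it
treats left and right alike. A Nakayama form amounts to a bijection nu and a
perfect form lam_i on e_i A e_(nu i) for every i, the bilinear form being
(a, b) |-> sum_i lam_i (a b) ([nakayama_form_perm], [nakayama_perm_form]). All
assertions are compared with the existence of such a family, [nakayama_perm].
A partner of an index is unique, on either side, since A e_j and A e_k are not
isomorphic for j <> k, even up to a shift ([cor_iso_eq]); so a bijection nu exists
as soon as every index has a partner on each side.

The module D(e_i A) is always injective with a simple essential socle
([corep_injective], [corep_essential]), and when it is projective it is some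
A e_j up to a shift ([projective_perfect]). It is a summand of D(A), so assertion
2 gives all partners; it is finitely cogenerated and injective, so assertion 3
gives those on one side, and those on the other because A e_j is then injective
and splits off a copy of some D(e_i A) ([coincidence_nakayama_perm]). Assertion 1
implies assertion 2 because D(A) is always injective ([dual_regular_injective]).

Conversely, suppose that all partners are given. Then every A e_j is injective
with a simple essential socle, and so is finitely cogenerated. A finitely
generated projective module is a summand of a finite direct sum of shifted A e_j.
An injective module E that contains a simple S contains the injective hull of S,
which is some A e_j; finitely many of these, in direct sum, absorb a finitely
generated socle ([indep_extend]), and their sum splits off and is E when the socle
is essential. This is assertion 3. If A is graded locally bounded, D(A) is the
direct sum of the D(e_i A), which gives assertion 2 ([dual_regular_projective]).

If A is graded locally Noetherian, Baer's criterion makes arbitrary direct sums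
of shifted A e_j injective, and duality turns the ascending chain condition on
e_i A into the descending one on A e_(nu i), so that every nonzero module has a
simple submodule. A maximal free family in an injective module then spans it, and
projective and injective objects coincide ([noetherian_frobenius]).

Both sides are treated at once through [side]. Quotient modules do not occur:
monomorphisms and epimorphisms are recognized by maps from free modules and to
cofree modules ([mono_inj], [epi_surj]). *)

Local Notation "a ** x" := (act a x) (at level 40, left associativity).

(** * Linear forms *)

Lemma fset_sum1 (V : nmodType) (T : choiceType) (X : {fset T}) (F : T -> V) t :
  (forall u, u \in X -> u <> t -> F u = 0) -> (t \notin X -> F t = 0) ->
  \sum_(u <- X) F u = F t.
Proof.
move=> F0 Ft; have [tX|tX] := boolP (t \in X).
  rewrite (big_fsetD1 t) //= big1_seq ?addr0 // => u /andP[_].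
  by rewrite !inE => /andP[/eqP ut uX]; exact: F0.
rewrite Ft // big1_seq // => u /andP[_ uX]; apply: F0 => // ut.
by rewrite -ut uX in tX.
Qed.

Section LinearForms.
Variable K : fieldType.

Lemma linN (V W : lmodType K) (f : V -> W) : linear f -> forall x, f (- x) = - f x.
Proof. by move=> fl x; rewrite -scaleN1r (linZ fl) scaleN1r. Qed.

Lemma linB (V W : lmodType K) (f : V -> W) :
  linear f -> forall x y, f (x - y) = f x - f y.
Proof. by move=> fl x y; rewrite (linD fl) (linN fl). Qed.

Lemma lin_comp (U V W : lmodType K) (g : V -> W) (f : U -> V) :
  linear g -> linear f -> linear (fun x => g (f x)).
Proof. by move=> gl fl a x y; rewrite fl gl. Qed.

Lemma subD (V : lmodType K) (U : set V) :
  is_subspace U -> forall x y, U x -> U y -> U (x + y).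
Proof. by move=> [_ Ul] x y Ux Uy; rewrite -[x]scale1r; exact: Ul. Qed.

Lemma subZ (V : lmodType K) (U : set V) :
  is_subspace U -> forall a x, U x -> U (a *: x).
Proof. by move=> [U0 Ul] a x Ux; rewrite -[_ *: _]addr0; exact: Ul. Qed.

Lemma subN (V : lmodType K) (U : set V) :
  is_subspace U -> forall x, U x -> U (- x).
Proof. by move=> Us x Ux; rewrite -scaleN1r; exact: subZ. Qed.

Lemma subB (V : lmodType K) (U : set V) :
  is_subspace U -> forall x y, U x -> U y -> U (x - y).
Proof. by move=> Us x y Ux Uy; apply: subD => //; exact: subN. Qed.

Lemma sub_sum (V : lmodType K) (U : set V) (T : Type) (r : seq T) (P : pred T)
    (f : T -> V) :
  is_subspace U -> (forall t, P t -> U (f t)) -> U (\sum_(t <- r | P t) f t).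
Proof.
move=> Us Uf; apply: big_ind => //; first exact: Us.1.
exact: subD.
Qed.

Lemma Zorn_above (T : Type) (P : set T -> Prop) (N0 : set T) : P N0 ->
  (forall F : set (set T), F !=set0 -> (forall X, F X -> P X /\ N0 `<=` X) ->
     total_on F subset -> P (\bigcup_(X in F) X)) ->
  exists M, [/\ P M, N0 `<=` M & forall N, P N -> M `<=` N -> N = M].
Proof.
move=> PN0 chain.
have [F FP Ft|M [PM Mmax]] := @Zorn_bigcup T (fun X => P (X `|` N0)).
  have [[X0 FX0]|/set0P/negP/negPn/eqP F0] := pselect (F !=set0); last first.
    by rewrite F0 bigcup_set0 set0U.
  have -> : \bigcup_(X in F) X `|` N0 =
      \bigcup_(X in [set X `|` N0 | X in F]) X.
    apply/seteqP; split=> [x [[X FX Xx]|N0x]|x [_ [X FX <-] [Xx|N0x]]].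
    - by exists (X `|` N0); [exists X|left].
    - by exists (X0 `|` N0); [exists X0|right].
    - by left; exists X.
    - by right.
  apply: chain => [|_ [X FX <-]|_ _ [X FX <-] [Y FY <-]].
  - by exists (X0 `|` N0), X0.
  - by split; [exact: FP|exact: subsetUr].
  - by have [XY|YX] := Ft _ _ FX FY; [left|right]; exact: setSU.
exists (M `|` N0); split=> [//||N PN MN]; first exact: subsetUr.
apply: contrapT => NM; apply: (Mmax N).
  split; first by apply: subset_trans MN; exact: subsetUl.
  by move=> NsM; apply: NM; apply/seteqP; split=> // x /NsM; left.
rewrite setUidl //; apply: subset_trans MN; exact: subsetUr.
Qed.

(** A subspace that is maximal among those avoiding v is a hyperplane
complementary to v. *)
Lemma sep_form (V : lmodType K) (U : set V) v : is_subspace U -> ~ U v ->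
  exists f : V -> K^o, [/\ linear f, forall u, U u -> f u = 0 & f v = 1].
Proof.
move=> Us Uv.
have [||W [[Ws Wv] UW Wmax]] :=
    @Zorn_above V (fun X => is_subspace X /\ ~ X v) U => //.
  move=> F [X0 FX0] FP Ft; split; last by move=> [X /FP[[]]].
  split; first by exists X0 => //; exact: (FP _ FX0).1.1.1.
  move=> a x y [X FX Xx] [Y FY Yy].
  have [XY|YX] := Ft _ _ FX FY.
    by exists Y => //; apply: (FP _ FY).1.1.2 => //; exact: XY.
  by exists X => //; apply: (FP _ FX).1.1.2 => //; exact: YX.
have Wdec x : exists c : K, W (x - c *: v).
  have [Wx|Wx] := pselect (W x); first by exists 0; rewrite scale0r subr0.
  apply: contrapT => /forallNP nx; apply: Wx.
  pose W' := [set w | exists a : K, W (w - a *: x)].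
  have W's : is_subspace W'.
    split=> [|b u w [a Wa] [c Wc]].
      by exists 0; rewrite scale0r subr0; exact: Ws.1.
    exists (b * a + c).
    have -> : b *: u + w - (b * a + c) *: x =
        b *: (u - a *: x) + (w - c *: x).
      by rewrite scalerBr scalerA scalerDl opprD addrACA.
    exact: Ws.2.
  have <- : W' = W.
    apply: Wmax => [|w Ww]; last by exists 0; rewrite scale0r subr0.
    split=> // -[a Wa]; have [a0|a0] := eqVneq a 0.
      by apply: Wv; move: Wa; rewrite a0 scale0r subr0.
    apply: (nx a^-1); have := subZ Ws (- a^-1) Wa.
    by rewrite scalerBr scalerA mulNr mulVf // !scaleNr scale1r opprK addrC.
  by exists 1; rewrite scale1r subrr; exact: Ws.1.
have Wuniq x c c' : W (x - c *: v) -> W (x - c' *: v) -> c = c'.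
  move=> Wc Wc'; apply: contrapT => /eqP; rewrite -subr_eq0 => cc; apply: Wv.
  have := subZ Ws (c - c')^-1 (subB Ws Wc' Wc).
  have -> : x - c' *: v - (x - c *: v) = (c - c') *: v.
    by rewrite opprB [LHS]addrC subrKA -scalerBl.
  by rewrite scalerA mulVf ?scale1r.
have [f fP] := choice Wdec.
exists f; split=> [a x y|u Uu|].
- apply: (Wuniq (a *: x + y)) => //.
  have -> : a *: x + y - (a *: (f x : K^o) + f y) *: v =
      a *: (x - f x *: v) + (y - f y *: v).
    by rewrite scalerBr scalerA scalerDl opprD addrACA.
  exact: Ws.2.
- by apply: (Wuniq u) => //; rewrite scale0r subr0; exact: UW.
- by apply: (Wuniq v) => //; rewrite scale1r subrr; exact: Ws.1.
Qed.

(** A form phi is recovered from its kernel and from one vector w with phi w = 1: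
it is the form that vanishes on the kernel and is 1 at w. *)
Lemma ext_form (V : lmodType K) (U : set V) (phi : V -> K) :
  is_subspace U -> linear_form_on U phi ->
  exists f : V -> K^o, linear f /\ forall u, U u -> f u = phi u.
Proof.
move=> Us phil.
have phi0 : phi 0 = 0.
  have := phil (-1) 0 0 Us.1 Us.1.
  by rewrite scaleN1r oppr0 addr0 mulN1r addNr.
have phiZ a u : U u -> phi (a *: u) = a * phi u.
  by move=> Uu; have := phil a u 0 Uu Us.1; rewrite phi0 !addr0.
have [[v Uv phiv]|phi00] := pselect (exists2 v, U v & phi v <> 0); last first.
  exists (fun=> 0); split=> [a x y|u Uu]; first by rewrite scaler0 addr0.
  by apply/esym; apply: contrapT => phiu; apply: phi00; exists u.
move/eqP: phiv => phiv.
pose w := (phi v)^-1 *: v.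
have phiw : phi w = 1 by rewrite phiZ // mulVf.
have Uw : U w by exact: subZ.
have Us0 : is_subspace [set u | U u /\ phi u = 0].
  split=> [|a x y [Ux x0] [Uy y0]]; first by split => //; exact: Us.1.
  by split; [exact: Us.2|rewrite phil // x0 y0 mulr0 addr0].
have [|f [fl fU fw]] := sep_form (v := w) Us0.
  by case=> _; rewrite phiw => /eqP; rewrite oner_eq0.
exists f; split=> // u Uu.
have fu : f (u - phi u *: w) = 0.
  apply: fU; split; first by apply: subB => //; exact: subZ.
  by rewrite addrC -scaleNr phil // phiw mulr1 addNr.
move: fu; rewrite (linB fl) (linZ fl) fw => /eqP; rewrite subr_eq0 => /eqP ->.
by rewrite /GRing.scale /= mulr1.
Qed.

Lemma ext_along (X Y : lmodType K) (m : X -> Y) (g : X -> K^o) :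
  linear m -> injective m -> linear g ->
  exists f : Y -> K^o, linear f /\ forall x, f (m x) = g x.
Proof.
move=> ml mi gl.
have [|a u v [x _ <-] [y _ <-]|f [fl fg]] :=
  @ext_form Y (range m) (fun y => g (xget 0 [set x | m x = y])).
- split=> [|a u v [x _ <-] [y _ <-]]; first by exists 0 => //; exact: lin0 ml.
  by exists (a *: x + y) => //; rewrite ml.
- have gE x' : g (xget 0 [set x | m x = m x']) = g x'.
    congr (g _); apply: mi.
    exact: (@xgetPex _ 0 [set x | m x = m x'] (ex_intro _ x' erefl)).
  by rewrite -ml !gE gl.
- exists f; split=> // x; rewrite fg; last by exists x.
  congr (g _); apply: mi.
  exact: (@xgetPex _ 0 [set x0 | m x0 = m x] (ex_intro _ x erefl)).
Qed.

(** Read on the values at a spanning family, a form that separates s0 from L is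
evaluation at a vector of U, on which L vanishes and s0 does not. *)
Lemma finite_dim_bidual (V : lmodType K) (U : set V) (L : set (V -> K^o))
    (s0 : V -> K) :
  is_subspace U -> finite_dim U -> is_subspace L ->
  (forall f, L f -> linear f) -> linear_form_on U s0 ->
  (forall r, U r -> (forall f, L f -> f r = 0) -> s0 r = 0) ->
  exists2 f, L f & forall u, U u -> f u = s0 u.
Proof.
move=> Us [n [b [Ub bU]]] Ls Ll /(ext_form Us)[s [sl sE]] s0E.
pose L' := [set w : 'I_n -> K^o | exists2 f, L f & w = f \o b].
have L's : is_subspace L'.
  split=> [|a _ _ [f Lf ->] [g Lg ->]]; first by exists 0; [exact: Ls.1|].
  by exists (a *: f + g) => //; exact: Ls.2.
have [[f Lf sf]|sL'] := pselect (L' (s \o b)).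
  exists f => // u Uu; rewrite -sE //; have [c ->] := bU u Uu.
  rewrite (lin_sum (Ll _ Lf)) (lin_sum sl); apply: eq_bigr => k _.
  rewrite (linZ (Ll _ Lf)) (linZ sl); congr (_ *: _).
  exact: (congr1 (fun g => g k) (esym sf)).
have [c [cl cL' cs]] := sep_form L's sL'.
pose dl k : 'I_n -> K^o := fun l => if l == k then 1 else 0.
have cE (g : V -> K^o) : linear g -> g (\sum_k c (dl k) *: b k) = c (g \o b).
  move=> gl; rewrite (lin_sum gl).
  have -> : g \o b = \sum_k g (b k) *: dl k.
    apply/funext => l; rewrite fct_sumE (bigD1 l) //= big1.
      by rewrite addr0 scalrfctE /dl eqxx /GRing.scale /= mulr1.
    by move=> k kl; rewrite scalrfctE /dl eq_sym (negPf kl) scaler0.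
  rewrite (lin_sum cl); apply: eq_bigr => k _.
  by rewrite (linZ gl) (linZ cl) /GRing.scale /= mulrC.
have Ur : U (\sum_k c (dl k) *: b k).
  by apply: sub_sum => // k _; exact: subZ.
have := s0E _ Ur; rewrite -sE // cE // cs => s1.
have : (1 : K) = 0.
  by apply: s1 => f Lf; rewrite cE; [apply: cL'; exists f|exact: Ll].
by move/eqP; rewrite oner_eq0.
Qed.

End LinearForms.

(** * Homogeneous components *)

Section Components.
Variables (K : fieldType) (H : zmodType).
Implicit Types V W : grspace K H.

Lemma homog_sub V h : is_subspace (@homog K H V h).
Proof. exact: (comp_direct V).1. Qed.

Lemma gcomp_id V h (x : V) : homog h x -> gcomp h x = x.
Proof. by move=> hx; rewrite /gcomp (dcomp_homog _ _ hx) eqxx. Qed.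

Lemma gcomp_other V h k (x : V) : homog k x -> h <> k -> gcomp h x = 0.
Proof. by move=> hx /eqP/negPf hk; rewrite /gcomp (dcomp_homog _ _ hx) hk. Qed.

Lemma gcomp_expand V (x : V) : exists X : {fset H},
  (forall h, h \notin X -> gcomp h x = 0) /\ x = \sum_(h <- X) gcomp h x.
Proof.
have [X X0] := dcomp_fin (comp_direct V) x.
by exists X; split => //; exact: dcomp_sum.
Qed.

Lemma gcomp_ind V (P : set V) x :
  is_subspace P -> (forall h, P (gcomp h x)) -> P x.
Proof.
by move=> Ps Px; have [X [_ ->]] := gcomp_expand x; apply: sub_sum.
Qed.

Lemma gcomp_eq0 V (x : V) : (forall h, gcomp h x = 0) -> x = 0.
Proof.
by move=> x0; have [X [_ ->]] := gcomp_expand x; rewrite big1.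
Qed.

Lemma lin_gcomp V (W : lmodType K) (g : V -> W) d x : linear g ->
  (forall h, h <> d -> g (gcomp h x) = 0) -> g x = g (gcomp d x).
Proof.
move=> gl g0; have [X [X0 xE]] := gcomp_expand x.
rewrite {1}xE (lin_sum gl); apply: (fset_sum1 (t := d)) => [h _|dX].
  exact: g0.
by rewrite X0 // (lin0 gl).
Qed.

Lemma gcomp_deg V W (f : V -> W) d : linear f ->
  (forall h x, homog h x -> homog (h + d) (f x)) ->
  forall h x, gcomp h (f x) = f (gcomp (h - d) x).
Proof.
move=> fl fh h x.
rewrite (lin_gcomp (g := fun x => gcomp h (f x)) (d := h - d)) => [||k kh].
- by apply: gcomp_id; rewrite -{1}[h](subrK d); exact/fh/gcomp_in.
- exact: lin_comp (gcomp_lin h) fl.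
- apply: (@gcomp_other _ _ (k + d)); first exact/fh/gcomp_in.
  by move=> hk; apply: kh; rewrite hk addrK.
Qed.

End Components.

Section ModuleBasics.
Variables (K : fieldType) (H : zmodType) (A : gralgebra K H).
Variables (I : choiceType) (e : I -> A) (s : side).
Hypothesis he : distinguished_family e.

Local Notation "a *o b" := (sided_mul s a b) (at level 40, left associativity).

Section OneModule.
Variable M : grmod A s.
Implicit Types x y : M.

Lemma act0l x : (0 : A) ** x = 0. Proof. exact: (lin0 (act_linl x)). Qed.
Lemma act0r a : a ** (0 : M) = 0. Proof. exact: (lin0 (act_linr a)). Qed.
Lemma actDl a b x : (a + b) ** x = a ** x + b ** x.
Proof. exact: (linD (act_linl x)). Qed.
Lemma actDr a x y : a ** (x + y) = a ** x + a ** y.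
Proof. exact: (linD (act_linr a)). Qed.
Lemma actBr a x y : a ** (x - y) = a ** x - a ** y.
Proof. exact: (linB (act_linr a)). Qed.
Lemma actZl c a x : (c *: a) ** x = c *: (a ** x).
Proof. exact: (linZ (act_linl x)). Qed.

Lemma act_idem i x : e i ** (e i ** x) = e i ** x.
Proof. by rewrite act_assoc sided_idem. Qed.

Lemma act_eq0 x : (forall i, e i ** x = 0) -> x = 0.
Proof. by move=> x0; have [X _ ->] := act_expand he x; rewrite big1. Qed.

Lemma gcomp_actl k a h x :
  homog k a -> gcomp h (a ** x) = a ** gcomp (h - k) x.
Proof.
move=> ka; apply: gcomp_deg; first exact: act_linr.
by move=> l y ly; rewrite addrC; exact: act_comp.
Qed.

Lemma gcomp_actr k a h x :
  homog k x -> gcomp h (a ** x) = gcomp (h - k) a ** x.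
Proof.
move=> kx; apply: (gcomp_deg (f := fun a => a ** x)); first exact: act_linl.
by move=> l y ly; exact: act_comp.
Qed.

Definition piece i h x : M := e i ** gcomp h x.
Definition in_piece i h x : Prop := homog h x /\ e i ** x = x.

Lemma piece_lin i h : linear (piece i h).
Proof. exact: lin_comp (act_linr _) (gcomp_lin h). Qed.

Lemma in_piece_piece i h x : in_piece i h (piece i h x).
Proof. by split; [exact/(act_e_comp he)/gcomp_in|exact: act_idem]. Qed.

Lemma piece_id i h x : in_piece i h x -> piece i h x = x.
Proof. by case=> hx ix; rewrite /piece gcomp_id. Qed.

Lemma in_piece_sub i h : is_subspace (in_piece i h).
Proof.
split=> [|a x y [hx ix] [hy iy]].
  by split; [exact: (homog_sub _ _).1|exact: act0r].
by split; [exact: (homog_sub _ _).2|rewrite act_linr ix iy].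
Qed.

Lemma piece_ind (P : set M) x :
  is_subspace P -> (forall i h, P (piece i h x)) -> P x.
Proof.
move=> Ps Px; apply: gcomp_ind => // h.
have [X _ ->] := act_expand he (gcomp h x).
by apply: sub_sum => // i _; exact: Px.
Qed.

Lemma piece_eq0 x : (forall i h, piece i h x = 0) -> x = 0.
Proof.
move=> x0; apply: gcomp_eq0 => h; apply: act_eq0 => i; exact: x0.
Qed.

Lemma piece_neq0 x : x <> 0 -> exists i h, piece i h x <> 0.
Proof.
move=> x0; apply: contrapT => /forallNP nx; apply: x0.
apply: piece_eq0 => i h; apply: contrapT => px; exact: (nx i (ex_intro _ h px)).
Qed.

End OneModule.

Lemma gcomp_hom (M N : grmod A s) (f : grhom M N) h x :
  gcomp h (f x) = f (gcomp h x).
Proof.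
rewrite -{2}[h]subr0; apply: gcomp_deg; first exact: grhom_lin.
by move=> k y ky; rewrite addr0; exact: grhom_comp.
Qed.

Lemma piece_hom (M N : grmod A s) (f : grhom M N) i h x :
  piece i h (f x) = f (piece i h x).
Proof. by rewrite /piece gcomp_hom grhom_act. Qed.

Lemma in_piece_hom (M N : grmod A s) (f : grhom M N) i h x :
  in_piece i h x -> in_piece i h (f x).
Proof.
by case=> hx ix; split; [exact: grhom_comp|rewrite -grhom_act ix].
Qed.

Lemma hom_inj (M N : grmod A s) (f : grhom M N) :
  (forall x, f x = 0 -> x = 0) -> injective f.
Proof.
move=> f0 x y fxy; apply/eqP; rewrite -subr_eq0; apply/eqP/f0.
by rewrite (linB (grhom_lin f)) fxy subrr.
Qed.

Lemma hom0 (M N : grmod A s) (f : grhom M N) : f 0 = 0.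
Proof. exact: lin0 (grhom_lin f). Qed.

(** ** Corners of the algebra *)

(** [hcorner] for the product of either side, as a condition instead of an image. *)
Definition cor i j h : set A :=
  [set a | [/\ homog h a, e i *o a = a & a *o e j = a]].

Definition crn i j h (a : A) : A := e i *o gcomp h a *o e j.

Implicit Types a b c : A.

Lemma omulA a b c : a *o (b *o c) = a *o b *o c.
Proof. exact: sided_mul_assoc. Qed.

Lemma omulBl a b c : (a - b) *o c = a *o c - b *o c.
Proof. exact: (linB (@sided_mul_linl _ _ _ s c)). Qed.

Lemma omulBr a b c : a *o (b - c) = a *o b - a *o c.
Proof. exact: (linB (@sided_mul_linr _ _ _ s a)). Qed.

Lemma omulDl a b c : (a + b) *o c = a *o c + b *o c.
Proof. exact: (linD (@sided_mul_linl _ _ _ s c)). Qed.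

Lemma omulDr a b c : a *o (b + c) = a *o b + a *o c.
Proof. exact: (linD (@sided_mul_linr _ _ _ s a)). Qed.

Lemma omulZl k a c : (k *: a) *o c = k *: (a *o c).
Proof. exact: (linZ (@sided_mul_linl _ _ _ s c)). Qed.

Lemma omulZr k a c : a *o (k *: c) = k *: (a *o c).
Proof. exact: (linZ (@sided_mul_linr _ _ _ s a)). Qed.

Lemma omul0l (a : A) : (0 : A) *o a = 0.
Proof. exact: (lin0 (@sided_mul_linl _ _ _ s a)). Qed.

Lemma omul0r (a : A) : a *o (0 : A) = 0.
Proof. exact: (lin0 (@sided_mul_linr _ _ _ s a)). Qed.

Lemma e_idem i : e i *o e i = e i. Proof. exact: sided_idem. Qed.

Lemma homog_mul h k (a b : A) : homog h a -> homog k b -> homog (h + k) (a *o b).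
Proof. exact: sided_mul_comp. Qed.

Lemma homog_el h i (a : A) : homog h a -> homog h (e i *o a).
Proof. by move=> ha; rewrite -[h]add0r; apply: homog_mul => //; exact: df_deg0. Qed.

Lemma homog_er h i (a : A) : homog h a -> homog h (a *o e i).
Proof. by move=> ha; rewrite -[h]addr0; apply: homog_mul => //; exact: df_deg0. Qed.

Lemma gcomp_mull k (a : A) h b :
  homog k a -> gcomp h (a *o b) = a *o gcomp (h - k) b.
Proof. exact: (@gcomp_actl (regular he s)). Qed.

Lemma gcomp_mulr k a h (b : A) :
  homog k b -> gcomp h (a *o b) = gcomp (h - k) a *o b.
Proof. exact: (@gcomp_actr (regular he s)). Qed.

Lemma gcomp_el h i (a : A) : gcomp h (e i *o a) = e i *o gcomp h a.
Proof. by rewrite (gcomp_mull _ _ (df_deg0 he i)) subr0. Qed.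

Lemma gcomp_er h i (a : A) : gcomp h (a *o e i) = gcomp h a *o e i.
Proof. by rewrite (gcomp_mulr _ _ (df_deg0 he i)) subr0. Qed.

Lemma cor_sub i j h : is_subspace (cor i j h).
Proof.
split=> [|c a b [ha ia aj] [hb ib bj]].
  by split; [exact: (homog_sub _ _).1|exact: omul0r|exact: omul0l].
split; first exact: (homog_sub _ _).2.
  by rewrite omulDr omulZr ia ib.
by rewrite omulDl omulZl aj bj.
Qed.

Lemma cor_crn i j h a : cor i j h (crn i j h a).
Proof.
split; first exact/homog_er/homog_el/gcomp_in.
  by rewrite /crn !omulA e_idem.
by rewrite /crn -omulA e_idem.
Qed.

Lemma crn_id i j h a : cor i j h a -> crn i j h a = a.
Proof. by case=> ha ia aj; rewrite /crn gcomp_id // ia aj. Qed.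

Lemma crn_lin i j h : linear (crn i j h).
Proof. by move=> c a b; rewrite /crn gcomp_lin omulDr omulZr omulDl omulZl. Qed.

Lemma cor_mul i j k h l a b : cor i j h a -> cor j k l b -> cor i k (h + l) (a *o b).
Proof.
move=> [ha ia aj] [lb jb bk]; split; first exact: homog_mul.
  by rewrite omulA ia.
by rewrite -omulA bk.
Qed.

Lemma cor_e i : cor i i 0 (e i).
Proof. by split; [exact: df_deg0|exact: e_idem|exact: e_idem]. Qed.

Lemma e_orth i j : i <> j -> e i *o e j = 0.
Proof. by move=> /eqP ij; rewrite sided_orth. Qed.

Lemma e_neq0 i : e i <> 0. Proof. exact/eqP/(df_neq0 he). Qed.

Lemma crn_ind (P : set A) a j : a *o e j = a ->
  is_subspace P -> (forall i h, P (crn i j h a)) -> P a.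
Proof.
move=> aj Ps Pa; apply: (@piece_ind (regular he s) P a Ps) => i h.
by have := Pa i h; rewrite /crn -omulA -gcomp_er aj.
Qed.

Lemma piece_act (M : grmod A s) i d k h a (x : M) :
  in_piece k h x -> piece i d (a ** x) = crn i k (d - h) a ** x.
Proof.
by case=> hx kx; rewrite /piece (gcomp_actr _ _ hx) /crn -!act_assoc kx.
Qed.

Lemma act_cor (M : grmod A s) i j h k a (x : M) :
  cor i j h a -> homog k x -> in_piece i (h + k) (a ** x).
Proof.
by case=> ha ia aj kx; split; [exact: act_comp|rewrite act_assoc ia].
Qed.

(** ** Graded submodules *)

Section Submodule.
Variable M : grmod A s.
Implicit Types x y : M.

Lemma gsubP (N : set M) : graded_submodule N <->
  [/\ is_subspace N, forall h x, N x -> N (gcomp h x) &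
      forall a x, N x -> N (a ** x)].
Proof.
split=> [[[Ns Ng] Na]|[Ns Ng Na]].
  split=> // h x Nx; apply: (Ng _ (fun h => gcomp h x) Nx); exact: dcompP.
by split=> //; split=> // x f Nx /(dcompE (comp_direct M)) f_h h; rewrite -f_h; exact: Ng.
Qed.

Lemma gsub_piece (N : set M) i h x : graded_submodule N -> N x -> N (piece i h x).
Proof. by move=> /gsubP[_ Ng Na] Nx; exact/Na/Ng. Qed.

Lemma gsub_neq0 (N : set M) : graded_submodule N -> N <> [set 0] ->
  exists i h x, [/\ N x, in_piece i h x & x <> 0].
Proof.
move=> Ng N0; have [x Nx x0] : exists2 x, N x & x <> 0.
  apply: contrapT => nx; apply: N0; apply/seteqP; split=> [x Nx|_ ->].
    by apply: contrapT => x0; apply: nx; exists x.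
  by case: Ng => [[[]]].
have [i [h px]] := piece_neq0 x0.
by exists i, h, (piece i h x); split => //; [exact: gsub_piece|exact: in_piece_piece].
Qed.

Lemma gsub_n0 (N : set M) x : N x -> x <> 0 -> N <> [set 0].
Proof. by move=> Nx x0 N0; apply: x0; move: Nx; rewrite N0. Qed.

Lemma gsub_cyclic h x : homog h x -> graded_submodule [set a ** x | a in [set: A]].
Proof.
move=> hx; apply/gsubP; split=> [|k _ [a _ <-]|b _ [a _ <-]].
- split=> [|c _ _ [a _ <-] [b _ <-]]; first by exists 0 => //; exact: act0l.
  by exists (c *: a + b) => //; rewrite act_linl.
- by exists (gcomp (k - h) a) => //; rewrite (gcomp_actr _ _ hx).
- by exists (b *o a) => //; rewrite act_assoc.
Qed.

Lemma homog_cyclic h x : homog h x -> [set a ** x | a in [set: A]] x.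
Proof.
move=> hx; have [X _ xE] := act_expand he x; exists (\sum_(i <- X) e i) => //.
by rewrite (lin_sum (act_linl x)) -xE.
Qed.

Lemma simple_cyclic (S : set M) h x : simple_graded_submodule S -> S x ->
  homog h x -> x <> 0 -> S = [set a ** x | a in [set: A]].
Proof.
move=> [Sg S0 Smin] Sx hx x0; have [||//] := Smin _ (gsub_cyclic hx).
- by move=> _ [a _ <-]; case/gsubP: Sg => _ _; exact.
- by move=> X0; case: (gsub_n0 (homog_cyclic hx) x0).
Qed.

Lemma gsubT : graded_submodule [set: M].
Proof. by apply/gsubP; split=> //. Qed.

End Submodule.

Lemma gsub_range (M N : grmod A s) (f : grhom N M) (P : set N) :
  graded_submodule P -> graded_submodule [set f x | x in P].
Proof.
move=> /gsubP[Ps Pg Pa]; apply/gsubP; split=> [|h _ [x Px <-]|a _ [x Px <-]].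
- split=> [|c _ _ [x Px <-] [y Py <-]]; first by exists 0; [exact: Ps.1|exact: hom0].
  by exists (c *: x + y); [exact: Ps.2|rewrite grhom_lin].
- by exists (gcomp h x); [exact: Pg|rewrite gcomp_hom].
- by exists (a ** x); [exact: Pa|rewrite grhom_act].
Qed.


End ModuleBasics.

Arguments piece {K H A I} e {s M} i h x.
Arguments in_piece {K H A I} e {s M} i h x.
Arguments cor {K H A I} e s i j h _.
Arguments crn {K H A I} e s i j h a.

(** * Graded modules cut out of an ambient action *)

(** The graded modules needed below live in spaces of functions on which A acts,
but which are neither graded nor unital. A [gract] records such an ambient
space V with independent subspaces V_h; its part is the span of the e_i V_h,
the largest unital graded module inside. *)
Record gract (K : fieldType) (H : zmodType) (A : gralgebra K H) (s : side) := GrAct {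
  ga_V : lmodType K;
  ga_act : A -> ga_V -> ga_V;
  ga_h : H -> set ga_V;
  ga_sub : forall h, is_subspace (ga_h h);
  ga_indep : forall (X : {fset H}) (f : H -> ga_V),
    (forall h, ga_h h (f h)) -> \sum_(h <- X) f h = 0 ->
    forall h, h \in X -> f h = 0;
  ga_assoc : forall a b x, ga_act a (ga_act b x) = ga_act (sided_mul s a b) x;
  ga_linl : forall h x, ga_h h x -> linear (fun a => ga_act a x);
  ga_linr : forall a, linear (ga_act a);
  ga_comp : forall h k a x, homog h a -> ga_h k x -> ga_h (h + k) (ga_act a x) }.

Inductive add_span (V : zmodType) (S : set V) : V -> Prop :=
| add_span0 : add_span S 0
| add_spanD x y : S x -> add_span S y -> add_span S (x + y).

Section PartSpace.
Variables (K : fieldType) (H : zmodType) (A : gralgebra K H) (I : choiceType).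
Variables (e : I -> A) (s : side) (G : gract A s).

Definition ga_inp : set (ga_V G) :=
  [set x | exists i h, ga_h h x /\ ga_act (e i) x = x].

Definition part_pred : {pred ga_V G} := fun x => `[< add_span ga_inp x >].

Record part_sort := Part { part_val :> ga_V G; part_valP : part_val \in part_pred }.

HB.instance Definition _ := [isSub for part_val].
HB.instance Definition _ := [Choice of part_sort by <:].

Lemma part_span_sub : is_subspace (add_span ga_inp).
Proof.
have spD x y : add_span ga_inp x -> add_span ga_inp y -> add_span ga_inp (x + y).
  by elim=> [|u v Su _ IH] ys; rewrite ?add0r // -addrA; apply: add_spanD => //; exact: IH.
split=> [|a x y xs ys]; first exact: add_span0.
apply: spD => //; elim: xs => [|u v [i [h [hu iu]]] _ IH].
  by rewrite scaler0; exact: add_span0.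
rewrite scalerDr; apply: add_spanD => //; exists i, h; split.
  exact: subZ (ga_sub _ _) _ _ hu.
by rewrite (linZ (ga_linr _)) iu.
Qed.

Lemma part_submod_closed : submod_closed part_pred.
Proof.
split=> [|a x y /asboolP xs /asboolP ys]; apply/asboolP.
  exact: part_span_sub.1.
exact: part_span_sub.2.
Qed.

HB.instance Definition _ := GRing.isSubmodClosed.Build _ _ part_pred
  part_submod_closed.
HB.instance Definition _ := [SubChoice_isSubLmodule of part_sort by <:].

Lemma part_valI (u v : part_sort) : part_val u = part_val v -> u = v.
Proof. exact: val_inj. Qed.

Lemma part_val_lin : linear (part_val : part_sort -> ga_V G).
Proof. by []. Qed.

Lemma part_valE x : add_span ga_inp x -> exists u : part_sort, part_val u = x.
Proof. by move=> xs; exists (Part (asboolT xs)). Qed.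

Lemma part_ind (P : part_sort -> Prop) : P 0 ->
  (forall u v i h, ga_h h (part_val u) -> ga_act (e i) u = part_val u ->
     P v -> P (u + v)) ->
  forall u, P u.
Proof.
move=> P0 PD u; have /asboolP us := part_valP u.
move uE: (part_val u) us => x xs.
elim: xs u uE => [|y z [i [h [hy iy]]] zs IH] u uE.
  by rewrite (_ : u = 0) //; exact: part_valI.
have [|v vE] := @part_valE y.
  by rewrite -[y]addr0; apply: add_spanD; [exists i, h|exact: add_span0].
have [w wE] := part_valE zs.
have -> : u = v + w by apply: part_valI; rewrite uE (linD part_val_lin) vE wE.
by apply: (PD _ _ i h); rewrite ?vE //; exact: IH.
Qed.

End PartSpace.

Arguments part_pred {K H A I} e {s} G _.
Arguments part_span_sub {K H A I} e {s} G.
Arguments ga_inp {K H A I} e {s G} _.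
Arguments part_val_lin {K H A I e s G}.

Section PartModule.
Variables (K : fieldType) (H : zmodType) (A : gralgebra K H) (I : choiceType).
Variables (e : I -> A) (s : side) (he : distinguished_family e) (G : gract A s).

Local Notation "a *o b" := (sided_mul s a b) (at level 40, left associativity).
Local Notation P := (part_sort e G).

Definition part_comp (h : H) : set P := [set u | ga_h h (part_val u)].

Let pv_sum (T : Type) (r : seq T) (f : T -> P) :
  part_val (\sum_(i <- r) f i) = \sum_(i <- r) part_val (f i).
Proof. exact: (lin_sum part_val_lin). Qed.

Lemma part_comp_sub h : is_subspace (part_comp h).
Proof.
split=> [|a u v hu hv]; first exact: (ga_sub _ _).1.
exact: (ga_sub _ _).2.
Qed.

Lemma part_comp_direct : direct_sum part_comp.
Proof.
split=> [h|u]; first exact: part_comp_sub.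
have [f fP] : exists f, decomposes part_comp u f.
  apply: (part_ind (P := fun u => exists f, decomposes part_comp u f)) u.
    exists (fun=> 0); apply/decomposesP; split=> [h|].
      exact: (part_comp_sub h).1.
    by exists fset0 => //; rewrite big_seq_fset0.
  move=> u v i h hu _ [f /decomposesP[fh [X X0 ->]]].
  exists (fun k => (if k == h then u else 0) + f k); apply/decomposesP; split.
    move=> k; apply: subD => //; first exact: part_comp_sub.
    by case: eqP => [->//|_]; exact: (part_comp_sub k).1.
  exists (h |` X)%fset => [k|].
    by rewrite !inE negb_or => /andP[/negPf -> /X0 ->]; rewrite addr0.
  rewrite big_split /=; congr (_ + _).
    rewrite (big_fsetD1 h) ?fset1U1 //= eqxx big1_seq ?addr0 // => k.
    by rewrite !inE => /andP[_ /andP[/negPf ->]].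
  by apply: big_fset_incl => [|k _ /X0 //]; exact: fsubsetUr.
exists f; split=> // g /decomposesP[gh [Y Y0 uY]].
move/decomposesP: fP => [fh [X X0 uX]].
apply/funext => h; have [hXY|] := boolP (h \in X `|` Y)%fset; last first.
  by rewrite inE negb_or => /andP[/X0 -> /Y0 ->].
apply: part_valI; apply/eqP; rewrite -subr_eq0 -(linB part_val_lin).
apply/eqP; apply: (ga_indep (f := fun k => part_val (f k - g k))) hXY.
  by move=> k; apply: (subB (part_comp_sub k)).
rewrite -pv_sum sumrB -(big_fset_incl _ (A := X) (B := (X `|` Y)%fset)) ?fsubsetUl //; last first.
  by move=> k _ /X0.
rewrite -(big_fset_incl _ (A := Y) (B := (X `|` Y)%fset)) ?fsubsetUr //; last by move=> k _ /Y0.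
by rewrite -uX -uY subrr.
Qed.

Definition part_space : grspace K H := GrSpace part_comp_direct.

Lemma part_linl (u : P) : linear (fun a : A => ga_act a (part_val u)).
Proof.
elim/part_ind: u => [|u v i h hu _ vl] c a b.
  by rewrite !(lin0 (ga_linr _)) scaler0 addr0.
rewrite !(linD part_val_lin) !(linD (ga_linr _)) vl (ga_linl hu).
by rewrite scalerDr addrACA.
Qed.

Lemma part_act_subproof (a : A) (u : P) : ga_act a (part_val u) \in part_pred e G.
Proof.
apply/asboolP; have Ss := part_span_sub e G.
elim/part_ind: u => [|u v i h hu _ vs].
  by rewrite (lin0 (ga_linr _)); exact: Ss.1.
rewrite (linD part_val_lin) (linD (ga_linr _)); apply: subD => //.
apply: (@piece_ind _ _ _ _ _ s he (regular he s)
  (fun a => add_span (ga_inp e) (ga_act a u))) => [|j k].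
  split=> [|c b b' bs b's]; first by rewrite (lin0 (ga_linl hu)); exact: Ss.1.
  by rewrite (ga_linl hu); exact: Ss.2.
rewrite -[ga_act _ _]addr0; apply: add_spanD (add_span0 _).
exists j, (k + h); split.
  by apply: ga_comp => //; case: (in_piece_piece he j k (a : regular he s)).
by rewrite ga_assoc; congr ga_act; exact: (act_idem he (M := regular he s)).
Qed.

Definition part_act (a : A) (u : part_space) : part_space :=
  Part (part_act_subproof a u).

Lemma part_act_assoc a b u : part_act a (part_act b u) = part_act (a *o b) u.
Proof. by apply: part_valI; rewrite /= ga_assoc. Qed.

Lemma part_act_linl u : linear (fun a => part_act a u).
Proof.
move=> c a b; apply: part_valI.
by rewrite part_val_lin /= part_linl.
Qed.

Lemma part_act_linr a : linear (part_act a).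
Proof.
move=> c u v; apply: part_valI.
by rewrite part_val_lin /= -ga_linr.
Qed.

Lemma part_act_comp h k a (u : part_space) :
  homog h a -> homog k u -> homog (h + k) (part_act a u).
Proof. by move=> ha ku; exact: ga_comp. Qed.

Lemma part_act_unital (u : part_space) :
  exists (n : nat) (a : 'I_n -> A) (y : 'I_n -> part_space),
    u = \sum_k part_act (a k) (y k).
Proof.
elim/part_ind: (u : P) => [|v w i h _ iv [n [a [y ->]]]].
  by exists 0, (fun=> 0), (fun=> 0); rewrite big_ord0.
exists n.+1, (fun k => oapp a (e i) (unlift ord0 k)),
  (fun k => oapp y v (unlift ord0 k)).
rewrite big_ord_recl unlift_none /=; congr (_ + _).
  exact: part_valI.
by apply: eq_bigr => k _; rewrite liftK.
Qed.

Definition part : grmod A s :=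
  @GrMod K H A s part_space part_act part_act_assoc part_act_linl part_act_linr
    part_act_comp part_act_unital.

(** Maps into a part are maps into the ambient space: unitality of the source
makes the values land in the part. *)
Lemma part_hom (X : grmod A s) (f : X -> ga_V G) : linear f ->
  (forall a x, f (act a x) = ga_act a (f x)) ->
  (forall h x, homog h x -> ga_h h (f x)) ->
  exists g : grhom X part, forall x, part_val (g x) = f x.
Proof.
move=> fl fa fh; have Ss := part_span_sub e G.
have fP x : f x \in part_pred e G.
  apply/asboolP; apply: (@piece_ind _ _ _ _ _ s he X
      (fun x => add_span (ga_inp e) (f x))) => [|i h].
    split=> [|c u v us vs]; first by rewrite (lin0 fl); exact: Ss.1.
    by rewrite fl; exact: Ss.2.
  have [hp ip] := in_piece_piece he i h x.
  rewrite -[f _]addr0; apply: add_spanD (add_span0 _).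
  by exists i, h; split; [exact: fh|rewrite -fa ip].
have gl : linear (fun x => Part (fP x) : part).
  by move=> c x y; apply: part_valI; rewrite part_val_lin /= fl.
have ga a x : (Part (fP (act a x)) : part) = act a (Part (fP x) : part).
  by apply: part_valI; rewrite /= fa.
have gh h x : homog h x -> homog h (Part (fP x) : part).
  by move=> hx; exact: fh.
by exists (GrHom gl ga gh).
Qed.

End PartModule.

(** * Submodules, free modules and cofree modules *)

Section Constructions.
Variables (K : fieldType) (H : zmodType) (A : gralgebra K H) (I : choiceType).
Variables (e : I -> A) (s : side) (he : distinguished_family e).

Local Notation "a *o b" := (sided_mul s a b) (at level 40, left associativity).

Section SubModule.
Variables (M : grmod A s) (N : set M) (Ng : graded_submodule N).

Let sub_h h : set M := [set x | N x /\ homog h x].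

Lemma sub_gract_sub h : is_subspace (sub_h h).
Proof.
have /gsubP[Ns _ _] := Ng.
split=> [|a x y [Nx hx] [Ny hy]]; first by split; [exact: Ns.1|exact: (homog_sub _ _).1].
by split; [exact: Ns.2|exact: (homog_sub _ _).2].
Qed.

Lemma sub_gract_indep (X : {fset H}) (f : H -> M) : (forall h, sub_h h (f h)) ->
  \sum_(h <- X) f h = 0 -> forall h, h \in X -> f h = 0.
Proof.
move=> fh f0 h hX; have /(congr1 (gcomp h)) := f0.
rewrite (lin_sum (gcomp_lin h)) (lin0 (gcomp_lin h)) (big_fsetD1 h) //=.
rewrite gcomp_id; last by case: (fh h).
rewrite big1_seq ?addr0 // => k /andP[_]; rewrite !inE => /andP[/eqP kh _].
by apply: (@gcomp_other _ _ _ _ k); [case: (fh k)|exact: nesym].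
Qed.

Lemma sub_gract_comp h k (a : A) x : homog h a -> sub_h k x -> sub_h (h + k) (a ** x).
Proof.
have /gsubP[_ _ Na] := Ng.
by move=> ha [Nx kx]; split; [exact: Na|exact: act_comp].
Qed.

Definition sub_gract : gract A s :=
  @GrAct _ _ A s M (fun a x => a ** x) sub_h sub_gract_sub sub_gract_indep
    (@act_assoc _ _ _ _ M) (fun _ x _ => act_linl x) (@act_linr _ _ _ _ M) sub_gract_comp.

Definition submod : grmod A s := part he sub_gract.

Lemma submod_in (u : submod) : N (part_val u).
Proof.
have /gsubP[Ns _ _] := Ng; elim/part_ind: (u : part_sort e sub_gract).
  exact: Ns.1.
move=> v w i h [Nv _] _ Nw; rewrite (linD part_val_lin).
exact: subD.
Qed.

Definition submod_incl : grhom submod M.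
Proof.
exists (fun u : part_sort e sub_gract => part_val u : M) => //.
by move=> h u [].
Defined.

Lemma submod_incl_inj : injective submod_incl.
Proof.
by move=> u v uv; apply: (part_valI (u := u : part_sort e sub_gract)).
Qed.

Lemma submod_inclP x : N x -> exists u : submod, submod_incl u = x.
Proof.
have /gsubP[Ns Nh _] := Ng => Nx; apply: part_valE.
have Ss := part_span_sub e sub_gract.
apply: (piece_ind (P := fun x => add_span _ x) he) => // i h.
rewrite -[piece _ _ _ _]addr0; apply: add_spanD (add_span0 _).
have [hp ip] := in_piece_piece he i h x.
by exists i, h; split=> //; split=> //; exact: gsub_piece.
Qed.

End SubModule.

(** [free j d Z] is the direct sum of copies of A e_(j t), for t in Z, with
generator in degree d t, as functions of finite support on the index type. *)
Section Free.
Variables (T : choiceType) (j : T -> I) (d : T -> H) (Z : set T).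

Definition free_h h : set (T -> A) := [set F |
  [/\ forall t, homog (h - d t) (F t), forall t, F t *o e (j t) = F t,
      forall t, ~ Z t -> F t = 0 & finite_set [set t | F t != 0]]].

Definition free_act (a : A) (F : T -> A) : T -> A := fun t => a *o F t.

Lemma free_gract_sub h : is_subspace (free_h h).
Proof.
split=> [|c F G [Fh Fj FZ Ff] [Gh Gj GZ Gf]].
  split=> [t|t|//|]; first exact: (homog_sub _ _).1.
  - exact: omul0l.
  - by apply: sub_finite_set (finite_set0 _) => t /=; rewrite eqxx.
split=> [t|t|t Zt|].
- exact: (homog_sub _ _).2.
- rewrite [(_ + _) t](_ : _ = c *: F t + G t) // omulDl omulZl.
  by rewrite Fj Gj.
- rewrite [(_ + _) t](_ : _ = c *: F t + G t) //.
  by rewrite FZ // GZ // scaler0 addr0.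
- apply: sub_finite_set (_ : finite_set (_ `|` _)); last first.
    by rewrite finite_setU; split; [exact: Ff|exact: Gf].
  move=> t /= FGt; have [Ft|Ft] := eqVneq (F t) 0; last by left.
  right; apply: contraNneq FGt => Gt.
  change (c *: F t + G t == 0).
  by rewrite Ft Gt scaler0 addr0.
Qed.

Lemma free_gract_indep (X : {fset H}) (f : H -> T -> A) :
  (forall h, free_h h (f h)) ->
  \sum_(h <- X) f h = 0 -> forall h, h \in X -> f h = 0.
Proof.
move=> fh f0 h hX; apply/funext => t.
have /(congr1 (fun F => gcomp (h - d t) (F t))) := f0.
rewrite fct_sumE (lin_sum (gcomp_lin _)) (lin0 (gcomp_lin _)) (big_fsetD1 h) //=.
rewrite gcomp_id; last by case: (fh h).
rewrite big1_seq ?addr0 // => k /andP[_]; rewrite !inE => /andP[/eqP kh _].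
apply: (@gcomp_other _ _ _ _ (k - d t)); first by case: (fh k).
by move/addIr/esym.
Qed.

Lemma free_gract_comp h k a F :
  homog h a -> free_h k F -> free_h (h + k) (free_act a F).
Proof.
move=> ha [Fh Fj FZ Ff]; split=> [t|t|t Zt|].
- by rewrite -addrA; apply: homog_mul.
- by rewrite /free_act -omulA Fj.
- by rewrite /free_act FZ // omul0r.
- apply: sub_finite_set Ff => t /=; apply: contraNneq => Ft.
  by rewrite /free_act Ft omul0r.
Qed.

Lemma free_gract_linl h F : free_h h F -> linear (fun a => free_act a F).
Proof. by move=> _ c a b; apply/funext => t; exact: sided_mul_linl. Qed.

Lemma free_gract_linr a : linear (free_act a).
Proof. by move=> c F G; apply/funext => t; exact: sided_mul_linr. Qed.

Lemma free_gract_assoc a b F : free_act a (free_act b F) = free_act (a *o b) F.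
Proof. by apply/funext => t; exact: omulA. Qed.

Definition free_gract : gract A s :=
  @GrAct _ _ A s (T -> A) free_act free_h free_gract_sub free_gract_indep
    free_gract_assoc free_gract_linl free_gract_linr free_gract_comp.

Definition free : grmod A s := part he free_gract.

Definition coef (u : free) (t : T) : A := part_val u t.

Arguments coef : simpl never.

Lemma coefI (u v : free) : (forall t, coef u t = coef v t) -> u = v.
Proof. by move=> uv; apply: part_valI; apply/funext. Qed.

Lemma coef_lin t : linear (coef ^~ t).
Proof. by []. Qed.

Lemma coef_act a u t : coef (a ** u) t = a *o coef u t.
Proof. by []. Qed.

Lemma coef_homog h u t : homog h u -> homog (h - d t) (coef u t).
Proof. by case. Qed.

Lemma coef_e u t : coef u t *o e (j t) = coef u t.
Proof.
rewrite /coef; elim/part_ind: (u : part_sort e free_gract).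
  exact: omul0l.
move=> v w i h [_ Fj _ _] _ Nw; rewrite (linD part_val_lin).
rewrite [(_ + _) t](_ : _ = part_val v t + part_val w t) // omulDl.
by rewrite Fj Nw.
Qed.

Lemma coef_Z u t : ~ Z t -> coef u t = 0.
Proof.
rewrite /coef => Zt; elim/part_ind: (u : part_sort e free_gract) => // v w i h.
case=> _ _ FZ _ _ Nw; rewrite (linD part_val_lin).
by rewrite [(_ + _) t](_ : _ = part_val v t + part_val w t) // FZ // Nw addr0.
Qed.

Lemma coef_fin u : exists X : {fset T}, forall t, t \notin X -> coef u t = 0.
Proof.
rewrite /coef; elim/part_ind: (u : part_sort e free_gract); first by exists fset0.
move=> v w i h [_ _ _ /finite_fsetP[X vX]] _ [Y Y0]; exists (X `|` Y)%fset => t.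
rewrite inE negb_or => /andP[tX tY]; rewrite (linD part_val_lin).
rewrite [(_ + _) t](_ : _ = part_val v t + part_val w t) // Y0 // addr0.
apply/eqP; apply: contraNT tX => vt; have : [set` X] t by rewrite -vX.
by [].
Qed.

Lemma free_mkE (F : T -> A) i h : free_h h F -> (forall t, e i *o F t = F t) ->
  exists u : free, in_piece e i h u /\ forall t, coef u t = F t.
Proof.
move=> Fh Fi; have [|u uE] := @part_valE _ _ _ _ e _ free_gract F.
  rewrite -[F]addr0; apply: add_spanD (add_span0 _).
  by exists i, h; split=> //; exact/funext.
exists u; split=> [|t]; last by rewrite /coef uE.
split; last by apply: part_valI; rewrite /= uE; exact/funext.
by change (free_h h (part_val u)); rewrite uE.
Qed.

Lemma free_bas_subproof t : exists u : free,
  (Z t -> in_piece e (j t) (d t) u) /\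
  forall t', coef u t' = if (t' == t) && `[< Z t >] then e (j t) else 0.
Proof.
have [Zt|Zt] := asboolP (Z t); last by exists 0; split=> // t'; rewrite andbF.
have [|t'|u [ui uE]] := @free_mkE (fun t' => if t' == t then e (j t) else 0)
    (j t) (d t); last by exists u; split=> // t'; rewrite andbT.
- split=> [t'|t'|t'|]; first by case: eqP => [->|_]; [rewrite subrr; exact: df_deg0|exact: (homog_sub _ _).1].
  + by case: eqP => [->|_]; [exact: e_idem|exact: omul0l].
  + by case: eqP => [->|].
  + apply: sub_finite_set (finite_set1 t) => t' /=.
    by case: (t' =P t) => [->//|_]; rewrite eqxx.
- by case: eqP => [_|_]; [exact: e_idem|exact: omul0r].
Qed.

Definition bas t : free := projT1 (cid (free_bas_subproof t)).

Lemma in_piece_bas t : Z t -> in_piece e (j t) (d t) (bas t).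
Proof. by rewrite /bas; case: cid => u []. Qed.

Lemma coef_basZ t t' : Z t -> coef (bas t) t' = if t' == t then e (j t) else 0.
Proof. by rewrite /bas; case: cid => u [_ /= ->] Zt; rewrite asboolT // andbT. Qed.

Section Hom.
Variables (M : grmod A s) (x : T -> M).
Hypothesis xi : forall t, Z t -> in_piece e (j t) (d t) (x t).

Definition free_eval (u : free) : M := \sum_(t \in [set: T]) (coef u t ** x t).

Lemma free_evalE (u : free) (X : {fset T}) :
  (forall t, t \notin X -> coef u t = 0) ->
  free_eval u = \sum_(t <- X) (coef u t ** x t).
Proof.
by move=> X0; rewrite /free_eval; apply: fsbigTE => t /X0 ->; exact: act0l.
Qed.

Lemma free_eval_lin : linear free_eval.
Proof.
move=> c u v; have [X X0] := coef_fin u; have [Y Y0] := coef_fin v.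
have XY t : t \notin (X `|` Y)%fset -> coef u t = 0 /\ coef v t = 0.
  by rewrite inE negb_or => /andP[/X0 -> /Y0 ->].
have cXY t : t \notin (X `|` Y)%fset -> coef (c *: u + v) t = 0.
  by move=> /XY[u0 v0]; rewrite coef_lin u0 v0 scaler0 addr0.
rewrite (free_evalE cXY) (@free_evalE u (X `|` Y)%fset) => [|t /XY[]//].
rewrite (@free_evalE v (X `|` Y)%fset) => [|t /XY[]//].
rewrite scaler_sumr -big_split /=; apply: eq_bigr => t _.
by rewrite coef_lin actDl actZl.
Qed.

Lemma free_eval_act a u : free_eval (a ** u) = a ** free_eval u.
Proof.
have [X X0] := coef_fin u; rewrite (free_evalE X0) (@free_evalE _ X).
  rewrite (lin_sum (act_linr a)); apply: eq_bigr => t _.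
  by rewrite coef_act act_assoc.
by move=> t /X0; rewrite coef_act => ->; exact: omul0r.
Qed.

Lemma free_eval_homog h u : homog h u -> homog h (free_eval u).
Proof.
move=> hu; have [X X0] := coef_fin u; rewrite (free_evalE X0).
apply: sub_sum => [|t _]; first exact: homog_sub.
have [Zt|Zt] := pselect (Z t); last first.
  by rewrite coef_Z // act0l; exact: (homog_sub _ _).1.
by rewrite -[h](subrK (d t)); apply: act_comp; [exact: coef_homog|case: (xi Zt)].
Qed.

(** The homomorphism that sends each generator to a prescribed element of the same
piece. *)
Definition free_hom : grhom free M :=
  GrHom free_eval_lin free_eval_act free_eval_homog.

Lemma free_hom_bas t : Z t -> free_hom (bas t) = x t.
Proof.
move=> Zt; rewrite /= (@free_evalE _ [fset t]%fset).
  by rewrite big_seq_fset1 coef_basZ // eqxx; case: (xi Zt).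
by move=> t'; rewrite coef_basZ // !inE => /negPf ->.
Qed.

End Hom.

Lemma free_expand (u : free) (X : {fset T}) :
  (forall t, t \notin X -> coef u t = 0) ->
  u = \sum_(t <- X) (coef u t ** bas t).
Proof.
move=> X0; apply: coefI => t; rewrite (lin_sum (coef_lin t)).
have bE t' : coef (coef u t' ** bas t') t = if t' == t then coef u t' else 0.
  have [Zt|Zt] := pselect (Z t'); last first.
    by rewrite (coef_Z _ Zt) act0l; case: eqP.
  rewrite coef_act coef_basZ // eq_sym; case: eqP => _; first exact: coef_e.
  exact: omul0r.
under eq_bigr do rewrite bE.
rewrite (fset_sum1 (t := t)) ?eqxx // => [t' _|tX]; first by case: eqP.
by rewrite X0.
Qed.

Lemma free_hom_expand (M : grmod A s) (f : grhom free M) (u : free) (X : {fset T}) :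
  (forall t, t \notin X -> coef u t = 0) ->
  f u = \sum_(t <- X) (coef u t ** f (bas t)).
Proof.
move=> X0; rewrite {1}(free_expand X0) (lin_sum (grhom_lin f)).
by apply: eq_bigr => t _; rewrite grhom_act.
Qed.

End Free.

(** [cofree i d] is the graded product over t of the duals of e_(i t) A, shifted
by d t. Its elements are families of linear forms on A. *)
Section Cofree.
Variables (T : Type) (i : T -> I) (d : T -> H).

Definition cofree_h h : set (T -> A -> K^o) := [set F | forall t,
  [/\ linear (F t), forall a, F t (e (i t) *o a) = F t a &
      forall k a, homog k a -> k <> d t - h -> F t a = 0]].

Definition cofree_act (b : A) (F : T -> A -> K^o) : T -> A -> K^o :=
  fun t a => F t (a *o b).

Lemma cofree_gract_sub h : is_subspace (cofree_h h).
Proof.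
split=> [t|c F G Fh Gh t].
  by split=> // b x y; rewrite scaler0 addr0.
have [Fl Fi F0] := Fh t; have [Gl Gi G0] := Gh t.
have E a : (c *: F + G) t a = c *: F t a + G t a by [].
split=> [b x y|a|k a ka kd]; rewrite !E.
- rewrite Fl Gl !scalerDr !scalerA [b * c]mulrC -!addrA; congr (_ + _).
  by rewrite addrCA.
- by rewrite Fi Gi.
- by rewrite (F0 _ _ ka kd) (G0 _ _ ka kd) scaler0 addr0.
Qed.

Lemma cofree_gract_indep (X : {fset H}) (f : H -> T -> A -> K^o) :
  (forall h, cofree_h h (f h)) ->
  \sum_(h <- X) f h = 0 -> forall h, h \in X -> f h = 0.
Proof.
move=> fh f0 h hX; apply/funext => t; apply/funext => a.
have fl k : linear (f k t) by case: (fh k t).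
apply: (gcomp_ind (P := fun a => f h t a = 0)) => [|l].
  by split=> [|c x y x0 y0]; rewrite ?(lin0 (fl h)) // fl x0 y0 scaler0 addr0.
have lin k : k <> h -> l = d t - h -> f k t (gcomp l a) = 0.
  move=> kh ll; have [_ _] := fh k t; apply; first exact: gcomp_in.
  by rewrite ll => /addrI/oppr_inj/esym.
have [ll|ll] := eqVneq l (d t - h); last first.
  by have [_ _] := fh h t; apply; [exact: gcomp_in|exact/eqP].
have /(congr1 (fun F => F t (gcomp l a))) := f0.
rewrite fct_sumE fct_sumE (big_fsetD1 h) //= big1_seq ?addr0 // => k /andP[_].
by rewrite !inE => /andP[/eqP kh _]; exact: lin.
Qed.

Lemma cofree_gract_comp h k b F :
  homog h b -> cofree_h k F -> cofree_h (h + k) (cofree_act b F).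
Proof.
move=> hb Fh t; have [Fl Fi F0] := Fh t; split=> [c x y|a|l a la ld].
- by rewrite /cofree_act omulDl omulZl Fl.
- by rewrite /cofree_act -omulA Fi.
- apply: (F0 (l + h)); first exact: homog_mul.
  by move=> E; apply: ld; rewrite opprD addrCA addrC -E addrK.
Qed.

Lemma cofree_gract_linl h F : cofree_h h F -> linear (fun b => cofree_act b F).
Proof.
move=> Fh c a b; apply/funext => t; apply/funext => x.
have [Fl _ _] := Fh t.
by rewrite /cofree_act omulDr omulZr Fl.
Qed.

Lemma cofree_gract_linr b : linear (cofree_act b).
Proof. by move=> c F G. Qed.

Lemma cofree_gract_assoc a b F :
  cofree_act a (cofree_act b F) = cofree_act (a *o b) F.
Proof.
by apply/funext => t; apply/funext => x; rewrite /cofree_act omulA.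
Qed.

Definition cofree_gract : gract A s :=
  @GrAct _ _ A s (T -> A -> K^o) cofree_act cofree_h cofree_gract_sub
    cofree_gract_indep cofree_gract_assoc cofree_gract_linl cofree_gract_linr
    cofree_gract_comp.

Definition cofree : grmod A s := part he cofree_gract.

Definition cval (u : cofree) (t : T) : A -> K^o := part_val u t.

Arguments cval : simpl never.

Lemma cvalI (u v : cofree) : (forall t a, cval u t a = cval v t a) -> u = v.
Proof.
by move=> uv; apply: part_valI; apply/funext => t; apply/funext => a; exact: uv.
Qed.

Lemma cval_act b u t a : cval (b ** u) t a = cval u t (a *o b).
Proof. by []. Qed.

Lemma cval_linu t a : linear (fun u => cval u t a).
Proof. by []. Qed.

Lemma cval_lin u t : linear (cval u t).
Proof.
rewrite /cval; elim/part_ind: (u : part_sort e cofree_gract) => [c a b|].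
  by rewrite scaler0 addr0.
move=> v w k h vh _ wl c a b; have [vl _ _] := vh t.
rewrite (linD part_val_lin) !fctE vl wl scalerDr -!addrA; congr (_ + _).
by rewrite addrCA.
Qed.

Lemma cval_e u t a : cval u t (e (i t) *o a) = cval u t a.
Proof.
rewrite /cval; elim/part_ind: (u : part_sort e cofree_gract) => // v w k h vh _ wi.
by have [_ vi _] := vh t; rewrite (linD part_val_lin) !fctE vi wi.
Qed.

Lemma cval_homog u t h k a : homog h u -> homog k a -> k <> d t - h ->
  cval u t a = 0.
Proof. by move=> hu; have [_ _ F0] := hu t; exact: F0. Qed.

(** A homomorphism f to the cofree module is determined by the forms
x |-> f(x)(t)(e_(i t)), because f(x)(t)(a) = f(a x)(t)(e_(i t)); conversely these
forms can be chosen freely, supported on one piece each. *)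
Lemma cofree_hom (X : grmod A s) (g : T -> X -> K^o) :
  (forall t, linear (g t)) -> exists f : grhom X cofree,
    forall x t a, cval (f x) t a = g t (piece e (i t) (d t) (a ** x)).
Proof.
move=> gl; have [c x y|b x|h x hx t|f fE] := part_hom he (G := cofree_gract)
  (f := fun x t a => g t (piece e (i t) (d t) (a ** x))).
- apply/funext => t; apply/funext => a.
  by rewrite act_linr piece_lin gl.
- by apply/funext => t; apply/funext => a; rewrite act_assoc.
- split=> [c a b|a|k a ka kd].
  + by rewrite act_linl piece_lin gl.
  + by rewrite -act_assoc /piece (gcomp_act_e he) act_idem.
  + rewrite /piece (@gcomp_other _ _ _ _ (k + h)) ?act0r ?(lin0 (gl t)) //.
      exact: act_comp.
    by move=> E; apply: kd; rewrite E addrK.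
by exists f => x t a; rewrite /cval fE.
Qed.

Lemma cofree_mkE (F : T -> A -> K^o) k h : cofree_h h F ->
  (forall t a, F t (a *o e k) = F t a) ->
  exists u : cofree, in_piece e k h u /\ forall t a, cval u t a = F t a.
Proof.
move=> Fh Fi; have [|u uE] := @part_valE _ _ _ _ e _ cofree_gract F.
  rewrite -[F]addr0; apply: add_spanD (add_span0 _).
  exists k, h; split=> //.
  by apply/funext => t; apply/funext => a; exact: Fi.
exists u; split=> [|t a]; last by rewrite /cval uE.
split; first by change (cofree_h h (part_val u)); rewrite uE.
by apply: cvalI => t a; rewrite cval_act /cval uE Fi.
Qed.

End Cofree.

End Constructions.

(** * Projective and injective graded modules *)

Section Homological.
Variables (K : fieldType) (H : zmodType) (A : gralgebra K H) (I : choiceType).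
Variables (e : I -> A) (s : side) (he : distinguished_family e).

Local Notation "a *o b" := (sided_mul s a b) (at level 40, left associativity).
Local Notation C := (grmod_cat A s).
Implicit Types M N X Y : grmod A s.

Definition zero_hom X Y : grhom X Y.
Proof.
exists (fun=> 0) => [a x y|a x|h x _].
- by rewrite scaler0 addr0.
- by rewrite act0r.
- exact: (homog_sub _ _).1.
Defined.

Lemma inj_mono X Y (m : grhom X Y) : injective m -> @monomorphism C X Y m.
Proof.
move=> mi Z g h gh; apply: grhomP => z; apply: mi.
exact: (congr1 (fun f : grhom Z Y => f z) gh).
Qed.

Lemma surj_epi X Y (p : grhom X Y) :
  (forall y, exists x, p x = y) -> @epimorphism C X Y p.
Proof.
move=> ps Z g h gh; apply: grhomP => y; have [x <-] := ps y.
exact: (congr1 (fun f : grhom X Z => f x) gh).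
Qed.

Lemma retract_projective M N (i : grhom N M) (r : grhom M N) :
  (forall x, r (i x) = x) -> projective (C := C) M -> projective (C := C) N.
Proof.
move=> ri Mp X Y p f pe.
have [g gE] := Mp X Y p (grhom_compose f r) pe.
exists (grhom_compose g i : @Defs.hom C N X); apply: grhomP => x.
have := congr1 (fun h : grhom M Y => h (i x)) gE.
by rewrite /= ri.
Qed.

Lemma retract_injective M N (i : grhom N M) (r : grhom M N) :
  (forall x, r (i x) = x) -> injective_obj (C := C) M -> injective_obj (C := C) N.
Proof.
move=> ri Mi X Y m f mm.
have [g gE] := Mi X Y m (grhom_compose i f) mm.
exists (grhom_compose r g : @Defs.hom C Y N); apply: grhomP => x.
have := congr1 (fun h : grhom X M => r (h x)) gE.
by rewrite /= ri.
Qed.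

Lemma injective_retract M N (i : grhom M N) : injective_obj (C := C) M ->
  injective i -> exists r : grhom N M, forall x, r (i x) = x.
Proof.
move=> Mi ii; have [r rE] := Mi M N i (grhom_id M) (inj_mono ii).
by exists r => x; exact: (congr1 (fun h : grhom M M => h x) rE).
Qed.

Lemma projective_section M N (p : grhom N M) : projective (C := C) M ->
  (forall y, exists x, p x = y) -> exists i : grhom M N, forall x, p (i x) = x.
Proof.
move=> Mp ps; have [i iE] := Mp N M p (grhom_id M) (surj_epi ps).
by exists i => x; exact: (congr1 (fun h : grhom M M => h x) iE).
Qed.

Lemma bij_hom_inv M N (f : grhom M N) : injective f ->
  (forall y, exists x, f x = y) ->
  exists g : grhom N M, (forall y, f (g y) = y) /\ (forall x, g (f x) = x).
Proof.
move=> fi /choice[g gE].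
have gl : linear g by move=> a x y; apply: fi; rewrite gE grhom_lin !gE.
have ga a x : g (a ** x) = a ** g x by apply: fi; rewrite grhom_act !gE.
have gh h x : homog h x -> homog h (g x).
  move=> hx; have <- : gcomp h (g x) = g x; last exact: gcomp_in.
  by apply: fi; rewrite -gcomp_hom gE gcomp_id.
by exists (GrHom gl ga gh); split=> [y|x]; [exact: gE|apply: fi; exact: gE].
Qed.

(** ** Free modules *)

Section FreeProjective.
Variables (T : choiceType) (j : T -> I) (d : T -> H) (Z : set T).
Local Notation F := (free s he j d Z).

Lemma free_ext M (f g : grhom F M) :
  (forall t, Z t -> f (bas s he j d Z t) = g (bas s he j d Z t)) ->
  forall u, f u = g u.
Proof.
move=> fg u; have [X X0] := coef_fin u.
rewrite !(free_hom_expand _ X0); apply: eq_bigr => t _.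
have [Zt|Zt] := pselect (Z t); first by rewrite fg.
by rewrite coef_Z // !act0l.
Qed.

End FreeProjective.

(** An element of the kernel in e_i X_h is the image of the generator under a map
from the free module on one generator, which the monomorphism cannot tell from
the zero map. *)
Lemma mono_inj X Y (m : grhom X Y) : @monomorphism C X Y m -> injective m.
Proof.
move=> mm; apply: hom_inj => x mx; apply: (piece_eq0 he) => i h.
pose j (_ : unit) := i; pose d (_ : unit) := h.
have xi (t : unit) : [set: unit] t -> in_piece e (j t) (d t) (piece e i h x).
  by move=> _; exact: in_piece_piece.
have zi (t : unit) : [set: unit] t -> in_piece e (j t) (d t) (0 : X).
  by move=> _; exact: (in_piece_sub _ _ _ _).1.
have E : free_hom he xi = free_hom he zi.
  apply: (mm (free s he j d setT)); apply: grhomP => u.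
  apply: (free_ext (f := grhom_compose m (free_hom he xi))
    (g := grhom_compose m (free_hom he zi))) => t Zt.
  change (m (free_hom he xi (bas s he j d setT t)) =
    m (free_hom he zi (bas s he j d setT t))).
  by rewrite !free_hom_bas // -piece_hom mx hom0 (lin0 (piece_lin _ _ _)).
rewrite -(free_hom_bas he xi (t := tt)) // E.
by rewrite (free_hom_bas he zi (t := tt)).
Qed.

(** ** Cofree modules *)

Section CofreeInjective.
Variables (T : Type) (i : T -> I) (d : T -> H).
Local Notation F := (cofree s he i d).

Lemma cval_piece (u : F) t : cval (piece e (i t) (d t) u) t (e (i t)) = cval u t (e (i t)).
Proof.
rewrite /piece cval_act (sided_idem he).
apply/esym/(lin_gcomp (g := fun u : F => cval u t (e (i t)))) => [|k kd].
  exact: cval_linu.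
apply: (cval_homog (gcomp_in k u) (df_deg0 he (i t))).
by move=> /eqP; rewrite eq_sym subr_eq0 => /eqP/esym.
Qed.

Lemma cval_eval (u : F) t a :
  cval u t a = cval (piece e (i t) (d t) (a ** u)) t (e (i t)).
Proof. by rewrite cval_piece cval_act cval_e. Qed.

(** Homomorphisms to a cofree module are families of linear forms, and linear
forms extend along injections. *)
Lemma cofree_extend X Y (m : grhom X Y) (f : grhom X F) : injective m ->
  exists h : grhom Y F, forall x, h (m x) = f x.
Proof.
move=> mi; pose g t (x : X) : K^o := cval (f x) t (e (i t)).
have gl t : linear (g t).
  exact: (lin_comp (@cval_linu _ _ _ _ _ s he _ i d t (e (i t))) (grhom_lin f)).
have /choice[g' g'P] : forall t, exists g' : Y -> K^o,
    linear g' /\ forall x, g' (m x) = g t x.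
  by move=> t; exact: (ext_along (grhom_lin m)).
have [h hE] := cofree_hom he i d (fun t => (g'P t).1).
exists h => x; apply: cvalI => t a.
rewrite hE -grhom_act piece_hom (g'P t).2 /g -piece_hom grhom_act.
by rewrite -cval_eval.
Qed.

Lemma cofree_injective : injective_obj (C := C) F.
Proof.
move=> X Y m f mm; have [h hE] := cofree_extend f (mono_inj mm).
by exists h; exact: grhomP.
Qed.

End CofreeInjective.

Lemma piece_e M i h (x : M) : piece e i h (e i ** x) = piece e i h x.
Proof. by rewrite /piece (gcomp_act_e he) (act_idem he). Qed.

(** If some e_i Y_h is not in the image, a linear form separating it from the image
is a nonzero map from Y to a cofree module that vanishes on the image. *)
Lemma epi_surj X Y (p : grhom X Y) : @epimorphism C X Y p ->
  forall y, exists x, p x = y.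
Proof.
move=> pe y; apply: contrapT => ny.
have Rs : is_subspace (range p).
  split=> [|c _ _ [u _ <-] [v _ <-]]; first by exists 0 => //; exact: hom0.
  by exists (c *: u + v) => //; rewrite grhom_lin.
have [i [h Ry]] : exists i h, ~ range p (piece e i h y).
  apply: contrapT => /forallNP ne; apply: ny.
  suff [x _ xy] : range p y by exists x.
  apply: (piece_ind he) => // i h; apply: contrapT => ri.
  by apply: (ne i); exists h.
have [g [gl gR gy]] := sep_form Rs Ry.
have [f fE] := cofree_hom he (fun _ : unit => i) (fun=> h) (X := Y) (fun=> gl).
have fp : grhom_compose f p = grhom_compose (zero_hom Y _) p.
  apply: grhomP => x; apply: cvalI => t a /=.
  by rewrite fE -grhom_act piece_hom gR.
have := congr1 (fun k : grhom Y _ => cval (k y) tt (e i)) (pe _ _ _ fp).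
by rewrite fE piece_e gy => /eqP; rewrite oner_eq0.
Qed.

Lemma free_projective (T : choiceType) (j : T -> I) (d : T -> H) (Z : set T) :
  projective (C := C) (free s he j d Z).
Proof.
move=> X Y p f pe; have ps := epi_surj pe.
have /choice[x xP] : forall t, exists x : X, Z t ->
    in_piece e (j t) (d t) x /\ grhom_fun p x = grhom_fun f (bas s he j d Z t).
  move=> t; have [x xE] := ps (grhom_fun f (bas s he j d Z t)).
  exists (piece e (j t) (d t) x) => Zt; split; first exact: in_piece_piece.
  rewrite -piece_hom xE; apply: piece_id; apply: in_piece_hom; exact: in_piece_bas.
have xi t : Z t -> in_piece e (j t) (d t) (x t) by move=> /xP[].
exists (free_hom he xi); apply: grhomP => u.
apply: (free_ext (f := grhom_compose p (free_hom he xi)) (g := f)) => t Zt.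
change (grhom_fun p (free_hom he xi (bas s he j d Z t)) =
  grhom_fun f (bas s he j d Z t)).
by rewrite free_hom_bas // (xP t Zt).2.
Qed.

(** All homogeneous pieces of all elements serve as generators, so that none have
to be chosen. *)
Definition cover M : grmod A s :=
  free s he (fun t : I * H * M => t.1.1) (fun t => t.1.2) setT.

Lemma cover_surj M : exists p : grhom (cover M) M, forall y, exists x, p x = y.
Proof.
pose j (t : I * H * M) := t.1.1; pose d (t : I * H * M) := t.1.2.
have xi t : [set: I * H * M] t -> in_piece e (j t) (d t) (piece e (j t) (d t) t.2).
  by move=> _; exact: in_piece_piece.
exists (free_hom he xi) => y; suff [x _ xy] : range (free_hom he xi) y by exists x.
apply: (piece_ind he) => [|i h].
  split=> [|c _ _ [u _ <-] [v _ <-]]; first by exists 0 => //; exact: hom0.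
  by exists (c *: u + v) => //; rewrite grhom_lin.
exists (bas s he j d setT (i, h, y)) => //.
by rewrite free_hom_bas.
Qed.

Lemma grmod_enough_projectives : enough_projectives C.
Proof.
move=> M; have [p ps] := cover_surj M; exists (cover M), p.
split; [exact: free_projective|exact: surj_epi].
Qed.

Lemma grmod_enough_injectives : enough_injectives C.
Proof.
move=> M; pose T := (I * H * {g : M -> K^o | linear g})%type.
have [f fE] := cofree_hom he (fun t : T => t.1.1) (fun t => t.1.2)
  (fun t => projT2 t.2).
exists (cofree s he (fun t : T => t.1.1) (fun t => t.1.2)), f.
split; first exact: cofree_injective.
apply: inj_mono; apply: hom_inj => x fx.
apply: (piece_eq0 he) => i h; apply: contrapT => px.
have [||g [gl _ gx]] := @sep_form K M [set 0] (piece e i h x) => //.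
  by split=> // a u v -> ->; rewrite scaler0 addr0.
have := fE x (i, h, exist _ g gl) (e i); rewrite fx /= piece_e gx => /esym/eqP.
by rewrite oner_eq0.
Qed.

End Homological.

(** * Socles *)

Section FinitelyCogenerated.
Variables (K : fieldType) (H : zmodType) (A : gralgebra K H) (I : choiceType).
Variables (e : I -> A) (s : side) (he : distinguished_family e).

Variables (M : grmod A s) (V : lmodType K) (T : choiceType) (Z : {fset T}).
Variables (p : T -> M -> V) (tau : T -> M).
Hypotheses (pl : forall t, linear (p t))
  (pker : forall t a x, p t x = 0 -> p t (a ** x) = 0)
  (pinj : forall x, (forall t, t \in Z -> p t x = 0) -> x = 0)
  (tauh : forall t, t \in Z -> exists h, homog h (tau t))
  (tau_off : forall t u, t \in Z -> u \in Z -> t <> u -> p t (tau u) = 0)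
  (tau_diag : forall t, t \in Z -> p t (tau t) <> 0)
  (tau_ess : forall t h x, t \in Z -> homog h x -> p t x <> 0 ->
     exists a k, homog k a /\ p t (a ** x) = p t (tau t)).

Let S : set M := [set x | exists c : T -> A, x = \sum_(t <- Z) (c t ** tau t)].

Let Ssub : is_subspace S.
Proof.
split=> [|k _ _ [c ->] [d ->]].
  by exists (fun=> 0); rewrite big1 // => t _; exact: act0l.
exists (fun t => k *: c t + d t); rewrite scaler_sumr -big_split /=.
by apply: eq_bigr => t _; rewrite act_linl.
Qed.

Let p_sum t (c : T -> A) : t \in Z ->
  p t (\sum_(u <- Z) (c u ** tau u)) = p t (c t ** tau t).
Proof.
move=> tZ; rewrite (lin_sum (pl t)) (big_fsetD1 t) //= big1_seq ?addr0 // => u.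
move=> /andP[_]; rewrite !inE => /andP[/eqP ut uZ]; apply: pker.
by apply: tau_off => //; exact: nesym.
Qed.

(** Multiplying a nonzero element of L successively so that its coordinates
become multiples of the tau t, one after the other. *)
Let meets_S (L : set M) : graded_submodule L -> L <> [set 0] ->
  exists h x, [/\ L x, homog h x, x <> 0 & S x].
Proof.
move=> Lg L0; have /gsubP[_ _ La] := Lg.
suff [h [x [Lx hx x0 [c cE]]]] : exists h x, [/\ L x, homog h x, x <> 0 &
    exists c : T -> A, forall t, t \in (Z : seq T) -> p t x = p t (c t ** tau t)].
  exists h, x; split=> //; exists c; apply/eqP; rewrite -subr_eq0; apply/eqP.
  by apply: pinj => t tZ; rewrite (linB (pl t)) p_sum // cE // subrr.
have : {subset (Z : seq T) <= Z} by [].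
elim: (Z : seq T) => [_|t r IH rZ].
  have [i [h [x [Lx [hx _] x0]]]] := gsub_neq0 he Lg L0.
  by exists h, x; split=> //; exists (fun=> 0).
have tZ : t \in Z by apply: rZ; rewrite inE eqxx.
have [|h [x [Lx hx x0 [c cE]]]] := IH.
  by move=> u ur; apply: rZ; rewrite inE ur orbT.
have [px|px] := pselect (p t x = 0).
  exists h, x; split=> //; exists (fun u => if u == t then 0 else c u) => u.
  rewrite inE; case: eqP => [-> _|_ /= ur]; last exact: cE.
  by rewrite px act0l (lin0 (pl t)).
have [a [k [ka pa]]] := tau_ess tZ hx px.
have [l lt] := tauh tZ; have [b _ bt] := homog_cyclic he lt.
exists (k + h), (a ** x); split.
- exact: La.
- exact: act_comp.
- by move=> ax; apply: (tau_diag tZ); rewrite -pa ax (lin0 (pl t)).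
exists (fun u => if u == t then b else sided_mul s a (c u)) => u.
rewrite inE; case: eqP => [-> _|_ /= ur]; first by rewrite pa bt.
apply/eqP; rewrite -subr_eq0 -(linB (pl u)) -act_assoc -actBr; apply/eqP/pker.
by rewrite (linB (pl u)) cE // subrr.
Qed.

Let tau_simple t : t \in Z ->
  simple_graded_submodule [set a ** tau t | a in [set: A]].
Proof.
move=> tZ; have [l lt] := tauh tZ; split.
- exact: gsub_cyclic lt.
- apply: (gsub_n0 (homog_cyclic he lt)) => t0.
  by apply: (tau_diag tZ); rewrite t0 (lin0 (pl t)).
move=> L Lg LS; have [->|L0] := pselect (L = [set 0]); [by left|right].
have /gsubP[_ _ La] := Lg; apply/seteqP; split=> //.
have [i [h [x [Lx [hx _] x0]]]] := gsub_neq0 he Lg L0.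
have [c _ cx] := LS _ Lx.
have px u : u \in Z -> u <> t -> p u x = 0.
  by move=> uZ ut; rewrite -cx; apply: pker; exact: tau_off.
have ptx : p t x <> 0.
  move=> ptx; apply: x0; apply: pinj => u uZ.
  by have [->//|/eqP ut] := eqVneq u t; exact: px.
have [a [k [_ pa]]] := tau_ess tZ hx ptx.
have <- : a ** x = tau t.
  apply/eqP; rewrite -subr_eq0; apply/eqP/pinj => u uZ; rewrite (linB (pl u)).
  have [->|/eqP ut] := eqVneq u t; first by rewrite pa subrr.
  by rewrite tau_off // subr0; apply: pker; exact: px.
by move=> _ [b _ <-]; exact/La/La.
Qed.

Let socle_sub : graded_socle M `<=` S.
Proof.
move=> _ [n [y [yS ->]]]; apply: (sub_sum _ Ssub) => k _.
have [L Ls Ly] := yS k; have [Lg L0 _] := Ls.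
have [h [x [Lx hx x0 [c xc]]]] := meets_S Lg L0.
move: Ly; rewrite (simple_cyclic he Ls Lx hx x0) => -[a _ <-].
exists (fun t => sided_mul s a (c t)); rewrite xc (lin_sum (act_linr a)).
by apply: eq_bigr => t _; rewrite act_assoc.
Qed.

Let sub_socle : S `<=` graded_socle M.
Proof.
move=> _ [c ->]; exists (size (Z : seq T)).
exists (fun k => c (tnth (in_tuple Z) k) ** tau (tnth (in_tuple Z) k)); split.
  move=> k; exists [set a ** tau (tnth (in_tuple Z) k) | a in [set: A]].
    by apply: tau_simple; exact: mem_tnth.
  by exists (c (tnth (in_tuple Z) k)).
by rewrite big_tnth.
Qed.

(** The socle is the sum of the simple modules A tau_t: every nonzero graded
submodule meets this sum. *)
Lemma coordinates_finitely_cogenerated : finitely_cogenerated M.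
Proof.
split; last first.
  move=> L Lg L0; have [h [x [Lx _ x0 Sx]]] := meets_S Lg L0.
  by apply: (gsub_n0 (x := x)) => //; split => //; exact: sub_socle.
exists (size (Z : seq T)), (fun k => tau (tnth (in_tuple Z) k)); split=> [k|y].
  have tZ : tnth (in_tuple Z) k \in Z by exact: mem_tnth.
  have [l lt] := tauh tZ.
  exists 1, (fun=> tau (tnth (in_tuple Z) k)); split; last by rewrite big_ord1.
  by move=> _; exists [set a ** tau (tnth (in_tuple Z) k) | a in [set: A]];
    [exact: tau_simple|exact: (homog_cyclic he lt)].
move=> /socle_sub[c ->]; exists (fun k => c (tnth (in_tuple Z) k)).
by rewrite big_tnth.
Qed.

End FinitelyCogenerated.

(** * Local corners *)

Section LocalCorner.
Variables (K : fieldType) (H : zmodType) (A : gralgebra K H) (I : choiceType).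
Variables (e : I -> A) (he : weakly_basic e).

Lemma cor_l i j h : cor e lside i j h = hcorner e i j h.
Proof.
apply/seteqP; split=> [a [ha /= ia aj]|_ [a ha <-]].
  by exists a => //; rewrite ia aj.
have := cor_crn lside he i j h a.
by rewrite /crn /= gcomp_id.
Qed.

Lemma cor_r i j h : cor e rside i j h = cor e lside j i h.
Proof. by apply/seteqP; split=> a [ha ia aj]. Qed.

Lemma cor_finite_dim s i j h : finite_dim (cor e s i j h).
Proof. by case: s; rewrite ?cor_r cor_l; exact: (wb_lfd he). Qed.

Lemma proper_left_ideal (R n : set A) (u : A) : R u ->
  (forall r, R r -> mul r u = r) -> left_ideal_of R n -> ~ n u ->
  exists2 m, maximal_left_ideal_of R m & n `<=` m.
Proof.
move=> Ru ru nI nu.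
have [|F [X0 FX0] FP Ft|m [[mI mu] nm mmax]] :=
    @Zorn_above A (fun X => left_ideal_of R X /\ ~ X u) n => //.
  split; last by move=> [X /FP[[]]].
  have FI X : F X -> left_ideal_of R X by move=> /FP[[]].
  split=> [x [X FX]||x y [X FX Xx] [Y FY Yy]|r x Rr [X FX Xx]].
  - by case: (FI X FX) => XR _ _ _; exact: XR.
  - by exists X0 => //; case: (FI _ FX0).
  - have [XY|YX] := Ft _ _ FX FY.
      by exists Y => //; case: (FI _ FY) => _ _ + _; apply => //; exact: XY.
    by exists X => //; case: (FI _ FX) => _ _ + _; apply => //; exact: YX.
  - by exists X => //; case: (FI _ FX) => _ _ _; apply.
exists m => //; split=> // [mR|n' n'I mn']; first by apply: mu; rewrite mR.
have [n'u|n'u] := pselect (n' u); [right|left; exact: mmax].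
apply/seteqP; split=> [|r Rr]; first by case: n'I.
by rewrite -(ru r Rr); case: n'I => _ _ _; apply.
Qed.

Lemma amul0l (a : A) : mul 0 a = 0. Proof. exact: (lin0 (@mul_linl _ _ _ a)). Qed.
Lemma amul0r (a : A) : mul a 0 = 0. Proof. exact: (lin0 (@mul_linr _ _ _ a)). Qed.

Lemma amulBl (a b c : A) : mul (a - b) c = mul a c - mul b c.
Proof. exact: (linB (@mul_linl _ _ _ c)). Qed.
Lemma amulZl (k : K) (a c : A) : mul (k *: a) c = k *: mul a c.
Proof. exact: (linZ (@mul_linl _ _ _ c)). Qed.
Lemma amulBr (a b c : A) : mul a (b - c) = mul a b - mul a c.
Proof. exact: (linB (@mul_linr _ _ _ a)). Qed.

(** The maximal left ideal m contains every proper one. If f is an idempotent other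
than 0 and e_i, both f and e_i - f generate proper left ideals, so e_i is in m.
Outside m, an element r has a left inverse y, and the idempotent r y is e_i. *)
Lemma local_corner i : exists m : set A, [/\ is_subspace m, ~ m (e i) &
  forall r, cor e lside i i 0 r -> ~ m r ->
    exists y, [/\ cor e lside i i 0 y, mul y r = e i & mul r y = e i]] /\
  forall f, cor e lside i i 0 f -> mul f f = f -> f = 0 \/ f = e i.
Proof.
have [m [mM muniq]] := wb_local he i; rewrite -cor_l in mM muniq.
set R := cor e lside i i 0 in mM muniq *.
have Rs : is_subspace R by exact: cor_sub.
have Re : R (e i) by exact: (cor_e lside he i).
have Rm a b : R a -> R b -> R (mul a b).
  by move=> Ra Rb; have := cor_mul (s := lside) Ra Rb; rewrite addr0.
have er r : R r -> mul r (e i) = r by case.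
have el r : R r -> mul (e i) r = r by case.
have [[mR m0 mB mI] mne mmax] := mM.
have mD x y : m x -> m y -> m (x + y).
  by move=> mx /(mB _ _ m0) mNy; rewrite -[y]opprK -[- y]sub0r; exact: mB.
have propm n : left_ideal_of R n -> ~ n (e i) -> n `<=` m.
  move=> nI ne; have [n' n'M nn'] := proper_left_ideal Re er nI ne.
  by rewrite (muniq _ n'M).
have mu : ~ m (e i).
  move=> mu; apply: mne; apply/seteqP; split=> // r Rr; rewrite -(er r Rr).
  exact: mI.
have prI f : R f -> left_ideal_of R [set mul r f | r in R].
  move=> Rf; split=> [_ [r Rr <-]||_ _ [r Rr <-] [t Rt <-]|t _ Rt [r Rr <-]].
  - exact: Rm.
  - by exists 0; [exact: Rs.1|exact: amul0l].
  - by exists (r - t); [exact: subB|exact: amulBl].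
  - by exists (mul t r); [exact: Rm|rewrite mul_assoc].
have idem f : R f -> mul f f = f -> f = 0 \/ f = e i.
  move=> Rf ff; apply: contrapT => /not_orP[f0 fe].
  have Ref : R (e i - f) by exact: subB.
  have mf : m f.
    apply: (propm _ (prI f Rf)) => [[r Rr rf]|]; last by exists (e i); rewrite ?el.
    apply: fe; apply/eqP; rewrite eq_sym -subr_eq0.
    have : mul (mul r f) (e i - f) = 0.
      by rewrite -mul_assoc amulBr er // ff subrr amul0r.
    by rewrite rf el // => ->.
  have mef : m (e i - f).
    apply: (propm _ (prI _ Ref)) => [[r Rr rf]|]; last first.
      by exists (e i); rewrite ?el.
    have : mul (mul r (e i - f)) f = 0.
      by rewrite -mul_assoc amulBl el // ff subrr amul0r.
    by rewrite rf el // => /f0.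
  by apply: mu; rewrite -[e i](subrK f); exact: mD.
exists m; split=> //; split=> //.
  split=> // a x y mx my.
  have maZ : m (a *: x).
    rewrite -(el x (mR x mx)) -amulZl; apply: mI => //.
    exact: subZ.
  exact: mD.
move=> r Rr mr.
have [y Ry yr] : exists2 y, R y & mul y r = e i.
  apply: contrapT => ny; apply: mr.
  apply: (propm _ (prI r Rr)) => [[y Ry yr]|]; last by exists (e i); rewrite ?el.
  by apply: ny; exists y.
exists y; split=> //; have [|ry|//] := idem (mul r y) (Rm _ _ Rr Ry).
  by rewrite mul_assoc -(mul_assoc r) yr er.
by case: mr; rewrite -(er r) // -yr mul_assoc ry amul0l.
Qed.

Lemma corner_unit s i : exists m : set A, [/\ is_subspace m, ~ m (e i) &
  forall r, cor e s i i 0 r -> ~ m r ->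
    exists y, [/\ cor e s i i 0 y, sided_mul s y r = e i & sided_mul s r y = e i]].
Proof.
have [m [[ms me mu] _]] := local_corner i; exists m; split=> // r.
case: s => [|]; first exact: mu.
by rewrite cor_r => Rr /(mu r Rr)[y [Ry yr ry]]; exists y.
Qed.

Lemma corner_idem s i f : cor e s i i 0 f -> sided_mul s f f = f ->
  f = 0 \/ f = e i.
Proof.
have [m [_ fi]] := local_corner i; case: s; first exact: fi.
by rewrite cor_r; exact: fi.
Qed.

End LocalCorner.

(** * Modules dual to a corner e_i A *)

Section Corepresenting.
Variables (K : fieldType) (H : zmodType) (A : gralgebra K H) (I : choiceType).
Variables (e : I -> A) (s : side) (he : weakly_basic e).

Local Notation "a *o b" := (sided_mul s a b) (at level 40, left associativity).
Local Notation C := (grmod_cat A s).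
Implicit Types M N X Y : grmod A s.

(** L exhibits M as the dual of e_i A shifted by d: x in M corresponds to the
form a |-> L (a x) on e_i A. *)
Definition corep M (i : I) (d : H) (L : M -> K^o) : Prop :=
  [/\ linear L, forall x, L (piece e i d x) = L x,
      forall x, (forall a, L (a ** x) = 0) -> x = 0 &
      forall k h (phi : A -> K^o), linear phi -> exists x,
        in_piece e k (d - h) x /\ forall a, cor e s i k h a -> L (a ** x) = phi a].

(** The element x generates a submodule contained in all nonzero graded submodules,
which is therefore a simple essential socle. *)
Definition essential_elt M (i : I) (d : H) (x : M) : Prop :=
  [/\ in_piece e i d x, x <> 0 &
      forall h y, homog h y -> y <> 0 -> exists a, a ** y = x].

Lemma essential_homog M i d (x : M) : essential_elt i d x ->
  forall h y, homog h y -> y <> 0 -> exists a k, homog k a /\ a ** y = x.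
Proof.
move=> [[dx _] _ xe] h y hy y0; have [a ay] := xe h y hy y0.
exists (gcomp (d - h) a), (d - h); split; first exact: gcomp_in.
by rewrite -(gcomp_actr _ _ hy) ay gcomp_id.
Qed.

Lemma essential_inj M N i d (x : M) (f : grhom M N) :
  essential_elt i d x -> f x <> 0 -> injective f.
Proof.
move=> [_ _ xe] fx; apply: hom_inj => y fy; apply: (piece_eq0 he) => k h.
apply: contrapT => py; have [a ay] := xe h _ (in_piece_piece he k h y).1 py.
by apply: fx; rewrite -ay grhom_act -piece_hom fy (lin0 (piece_lin _ _ _)) act0r.
Qed.

Lemma essential_cogenerated M i d (x : M) :
  essential_elt i d x -> finitely_cogenerated M.
Proof.
move=> xe; have [[dx _] x0 _] := xe.
apply: (coordinates_finitely_cogenerated he (V := M) (Z := [fset tt]%fset)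
  (p := fun _ y => y) (tau := fun=> x)) => //.
- by move=> _ a y ->; exact: act0r.
- by move=> y /(_ tt); rewrite inE => ->.
- by move=> _ _; exists d.
- by move=> [] [].
- by move=> _ h y _ hy y0; exact: essential_homog xe _ _ hy y0.
Qed.

Section OneCorep.
Variables (M : grmod A s) (i : I) (d : H) (L : M -> K^o).
Hypothesis ML : corep i d L.

Lemma corep_sep x y : (forall a, L (a ** x) = L (a ** y)) -> x = y.
Proof.
have [Ll _ L0 _] := ML => xy; apply/eqP; rewrite -subr_eq0; apply/eqP/L0 => a.
by rewrite actBr (linB Ll) xy subrr.
Qed.

Lemma corep_ext Y (f g : grhom Y M) : (forall y, L (f y) = L (g y)) ->
  forall y, f y = g y.
Proof. by move=> fg y; apply: corep_sep => a; rewrite -!grhom_act. Qed.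

(** The image of y is the element that represents the form a |-> g (a y). *)
Lemma corep_hom Y (g : Y -> K^o) : linear g -> (forall y, g (piece e i d y) = g y) ->
  exists f : grhom Y M, forall y, L (f y) = g y.
Proof.
have [Ll Lp L0 Lf] := ML => gl gp.
have /choice[f fE] : forall y, exists z, forall a, L (a ** z) = g (a ** y).
  move=> y; apply: (piece_ind (P := fun y => exists z, forall a,
      L (a ** z) = g (a ** y)) he) => [|k h].
    split=> [|c u v [z zE] [w wE]].
      by exists 0 => a; rewrite !act0r (lin0 Ll) (lin0 gl).
    by exists (c *: z + w) => a; rewrite !act_linr Ll gl zE wE.
  have yi := in_piece_piece he k h y; move: (piece e k h y) yi => {}y yi.
  have [|z [zi zE]] := Lf k (d - h) (fun a => g (a ** y)).
    exact: lin_comp gl (act_linl y).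
  rewrite subKr in zi; exists z => a.
  rewrite -Lp -gp (piece_act _ _ _ zi) (piece_act _ _ _ yi) zE //.
  exact: (cor_crn s he).
have fl : linear f.
  by move=> c u v; apply: corep_sep => a; rewrite act_linr Ll !fE act_linr gl.
have fa a y : f (a ** y) = a ** f y.
  by apply: corep_sep => b; rewrite fE !act_assoc fE.
have fh h y : homog h y -> homog h (f y).
  move=> hy; have <- : gcomp h (f y) = f y; last exact: gcomp_in.
  apply: corep_sep => a; rewrite fE.
  rewrite -Lp /piece (gcomp_actr _ _ (gcomp_in h (f y))) act_assoc.
  have E : homog (d - h) (e i *o gcomp (d - h) a).
    by apply: (homog_el s he); exact: gcomp_in.
  rewrite -gp /piece (gcomp_actr _ _ hy) act_assoc -fE -(Lp (_ ** f y)) /piece.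
  by rewrite (gcomp_actl _ _ E) subKr act_assoc omulA (e_idem s he).
exists (GrHom fl fa fh) => y; rewrite -Lp piece_hom.
have [_ <-] := in_piece_piece he i d y.
by rewrite grhom_act fE; have [_ ->] := in_piece_piece he i d y.
Qed.

(** Homomorphisms to M are linear forms on the piece (i, d), and these extend. *)
Lemma corep_injective : injective_obj (C := C) M.
Proof.
suff ext X Y (m : grhom X Y) (f : grhom X M) : injective m ->
    exists h : grhom Y M, forall x, h (m x) = f x.
  move=> X Y m f mm; have [h hE] := ext _ _ _ f (mono_inj he mm).
  by exists h; exact: grhomP.
have [Ll Lp _ _] := ML => mi.
have [g [gl gE]] := ext_along (grhom_lin m) mi (lin_comp Ll (grhom_lin f)).
have [||h hE] := @corep_hom Y (fun y => g (piece e i d y)).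
- exact: lin_comp gl (piece_lin _ _ _).
- by move=> y; rewrite (piece_id (in_piece_piece he _ _ _)).
exists h; apply: (corep_ext (f := grhom_compose h m)) => x /=.
by rewrite hE piece_hom gE -piece_hom Lp.
Qed.

(** Take for x the element whose form on the local ring e_i A_0 e_i vanishes on the
nonunits and is 1 at e_i. A nonzero form phi on that ring has x among its
multiples: otherwise some r would kill all multiples of phi but not x, and such
an r is a unit. A nonzero element of M has a multiple with nonzero form there. *)
Lemma corep_essential : exists x : M, essential_elt i d x.
Proof.
have [Ll Lp L0 Lf] := ML; have [m [ms me mu]] := corner_unit he s i.
have [r0 [rl rm re]] := sep_form ms me.
have [x [xi xE]] := Lf i 0 r0 rl; rewrite subr0 in xi.
have Ri := cor_e s he i.
exists x; split=> // [x0|h y hy y0].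
  have := xE _ Ri; rewrite x0 act0r (lin0 Ll) re => /esym/eqP.
  by rewrite oner_eq0.
have [b Lb] : exists b, L (b ** y) <> 0.
  by apply: contrapT => /forallNP nb; apply: y0; apply: L0 => b; exact: contrapT.
pose z := piece e i d (b ** y); have zi : in_piece e i d z by exact: (in_piece_piece he).
have zL : L z <> 0 by rewrite Lp.
pose Q := [set phi : A -> K^o | exists2 c, cor e s i i 0 c &
  phi = fun r => L (r ** (c ** z))].
have Qs : is_subspace Q.
  split=> [|k _ _ [c Rc ->] [c' Rc' ->]].
    exists 0; first exact: (cor_sub e s i i 0).1.
    by apply/funext => r; rewrite act0l act0r (lin0 Ll).
  exists (k *: c + c'); first exact: (cor_sub e s i i 0).2.
  by apply/funext => r; rewrite act_linl act_linr Ll.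
have [||r Rr rQ|_ [c Rc ->] cE] := finite_dim_bidual (cor_sub e s i i 0)
    (cor_finite_dim he s i i 0) Qs _ (s0 := r0) _.
- by move=> _ [c _ ->]; exact: lin_comp Ll (act_linl _).
- by move=> k u v _ _; exact: rl.
- apply: contrapT => r0r; have [|c [Rc _ rc]] := mu r Rr.
    by move=> mr; apply: r0r; exact: rm.
  apply: zL; have := rQ _ (ex_intro2 _ _ c Rc erefl).
  by rewrite act_assoc rc; case: zi => _ ->.
have cz : c ** z = x.
  have czi : in_piece e i d (c ** z).
    by have := act_cor Rc zi.1; rewrite add0r.
  apply: corep_sep => a; rewrite -Lp -[RHS]Lp (piece_act _ _ _ czi).
  rewrite (piece_act _ _ _ xi) subrr cE ?xE //; exact: (cor_crn s he).
exists (c *o e i *o gcomp (d - h) b).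
by rewrite -!act_assoc -(gcomp_actr _ _ hy).
Qed.

End OneCorep.

(** ** The dual of e_i A *)

Definition cdual i d : grmod A s := cofree s he (fun _ : unit => i) (fun=> d).

Definition cdual_form i d (u : cdual i d) : K^o := cval u tt (e i).

Lemma cdual_corep i d : corep i d (@cdual_form i d).
Proof.
split=> [||u u0|k h phi phil].
- exact: cval_linu.
- by move=> u; exact: cval_piece.
- apply: cvalI => -[] a; rewrite -cval_e -cval_act.
  exact: u0.
pose F (_ : unit) a := phi (crn e s i k h a).
have [||u [ui uE]] := cofree_mkE (s := s) he (i := fun _ : unit => i)
  (d := fun=> d) (F := F) (k := k) (h := d - h).
- move=> t; split=> [|a|l a la ld].
  + exact: lin_comp phil (crn_lin e s i k h).
  + by rewrite /F /crn (gcomp_el s he) omulA (e_idem s he).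
  + rewrite subKr in ld.
    by rewrite /F /crn (gcomp_other la) ?omul0r ?omul0l ?(lin0 phil) //; exact: nesym.
- by move=> t a; rewrite /F /crn (gcomp_er s he) -!omulA (e_idem s he).
exists u; split=> // a ac; have [_ ia _] := ac.
by rewrite /cdual_form cval_act ia uE /F crn_id.
Qed.

End Corepresenting.

Arguments corep {K H A I} e {s} M i d L.
Arguments essential_elt {K H A I} e {s} M i d x.

(** * Perfect corner forms *)

Section Radical.
Variables (K : fieldType) (H : zmodType) (A : gralgebra K H) (I : choiceType).
Variables (e : I -> A) (he : weakly_basic e).

(** The set N of all a such that the degree 0 part of e_i c a e_i is a nonunit for
every c is a graded left ideal without e_i. It is maximal: an ideal L above it
contains a unit of e_i A_0 e_i, because all a - a e_i are in N. *)
Lemma idem_notin_radical i : ~ graded_radical (e i).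
Proof.
have [m [ms me mu]] := corner_unit he lside i.
pose cr := crn e lside i i 0; pose N := [set a | forall c, m (cr (mul c a))].
have crl : linear cr by exact: crn_lin.
have crN a b : a = mul a (e i) -> cr (mul b (a - mul a (e i))) = 0.
  by move=> <-; rewrite subrr amul0r (lin0 crl).
have NI : graded_left_ideal N.
  split=> [|a x Nx c]; last by rewrite mul_assoc; exact: Nx.
  have NP : graded_submodule (N : set (regular he lside)).
    apply/(gsubP _); split=> [|h x Nx c|a x Nx c]; last first.
    - by rewrite [act a x]/(mul a x) mul_assoc; exact: Nx.
    - suff -> : cr (mul c (gcomp h x)) = cr (mul (gcomp (0 - h) c) x) by exact: Nx.
      rewrite /cr /crn; congr (sided_mul _ (sided_mul _ _ _) _).
      rewrite (gcomp_mulr lside he c 0 (gcomp_in h x)).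
      by rewrite (gcomp_mull lside he 0 x (gcomp_in (0 - h) c)) subKr.
    split=> [c|k x y Nx Ny c].
      rewrite (lin0 (@mul_linr _ _ _ c)) (lin0 crl); exact: ms.1.
    by rewrite (@mul_linr _ _ _ c) crl; exact: ms.2.
  by case: NP.
have Ne : ~ N (e i).
  move=> /(_ (e i)); rewrite (df_idem he) /cr crn_id //.
  exact: (cor_e lside he i).
have Nz a : N (a - mul a (e i)).
  move=> c; have -> : mul c (a - mul a (e i)) = mul c a - mul (mul c a) (e i).
    by rewrite amulBr mul_assoc.
  suff -> : cr (mul c a - mul (mul c a) (e i)) = 0 by exact: ms.1.
  rewrite (linB crl); apply/eqP; rewrite subr_eq0; apply/eqP.
  rewrite /cr /crn (gcomp_er lside he).
  by rewrite /= -!mul_assoc (df_idem he).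
move=> /(_ N) /= Je; apply/Ne/Je; split=> // [N1|L [[[L0 Ll] Lg] Lm] NL].
  by apply: Ne; rewrite N1.
have [LN|nLN] := pselect (L `<=` N); [by left; apply/seteqP|right].
have Ls : is_subspace L by [].
have [x Lx nx] : exists2 x, L x & ~ N x.
  by apply: contrapT => nx; apply: nLN => x Lx; apply: contrapT => Nx; apply: nx; exists x.
have [c ncx] : exists c, ~ m (cr (mul c x)).
  by apply: contrapT => /forallNP nc; apply: nx => c; exact: contrapT.
pose y := mul (e i) (gcomp 0 (mul c x)).
have Ly : L y.
  apply: (Lm); apply: (Lg (mul c x) (fun h => gcomp h (mul c x))) => //.
    exact: Lm.
  exact: dcompP.
have Lr : L (cr (mul c x)).
  rewrite (_ : cr _ = y - (y - mul y (e i))); last by rewrite subKr.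
  by apply: subB => //; exact/NL/Nz.
have [r [_ re _]] := mu _ (cor_crn lside he i i 0 _) ncx.
have Le : L (e i) by rewrite -re; exact: Lm.
apply/seteqP; split=> // a _; rewrite -[a](subrK (mul a (e i))).
by apply: subD => //; [exact/NL/Nz|exact: Lm].
Qed.

Lemma mul_iso_eq i j x y : x = mul (mul (e i) x) (e j) -> mul y x = e j -> i = j.
Proof.
move=> xE yx; apply: contrapT => /eqP ij; apply: (@idem_notin_radical j).
rewrite -yx => N NM; have [[_ Nm] _ _] := NM; apply: Nm.
by apply: (wb_radical he ij) NM; exists x.
Qed.

(** The elements x and y are inverse isomorphisms between A e_i and A e_j up to a
shift. For i <> j they are in the radical, hence so would be an idempotent. *)
Lemma cor_iso_eq s i j h k x y : cor e s i j h x -> cor e s j i k y ->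
  sided_mul s x y = e i -> sided_mul s y x = e j -> i = j.
Proof.
case: s => -[_ ix xj] [_ jy yi] /= xy yx.
  by apply: mul_iso_eq yx; rewrite [mul _ x]ix [mul x _]xj.
by apply/esym; apply: mul_iso_eq xy; rewrite [mul _ x]xj [mul x _]ix.
Qed.

End Radical.

Section Perfect.
Variables (K : fieldType) (H : zmodType) (A : gralgebra K H) (I : choiceType).
Variables (e : I -> A) (he : weakly_basic e).

(** A homogeneous form lam on e_i A e_j whose pairing (a, b) |-> lam (a b) of
e_i A with A e_j is nondegenerate on both sides. It carries the isomorphisms of
A e_j with the dual of e_i A, and of e_i A with the dual of A e_j. *)
Definition perfect s (i j : I) (d : H) (lam : A -> K^o) : Prop :=
  [/\ linear lam, forall a, lam (crn e s i j d a) = lam a,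
      forall b, sided_mul s b (e j) = b ->
        (forall a, lam (sided_mul s a b) = 0) -> b = 0 &
      forall a, sided_mul s (e i) a = a ->
        (forall b, lam (sided_mul s a b) = 0) -> a = 0].

Lemma sided_mul_opp s (a b : A) : sided_mul (opp_side s) a b = sided_mul s b a.
Proof. by case: s. Qed.

Lemma perfect_opp s i j d lam :
  perfect s i j d lam -> perfect (opp_side s) j i d lam.
Proof.
case=> ll lc lb la; split=> // [a|b|a].
- by rewrite -[RHS]lc /crn !sided_mul_opp omulA.
- rewrite sided_mul_opp => ib b0; apply: la => // a.
  by rewrite -sided_mul_opp.
- rewrite sided_mul_opp => aj a0; apply: lb => // b.
  by rewrite -sided_mul_opp.
Qed.

Section OneSide.
Variable s : side.
Local Notation "a *o b" := (sided_mul s a b) (at level 40, left associativity).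

Lemma crn_mull i k h j d (r b : A) : cor e s i k h r ->
  crn e s i j d (r *o b) = r *o crn e s k j (d - h) b.
Proof.
move=> [hr ir rk].
by rewrite /crn (gcomp_mull _ he _ _ hr) !omulA ir rk.
Qed.

Lemma crn_mulr i k h j d (a c : A) : cor e s k j h c ->
  crn e s i j d (a *o c) = crn e s i k (d - h) a *o c.
Proof.
move=> [hc kc cj].
by rewrite /crn (gcomp_mulr _ he _ _ hc) -!omulA kc cj.
Qed.

Lemma crn_eq0 i (a : A) : e i *o a = a -> (forall k h, crn e s i k h a = 0) -> a = 0.
Proof.
move=> ia a0; apply: (piece_eq0 he (M := regular he (opp_side s))) => k h.
rewrite /piece /= sided_mul_opp -[a]ia (gcomp_el s he) /=.
exact: a0.
Qed.

(** Nondegeneracy gives surjectivity, as the pieces are finite dimensional. *)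
Lemma perfect_full i j d lam : perfect s i j d lam ->
  forall k h (phi : A -> K^o), linear phi -> exists x,
    cor e s k j (d - h) x /\ forall a, cor e s i k h a -> lam (a *o x) = phi a.
Proof.
move=> [ll lc lb la] k h phi phil.
pose Q := [set f : A -> K^o | exists2 x, cor e s k j (d - h) x &
  f = fun a => lam (a *o x)].
have Qs : is_subspace Q.
  split=> [|c _ _ [x xc ->] [y yc ->]].
    exists 0; first exact: (cor_sub e s _ _ _).1.
    by apply/funext => a; rewrite omul0r (lin0 ll).
  exists (c *: x + y); first exact: (cor_sub e s _ _ _).2.
  by apply/funext => a; rewrite omulDr omulZr ll.
have [|||_ [x xc ->] xE] := finite_dim_bidual (cor_sub e s i k h)
    (cor_finite_dim he s i k h) Qs _ (s0 := phi) _; last by exists x; split.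
- by move=> _ [x _ ->]; exact: (lin_comp ll (@sided_mul_linl _ _ A s x)).
- by move=> c u v _ _; exact: phil.
- move=> r rc rQ; rewrite (_ : r = 0) ?(lin0 phil) //; apply: la => [|b].
    by case: rc.
  rewrite -lc (crn_mull _ _ _ rc).
  apply: (rQ (fun r => lam (r *o crn e s k j (d - h) b))).
  by exists (crn e s k j (d - h) b) => //; exact: (cor_crn s he).
Qed.

Lemma perfect_neq0 i j d lam : perfect s i j d lam -> exists a, lam a <> 0.
Proof.
move=> [_ _ lb _]; apply: contrapT => /forallNP la.
have ej0 : e j = 0 by apply: lb => [|a]; [exact: (e_idem s he)|exact: contrapT].
exact: e_neq0 he j ej0.
Qed.

Lemma perfect_compose i j j' d d' lam lam' x y : perfect s i j d lam ->
  cor e s j j' (d' - d) x -> (forall a, cor e s i j d a -> lam' (a *o x) = lam a) ->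
  cor e s j' j (d - d') y -> (forall a, cor e s i j' d' a -> lam (a *o y) = lam' a) ->
  x *o y = e j.
Proof.
move=> [ll lc lb _] xc xE yc yE; apply/eqP; rewrite -subr_eq0; apply/eqP.
have xyc : cor e s j j 0 (x *o y).
  by have := cor_mul xc yc; rewrite addrC subrKA subrr.
apply: lb => [|a]; first by rewrite omulBl (e_idem s he); case: xyc => _ _ ->.
rewrite omulBr (linB ll) -lc -[X in _ - X]lc (crn_mulr _ _ _ xyc).
rewrite (crn_mulr _ _ _ (cor_e s he j)) subr0.
have ac := cor_crn s he i j d a; move: (crn _ _ _ _ _ a) ac => {}a ac.
rewrite omulA yE; last by have := cor_mul ac xc; rewrite addrC subrK.
rewrite xE //; case: ac => _ _ ->.
by rewrite subrr.
Qed.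

(** Both A e_j and A e_j' are isomorphic to the dual of e_i A. The isomorphism
between them is right multiplication by the element x representing lam in terms
of lam', with inverse y representing lam' in terms of lam. *)
Lemma perfect_uniq i j j' d d' lam lam' :
  perfect s i j d lam -> perfect s i j' d' lam' -> j = j'.
Proof.
move=> lP lP'; have [ll _ _ _] := lP; have [ll' _ _ _] := lP'.
have [x [xc xE]] := perfect_full lP' j d ll.
have [y [yc yE]] := perfect_full lP j' d' ll'.
apply: (cor_iso_eq he xc yc).
  exact: perfect_compose lP xc xE yc yE.
exact: perfect_compose lP' yc yE xc xE.
Qed.

End OneSide.

Lemma perfect_uniql s i i' j d d' lam lam' :
  perfect s i j d lam -> perfect s i' j d' lam' -> i = i'.
Proof. by move=> /perfect_opp lP /perfect_opp lP'; exact: perfect_uniq lP lP'. Qed.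

(** A e_j with its generator in degree d. *)
Definition pfree s j d : grmod A s :=
  free s he (fun _ : unit => j) (fun=> d) [set: unit].

Definition pgen s j d : pfree s j d := bas s he (fun _ : unit => j) (fun=> d) setT tt.

Lemma in_piece_pgen s j d : in_piece e j d (pgen s j d).
Proof. exact: (in_piece_bas s he (fun _ : unit => j) (fun=> d)). Qed.

Lemma coef_pgen s j d : coef (pgen s j d) tt = e j.
Proof. by rewrite (coef_basZ s he). Qed.

Lemma pfree_expand s j d (u : pfree s j d) : u = coef u tt ** pgen s j d.
Proof.
by apply: coefI => -[]; rewrite coef_act coef_pgen coef_e.
Qed.

Lemma coef_gcomp s (T : choiceType) (j : T -> I) d Z (u : free s he j d Z) h t :
  coef (gcomp h u) t = gcomp (h - d t) (coef u t).
Proof.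
have ch k (v : free s he j d Z) : homog k v -> homog (k + - d t) (coef v t).
  by move=> kv; exact: coef_homog.
have := gcomp_deg (coef_lin t) ch (h - d t) u.
by rewrite opprK subrK.
Qed.

(** The instance that makes the A e_j with a partner injective. *)
Lemma perfect_corep s i j d lam : perfect s i j d lam ->
  forall l, corep e (pfree s j l) i (d + l) (fun u => lam (coef u tt)).
Proof.
move=> lP l; have [ll lc lb _] := lP; split=> [|u|u u0|k h phi phil].
- by apply: (lin_comp ll); exact: coef_lin.
- rewrite /piece coef_act coef_gcomp addrK -[RHS]lc /crn -omulA -(gcomp_er s he).
  by rewrite coef_e.
- apply: coefI => -[]; apply: lb => [|a]; first exact: coef_e.
  by rewrite -coef_act; exact: u0.
have [x [[xh kx xj] xE]] := perfect_full lP k h phil.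
have [|u [ui uE]] := free_mkE (s := s) he (j := fun _ : unit => j) (d := fun=> l)
    (Z := setT) (F := fun=> x) (i := k) (h := d + l - h) _ (fun=> kx).
  split=> // [_|t nZ|]; [by rewrite addrAC addrK|by case: nZ|].
  by apply: sub_finite_set (finite_set1 tt) => -[].
by exists u; split=> // a /xE <-; rewrite coef_act uE.
Qed.

(** If the dual D of e_i A is projective, the identity of D is a pointwise
finite sum of maps f |-> q_t(f) x_t with q_t from D to some A e_j. One of them
is nonzero on the essential element, hence injective, hence bijective because D
is injective; so A e_j maps onto D by b |-> b x, and the splitting is cut out by
an idempotent of the local ring e_j A_0 e_j. *)
Lemma projective_perfect s i : projective (C := grmod_cat A s) (cdual s he i 0) ->
  exists j d lam, perfect s i j d lam.
Proof.
set D := cdual s he i 0 => Dp; pose L := @cdual_form _ _ _ _ _ s he i 0.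
have DL : corep e D i 0 L by exact: cdual_corep.
have [Ll Lp L0 Lf] := DL.
have [sg sge] := corep_essential he DL; have [[sgh _] sg0 _] := sge.
have [p ps] := cover_surj he D; have [q pq] := projective_section Dp ps.
pose j (t : I * H * D) := t.1.1; pose d (t : I * H * D) := t.1.2.
pose x t := p (bas s he j d setT t).
have xi t : in_piece e (j t) (d t) (x t) by exact/in_piece_hom/in_piece_bas.
have [t tx] : exists t, coef (q sg) t ** x t <> 0.
  apply: contrapT => /forallNP nx; apply: sg0; rewrite -[sg]pq.
  have [X X0] := coef_fin (q sg).
  rewrite (free_hom_expand p X0) big1_seq // => t _; exact: contrapT.
have ul : linear (fun f => coef (q f) t ** x t).
  by move=> c f g; rewrite grhom_lin coef_lin act_linl.
have ua a f : coef (q (a ** f)) t ** x t = a ** (coef (q f) t ** x t).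
  by rewrite grhom_act coef_act act_assoc.
have uh h f : homog h f -> homog h (coef (q f) t ** x t).
  move=> hf; rewrite -[h](subrK (d t)); apply: act_comp; last by case: (xi t).
  by apply: coef_homog; exact: grhom_comp.
pose u : grhom D D := GrHom ul ua uh.
have Di := corep_injective he DL.
have ui : injective u by exact: (essential_inj he sge).
have [v vu] := injective_retract Di ui.
(* sg is a multiple of u sg, which makes v sg nonzero as well. *)
have vi : injective v.
  apply: (essential_inj he sge).
  have [_ _ se] := sge; have [a asg] := se _ _ (uh _ _ sgh) tx.
  rewrite -[sg in v sg]asg -[coef _ _ ** _]/(u sg) grhom_act vu => asg0.
  by apply: sg0; rewrite -asg -[coef _ _ ** _]/(u sg) -grhom_act asg0 hom0.
have uv f : u (v f) = f by apply: vi; rewrite vu.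
pose w f := coef (q (v f)) t.
have wx f : w f ** x t = f by exact: uv.
have wa a f : w (a ** f) = sided_mul s a (w f).
  by rewrite /w !grhom_act coef_act.
have w0 : w 0 = 0 by rewrite /w !hom0.
pose c := w (x t).
have cc : cor e s (j t) (j t) 0 c.
  split; last exact: coef_e.
    rewrite -(subrr (d t)); apply: coef_homog; do 2!apply: grhom_comp.
    by case: (xi t).
  by rewrite /c -wa; case: (xi t) => _ ->.
(* w splits right multiplication by x t, and c is the idempotent of the splitting. *)
have cE : c = e (j t).
  have [||//] := corner_idem he cc; first by rewrite /c -wa wx.
  move=> c0; have x0 : x t = 0 by rewrite -[LHS]wx -/c c0 act0l.
  by case: sg0; rewrite -[sg]wx x0 act0r.
exists (j t), (0 - d t), (fun b => L (b ** x t)); split=> [|b|b bj b0|a ia a0].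
- exact: lin_comp Ll (act_linl _).
- by rewrite -(piece_act _ _ _ (xi t)) Lp.
- have : b ** x t = 0 by apply: L0 => a; rewrite act_assoc; exact: b0.
  by move=> /(congr1 w); rewrite wa -/c cE bj w0.
have La f : L (a ** f) = 0 by rewrite -[f]wx act_assoc; exact: a0.
apply: (crn_eq0 ia) => k h; apply: contrapT => r0.
have [||phi [phil _ phi1]] := @sep_form K A [set 0] (crn e s i k h a) => //.
  by split=> // b y z -> ->; rewrite scaler0 addr0.
have [f [fi fE]] := Lf k h phi phil.
have := La f; rewrite -Lp (piece_act _ _ _ fi) subKr fE ?phi1; last exact: (cor_crn s he).
by move=> /eqP; rewrite oner_eq0.
Qed.

(** * Nakayama permutations *)

Definition nakayama_perm s : Prop := exists nu : I -> I, bijective nu /\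
  forall i, exists d lam, perfect s i (nu i) d lam.

Lemma nakayama_perm_intro s : (forall i, exists j d lam, perfect s i j d lam) ->
  (forall j, exists i d lam, perfect s i j d lam) -> nakayama_perm s.
Proof.
move=> /choice[nu nuP] /choice[mu muP]; exists nu; split=> //.
exists mu => [i|j].
  have [d [lam lP]] := nuP i; have [d' [lam' lP']] := muP (nu i).
  exact: perfect_uniql lP' lP.
have [d [lam lP]] := nuP (mu j); have [d' [lam' lP']] := muP j.
exact: perfect_uniq lP lP'.
Qed.

Lemma nakayama_perm_opp s : nakayama_perm s -> nakayama_perm (opp_side s).
Proof.
move=> [nu [[mu numu munu] nuP]]; exists mu; split; first by exists nu.
move=> j; have [d [lam lP]] := nuP (mu j); exists d, lam.
by rewrite munu in lP; exact: perfect_opp.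
Qed.

Lemma nakayama_perm_side s s' : nakayama_perm s -> nakayama_perm s'.
Proof. by case: s; case: s' => // /nakayama_perm_opp. Qed.

End Perfect.

(** * Nakayama forms *)

Section NakayamaForms.
Variables (K : fieldType) (H : zmodType) (A : gralgebra K H) (I : choiceType).
Variables (e : I -> A) (he : weakly_basic e).

Section Sided.
Variable s : side.
Local Notation "a *o b" := (sided_mul s a b) (at level 40, left associativity).

Lemma perfect_el i j d lam a : perfect e s i j d lam -> lam (e i *o a) = lam a.
Proof.
case=> _ lc _ _; rewrite -lc -[RHS]lc /crn (gcomp_el s he) omulA.
by rewrite (e_idem s he).
Qed.

Lemma perfect_er i j d lam a : perfect e s i j d lam -> lam (a *o e j) = lam a.
Proof.
case=> _ lc _ _; rewrite -lc -[RHS]lc /crn (gcomp_er s he) -!omulA.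
by rewrite (e_idem s he).
Qed.

Lemma perfect_deg i j d lam h a : perfect e s i j d lam -> homog h a ->
  h <> d -> lam a = 0.
Proof.
case=> ll lc _ _ ha hd; rewrite -lc /crn (gcomp_other ha); last exact: nesym.
by rewrite omul0r omul0l (lin0 ll).
Qed.

(** Assembling the solutions of all degrees turns a perfect form into the graded
duality between e_i A e_j and e_j A e_k. *)
Lemma perfect_dual i j k d lam : perfect e s i k d lam ->
  forall phi : H -> A -> K,
  (forall h, linear_form_on (cor e s i j h) (phi h)) ->
  finite_set [set h | exists2 v, cor e s i j h v & phi h v != 0] ->
  exists! w, (e j *o w = w /\ w *o e k = w) /\
    forall h v, cor e s i j h v -> lam (v *o w) = phi h v.
Proof.
move=> lP phi phil /finite_fsetP[X phiX]; have [ll lc lb la] := lP.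
have /choice[w wP] : forall h, exists w, cor e s j k (d - h) w /\
    forall v, cor e s i j h v -> lam (v *o w) = phi h v.
  move=> h; have [f [fl fE]] := ext_form (cor_sub e s i j h) (phil h).
  have [w [wc wE]] := perfect_full he lP j h fl.
  by exists w; split=> // v vc; rewrite wE ?fE.
pose w0 := \sum_(h <- X) w h.
have [jw0 w0k] : e j *o w0 = w0 /\ w0 *o e k = w0.
  rewrite /w0 (lin_sum (@sided_mul_linr _ _ A s (e j))) (lin_sum (@sided_mul_linl _ _ A s (e k))).
  by split; apply: eq_bigr => h _; have [[]] := wP h.
have w0E h v : cor e s i j h v -> lam (v *o w0) = phi h v.
  move=> vc; have [hv _ _] := vc.
  rewrite /w0 (lin_sum (@sided_mul_linr _ _ A s v)) (lin_sum ll).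
  have off h' : h' <> h -> lam (v *o w h') = 0.
    move=> hh'; have [[hw _ _] _] := wP h'.
    apply: (perfect_deg lP (homog_mul s hv hw)) => E; apply: hh'.
    by apply/esym/subr0_eq/(addrI d); rewrite addr0 addrCA.
  rewrite (fset_sum1 (t := h)) => [|h' _|hX]; first by have [_ ->] := wP h.
    exact: off.
  have [_ ->//] := wP h; apply/eqP; apply: contraNT hX => phiv.
  have : [set` X] h by rewrite -phiX; exists v.
  by [].
exists w0; split=> // w' [[jw' wk'] wE'].
apply/eqP; rewrite -subr_eq0; apply/eqP.
apply: lb => [|a]; first by rewrite omulBl w0k wk'.
have -> : w0 - w' = e j *o (w0 - w') by rewrite omulBr jw0 jw'.
rewrite -(perfect_el _ lP) !omulA.
have bi : e i *o (e i *o a *o e j) = e i *o a *o e j by rewrite !omulA (e_idem s he).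
have bj : e i *o a *o e j *o e j = e i *o a *o e j by rewrite -!omulA (e_idem s he).
move: (e i *o a *o e j) bi bj => b bi bj.
apply: (gcomp_ind (P := fun b => lam (b *o (w0 - w')) = 0)) => [|h].
  split=> [|c u v u0 v0]; first by rewrite omul0l (lin0 ll).
  by rewrite omulDl omulZl ll u0 v0 scaler0 addr0.
have bc : cor e s i j h (gcomp h b).
  by split; [exact: gcomp_in|rewrite -(gcomp_el s he) bi|rewrite -(gcomp_er s he) bj].
by rewrite omulBr (linB ll) (w0E _ _ bc) (wE' _ _ bc) subrr.
Qed.

End Sided.

Lemma corner_fix i j w : corner e i j w <-> mul (e i) w = w /\ mul w (e j) = w.
Proof.
split=> [[a _ <-]|[iw wj]]; last by exists w => //; rewrite iw wj.
by rewrite !mul_assoc (df_idem he) -!mul_assoc (df_idem he).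
Qed.

Lemma biscalar_linr (B : {biscalar A}) x : linear (B x : A -> K^o).
Proof. by move=> c a b; rewrite linearPr. Qed.

(** By associativity B (v, w) = B (e_i, v w) for v in e_i A, so B is given on
e_i A and A e_(nu i) by the linear form B (e_i, _). *)
Lemma nakayama_form_perm (B : {biscalar A}) :
  graded_nakayama_form e B -> nakayama_perm e lside.
Proof.
move=> [Bass [nu [nubij nuP [hd hdP]]]]; exists nu; split=> // i.
set k := nu i; pose lam : A -> K^o := fun a => B (e i) (mul a (e k)).
exists (hd i), lam.
have Bl x := biscalar_linr B x.
have laml : linear lam.
  move=> c a b; rewrite /lam -(Bl (e i)); congr (B _ _).
  exact: (@mul_linl _ _ _ (e k)).
have Blam v w : mul (e i) v = v -> mul w (e k) = w -> B v w = lam (mul v w).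
  by move=> iv wk; rewrite -iv Bass /lam iv -mul_assoc wk.
have lamc a : lam (crn e lside i k (hd i) a) = lam a.
  have -> : lam a = B (e i) (mul (mul (e i) a) (e k)).
    by rewrite /lam -{1}(df_idem he i) Bass mul_assoc.
  rewrite (lin_gcomp (d := hd i) (Bl (e i))) => [|h hh].
    rewrite (gcomp_er lside he) (gcomp_el lside he) /lam; congr (B _ _).
    by case: (cor_crn lside he i k (hd i) a).
  apply: contrapT => /eqP B0; apply: hh.
  rewrite -[h]add0r; apply: (hdP i i).1; exists (e i).
    by rewrite -cor_l //; exact: (cor_e lside he).
  exists (gcomp h (mul (mul (e i) a) (e k))) => //.
  rewrite (gcomp_er lside he) (gcomp_el lside he) -cor_l //.
  exact: (cor_crn lside he).
have B0 j h l v w : cor e lside i j h v -> cor e lside j k l w -> h <> hd i - l ->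
    B v w = 0.
  move=> vc wc hl; apply: contrapT => /eqP Bvw; apply: hl.
  have <- : h + l = hd i; last by rewrite addrK.
  by apply: (hdP i j).1; exists v; [rewrite -cor_l|exists w => //; rewrite -cor_l].
have zero_dual (V : H -> set A) : graded_dual_element V (fun _ _ => 0).
  split=> [h c u v _ _|]; first by rewrite mulr0 addr0.
  by apply: sub_finite_set (finite_set0 _) => h [v _]; rewrite eqxx.
split=> // [b bk b0|a ia a0].
- apply: (piece_eq0 he (M := regular he lside)) => j h.
  have -> : piece e j h (b : regular he lside) = crn e lside j k h b.
    by rewrite /crn -omulA -(gcomp_er lside he) bk.
  have wc := cor_crn lside he j k h b; move: wc.
  set w := crn _ _ _ _ _ _ => wc; have [_ jw wk] := wc.
  have [w0 [_ w0u]] := (hdP i j).2.1 _ (zero_dual _).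
  transitivity w0; last (apply: w0u; split).
  + apply/esym/w0u; split; first exact/corner_fix.
    move=> l v; rewrite -cor_l // => vc; have [_ iv _] := vc.
    have [hl|hl] := pselect (h = hd i - l); last first.
      apply: B0 vc wc _ => E; apply: hl.
      by rewrite E subKr.
    rewrite Blam //.
    have -> : mul v w = crn e lside i k (hd i) (mul v b).
      by rewrite (crn_mull he k (hd i) b vc) -hl.
    by rewrite lamc b0.
  + by apply/corner_fix; rewrite amul0r amul0l.
  + by move=> l v _; rewrite (lin0 (Bl v)).
- apply: (crn_eq0 he ia) => j h.
  have vc := cor_crn lside he i j h a; move: vc.
  set v := crn _ _ _ _ _ _ => vc; have [_ iv vj] := vc.
  have [v0 [_ v0u]] := (hdP i j).2.2 _ (zero_dual _).
  transitivity v0; last (apply: v0u; split).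
  + apply/esym/v0u; split; first exact/corner_fix.
    move=> l w; rewrite -cor_l // => wc; have [_ _ wk] := wc.
    have [hl|hl] := pselect (h = hd i - l); last exact: B0 vc wc hl.
    rewrite Blam //.
    have -> : mul v w = crn e lside i k (hd i) (mul a w).
      by rewrite (crn_mulr he i (hd i) a wc) -hl.
    by rewrite lamc a0.
  + by apply/corner_fix; rewrite amul0r amul0l.
  + by move=> l w _; rewrite (linear0l).
Qed.

(** The form (a, b) |-> sum_i lam_i (a b) is associative because it only depends
on the product; the sum is finite since e_i a b vanishes for almost all i. *)
Lemma nakayama_perm_form :
  nakayama_perm e lside -> exists B : {biscalar A}, graded_nakayama_form e B.
Proof.
move=> [nu [nubij /choice[d /choice[lam lP]]]].
have ll i : linear (lam i) by case: (lP i).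
have l0 i a : mul (e i) a = 0 -> lam i a = 0.
  by move=> ia; rewrite -(perfect_el _ (lP i)) /= ia (lin0 (ll i)).
pose tr a : K^o := \sum_(i \in [set: I]) lam i a.
have trE a (X : {fset I}) : (forall i, i \notin X -> mul (e i) a = 0) ->
    tr a = \sum_(i <- X) lam i a.
  by move=> X0; rewrite /tr; apply: fsbigTE => i /X0 /l0.
have trl : linear tr.
  move=> c a b; have [X X0] := df_fin he lside a; have [Y Y0] := df_fin he lside b.
  have XY i : i \notin (X `|` Y)%fset -> mul (e i) a = 0 /\ mul (e i) b = 0.
    by rewrite inE negb_or => /andP[/X0 /= -> /Y0 /= ->].
  have cXY i : i \notin (X `|` Y)%fset -> mul (e i) (c *: a + b) = 0.
    by move=> /XY[a0 b0]; rewrite mul_linr a0 b0 scaler0 addr0.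
  rewrite (trE _ _ cXY) (trE a (X `|` Y)%fset) => [|i /XY[]//].
  rewrite (trE b (X `|` Y)%fset) => [|i /XY[]//].
  by rewrite scaler_sumr -big_split; apply: eq_bigr => i _; exact: ll.
have trlam i a : mul (e i) a = a -> tr a = lam i a.
  move=> ia; rewrite (trE _ [fset i]%fset) ?big_seq_fset1 // => j.
  rewrite inE => /eqP ji; rewrite -ia mul_assoc (df_orth he) ?amul0l //.
  exact/eqP.
pose f (a b : A) : K := tr (mul a b).
have fb : bilinear_for *%R *%R f.
  split=> x c u v.
    by rewrite /f mul_linl trl.
  by rewrite /f mul_linr trl.
pose B : {biscalar A} := HB.pack f (bilinear_isBilinear.Build K A A K _ _ f fb).
have BE a b : B a b = tr (mul a b) by [].
have Bi i v w : mul (e i) v = v -> B v w = lam i (mul v w).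
  by move=> iv; rewrite BE (trlam i) // mul_assoc iv.
exists B; split=> [a b c|]; first by rewrite !BE mul_assoc.
exists nu; split=> // [i j|].
  split=> [[a' [a _ <-]] [b' [b _ <-]]|->].
    rewrite (Bi i); last by rewrite mul_assoc (df_idem he).
    rewrite mul_assoc -(perfect_er _ (lP i)) /= -mul_assoc.
    have [->//|/eqP ji] := pselect (j = nu i).
    by rewrite (df_orth he) // amul0r (lin0 (ll i)) eqxx.
  have [a la] := perfect_neq0 he (lP i).
  exists (mul (e i) a); first by exists a.
  exists (e (nu i)); first by exists (e (nu i)) => //; exact: (df_idem he).
  rewrite (Bi i); last by rewrite mul_assoc (df_idem he).
  by rewrite [lam i _](perfect_er _ (lP i)) [lam i _](perfect_el _ (lP i)); exact/eqP.
exists d => i j; split.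
  move=> h k [v [v' hv' <-] [w [w' kw' <-] Bvw]].
  apply: contrapT => hk; move: Bvw; rewrite (Bi i); last first.
    by rewrite !mul_assoc (df_idem he).
  rewrite (perfect_deg (lP i) _ hk) ?eqxx //.
  by apply: mul_comp; apply/(homog_er lside he)/(homog_el lside he).
split=> phi [phil phif].
  have [||w [[[jw wk] wE] wu]] := perfect_dual (j := j) (lP i) (phi := phi).
  - by move=> h; rewrite cor_l.
  - by under eq_set do rewrite cor_l //.
  exists w; split=> [|w' [/corner_fix w'c w'E]].
    split=> [|h v]; first exact/corner_fix.
    by rewrite -cor_l // => vc; have [_ iv _] := vc; rewrite (Bi i) //; exact: wE vc.
  apply: wu; split=> // h v; rewrite cor_l // => vc.
  by rewrite -w'E // (Bi i) //; move: vc; rewrite -cor_l // => -[].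
have [||v [[[jv iv] vE] vu]] := perfect_dual (j := j) (perfect_opp (lP i)) (phi := phi).
- by move=> h; rewrite cor_r cor_l.
- by under eq_set do rewrite cor_r cor_l //.
exists v; split=> [|v' [/corner_fix[iv' v'j] v'E]].
  split=> [|h w]; first exact/corner_fix.
  by rewrite -cor_l // -cor_r => wc; rewrite (Bi i) // -(vE h).
apply: vu; split=> // h w; rewrite cor_r cor_l // => wc.
by rewrite -v'E // (Bi i).
Qed.

End NakayamaForms.

(** * Injectivity of free modules *)

Section Baer.
Variables (K : fieldType) (H : zmodType) (A : gralgebra K H) (I : choiceType).
Variables (e : I -> A) (s : side) (he : weakly_basic e).

Local Notation "a *o b" := (sided_mul s a b) (at level 40, left associativity).
Local Notation C := (grmod_cat A s).

(** Keeping phi total on A and restricting its properties to the left ideal N avoids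
forming N as a module. *)
Definition partial_hom i h (E : grmod A s) (N : set A) (phi : A -> E) : Prop :=
  [/\ graded_submodule (N : set (regular he s)), forall n, N n -> n *o e i = n,
      forall c u v, N u -> N v -> phi (c *: u + v) = c *: phi u + phi v,
      forall a n, N n -> phi (a *o n) = a ** phi n &
      forall k n, N n -> homog k n -> homog (k + h) (phi n)].

Lemma partial_hom_gcomp i h (E : grmod A s) N (phi : A -> E) :
  partial_hom i h N phi -> forall l n, N n -> phi (gcomp l n) = gcomp (l + h) (phi n).
Proof.
move=> [Ng _ pl _ ph] l n Nn; have /gsubP[Ns Nh _] := Ng.
have p0 : phi 0 = 0.
  have := pl (-1) 0 0 Ns.1 Ns.1.
  by rewrite scaler0 addr0 scaleN1r addNr.
have [X [X0 nE]] := gcomp_expand n.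
have -> : phi n = \sum_(k <- X) phi (gcomp k n).
  rewrite {1}nE; elim: (X : seq H) => [|k r IH]; first by rewrite !big_nil.
  rewrite !big_cons -[gcomp k n]scale1r pl; last by apply: sub_sum => // t _; exact: Nh.
    by rewrite IH !scale1r.
  exact: Nh.
rewrite (lin_sum (gcomp_lin _)) (fset_sum1 (t := l)) => [|k _ kl|lX].
- by apply/esym/gcomp_id/ph; [exact: Nh|exact: gcomp_in].
- apply: gcomp_other (ph k _ (Nh k n Nn) (gcomp_in k n)) _.
  by move/addIr/esym.
- by rewrite X0 // p0 (lin0 (gcomp_lin _)).
Qed.

(** Baer's criterion. A partial extension is a graph, closed under the structure
and functional; a maximal one is defined on every homogeneous y because it can
be extended along the left ideal of all a such that a y is in its domain. *)
Lemma baer_criterion (E : grmod A s) :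
  (forall i h N phi, @partial_hom i h E N phi ->
     exists z, in_piece e i h z /\ forall n, N n -> phi n = n ** z) ->
  injective_obj (C := C) E.
Proof.
move=> baer; suff ext (X Y : grmod A s) (m : grhom X Y) (f : grhom X E) :
    injective m -> exists g : grhom Y E, forall x, g (m x) = f x.
  move=> X Y m f mm; have [g gE] := ext _ _ _ f (mono_inj he mm).
  by exists g; exact: grhomP.
move=> mi.
pose P (G : set (Y * E)) := [/\
  G (0, 0) /\ forall c y z y' z', G (y, z) -> G (y', z') ->
    G (c *: y + y', c *: z + z'),
  forall a y z, G (y, z) -> G (a ** y, a ** z),
  forall h y z, G (y, z) -> G (gcomp h y, gcomp h z) &
  forall z, G (0, z) -> z = 0].
pose G0 : set (Y * E) := [set (m x, f x) | x in [set: X]].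
have [|F [Z0 FZ0] FP Ft|G [[[G00 Gl] Ga Gh Gf] G0G Gmax]] := @Zorn_above _ P G0.
- split.
  + split; first by exists 0; rewrite ?hom0.
    move=> c _ _ _ _ [x _ [<- <-]] [x' _ [<- <-]]; exists (c *: x + x') => //.
    by rewrite !grhom_lin.
  + by move=> a _ _ [x _ [<- <-]]; exists (a ** x) => //; rewrite !grhom_act.
  + by move=> h _ _ [x _ [<- <-]]; exists (gcomp h x) => //; rewrite !gcomp_hom.
  + by move=> _ [x _ [mx <-]]; rewrite (mi x 0) ?hom0 // mx hom0.
- split.
  + split; first by exists Z0 => //; have [[[]]] := FP _ FZ0.
    move=> c y z y' z' [W FW Wy] [W' FW' Wy'].
    have [WW|WW] := Ft _ _ FW FW'.
      exists W' => //; have [[[_ Wl] _ _ _] _] := FP _ FW'.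
      by apply: Wl => //; exact: WW.
    exists W => //; have [[[_ Wl] _ _ _] _] := FP _ FW.
    by apply: Wl => //; exact: WW.
  + by move=> a y z [W FW Wy]; exists W => //; have [[_ Wa _ _] _] := FP _ FW; exact: Wa.
  + by move=> h y z [W FW Wy]; exists W => //; have [[_ _ Wh _] _] := FP _ FW; exact: Wh.
  + by move=> z [W FW Wy]; have [[_ _ _ Wf] _] := FP _ FW; exact: Wf.
have Gu y z z' : G (y, z) -> G (y, z') -> z = z'.
  move=> yz yz'; apply/esym/eqP; rewrite -subr_eq0; apply/eqP/Gf.
  by have := Gl (-1) _ _ _ _ yz yz'; rewrite !scaleN1r addNr addrC.
have Gtot y : exists z, G (y, z).
  apply: (piece_ind (P := fun y => exists z, G (y, z)) he) => [|i h].
    split=> [|c u v [z uz] [w vw]]; first by exists 0.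
    by exists (c *: z + w); exact: Gl.
  have yi := in_piece_piece he i h y; move: (piece e i h y) yi => {}y yi.
  (* y can be added to the domain along this left ideal. *)
  pose N : set A := [set a | a *o e i = a /\ exists z, G (a ** y, z)].
  pose phi a : E := xget 0 [set z | G (a ** y, z)].
  have phiG a : N a -> G (a ** y, phi a) by case=> _; exact: xgetPex.
  have Nphi : partial_hom i h N phi.
    have Nl c u v : N u -> N v -> N (c *: u + v).
      move=> [ui [z uz]] [vi [w vw]]; split; first by rewrite omulDl omulZl ui vi.
      by exists (c *: z + w); rewrite act_linl; exact: Gl.
    have Nact a n : N n -> N (a *o n).
      move=> [ni [z nz]]; split; first by rewrite -omulA ni.
      by exists (a ** z); rewrite -act_assoc; exact: Ga.
    have Nh k n : N n -> N (gcomp k n).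
      move=> [ni [z nz]]; split; first by rewrite -(gcomp_er s he) ni.
      exists (gcomp (k + h) z); rewrite -{1}[k](addrK h) -(gcomp_actr _ _ yi.1).
      exact: Gh.
    split=> [|n [] //|c u v Nu Nv|a n Nn|k n Nn kn].
    - apply/gsubP; split=> //; split=> [|c u v]; last exact: Nl.
      by split; [exact: omul0l|exists 0; rewrite act0l].
    - apply: (Gu ((c *: u + v) ** y)); first exact/phiG/Nl.
      by rewrite act_linl; apply: Gl; exact: phiG.
    - apply: (Gu ((a *o n) ** y)); first exact/phiG/Nact.
      by rewrite -act_assoc; apply: Ga; exact: phiG.
    - have <- : gcomp (k + h) (phi n) = phi n; last exact: gcomp_in.
      apply: (Gu (n ** y)); last exact: phiG.
      rewrite -(gcomp_id (act_comp kn yi.1)); apply: Gh; exact: phiG.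
  have [z [zi zE]] := baer i h N phi Nphi; exists z.
  pose G' : set (Y * E) := [set p | exists u w a,
    [/\ G (u, w), p.1 = u + a ** y & p.2 = w + a ** z]].
  have <- : G' = G.
    apply: Gmax => [|[u w] Guw]; last by exists u, w, 0; split=> //=; rewrite act0l addr0.
    split.
    - split; first by exists 0, 0, 0; split=> //=; rewrite act0l addr0.
      move=> c _ _ _ _ [u [w [a [/= uw -> ->]]]] [u' [w' [a' [/= uw' -> ->]]]].
      exists (c *: u + u'), (c *: w + w'), (c *: a + a'); split; first exact: Gl.
        by rewrite /= act_linl scalerDr addrACA.
      by rewrite /= act_linl scalerDr addrACA.
    - move=> b _ _ [u [w [a [/= uw -> ->]]]].
      exists (b ** u), (b ** w), (b *o a); split; first exact: Ga.
        by rewrite /= actDr act_assoc.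
      by rewrite /= actDr act_assoc.
    - move=> k _ _ [u [w [a [/= uw -> ->]]]].
      exists (gcomp k u), (gcomp k w), (gcomp (k - h) a); split; first exact: Gh.
        by rewrite /= (linD (gcomp_lin k)) (gcomp_actr _ _ yi.1).
      by rewrite /= (linD (gcomp_lin k)) (gcomp_actr _ _ zi.1).
    - move=> _ [u [w [a [/= uw u0 ->]]]].
      have ay : (a *o e i) ** y = - u.
        by rewrite -act_assoc yi.2; apply/eqP; rewrite eq_sym -subr_eq0 -opprD -u0 oppr0.
      have Nuw : G (- u, - w) by have := Gl (-1) _ _ _ _ uw G00; rewrite !scaleN1r !addr0.
      have Na : N (a *o e i).
        by split; [rewrite -omulA (e_idem s he)|exists (- w); rewrite ay].
      have := phiG _ Na; rewrite ay (zE _ Na) -act_assoc zi.2 => /(Gu _ _ _ Nuw) <-.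
      by rewrite subrr.
  by exists 0, 0, (e i); split=> //=; rewrite ?yi.2 ?zi.2 add0r.
have /choice[g gE] := Gtot.
have gl : linear g.
  by move=> c u v; apply: (Gu (c *: u + v)) => //; exact: Gl.
have ga a y : g (a ** y) = a ** g y by apply: (Gu (a ** y)) => //; exact: Ga.
have gh h y : homog h y -> homog h (g y).
  move=> hy; have <- : gcomp h (g y) = g y; last exact: gcomp_in.
  by apply: (Gu y) => //; rewrite -{1}(gcomp_id hy); exact: Gh.
exists (GrHom gl ga gh) => x; apply: (Gu (m x)); first exact: gE.
by apply: G0G; exists x.
Qed.

(** A e_j is dual to e_i' A, so a partial homomorphism to A e_j is a linear form,
and extends as such. *)
Lemma perfect_baer i' j d lam : perfect e s i' j d lam ->
  forall i h N phi, @partial_hom i h (regular he s) N phi ->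
    (forall n, N n -> phi n *o e j = phi n) ->
  exists z, cor e s i j h z /\ forall n, N n -> phi n = n *o z.
Proof.
move=> lP i h N phi Np phij; have [ll lc lb _] := lP.
have [Ng Ni pl pa ph] := Np; have /gsubP[Ns Nh Na] := Ng.
have [|g [gl gN]] := ext_form (phi := fun n => lam (phi n)) Ns.
  by move=> c u v Nu Nv; rewrite pl // ll.
have [z [zc zE]] := perfect_full he lP i (d - h) gl; rewrite subKr in zc.
have key n : N n -> lam (n *o z) = lam (phi n).
  move=> Nn; rewrite -lc (crn_mulr he _ _ _ zc) zE; last exact: (cor_crn s he).
  have Nd := Nh (d - h) n Nn.
  have -> : crn e s i' i (d - h) n = e i' *o gcomp (d - h) n.
    by rewrite /crn -omulA Ni.
  rewrite gN; last exact: Na.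
  rewrite pa // [lam _](perfect_el he _ lP) -gN // -(gN n) //.
  apply/esym/lin_gcomp => // k kd; rewrite gN; last exact: Nh.
  apply: (perfect_deg lP (ph _ _ (Nh k n Nn) (gcomp_in k n))) => E.
  by apply: kd; rewrite -E addrK.
exists z; split=> // n Nn; apply/eqP; rewrite -subr_eq0; apply/eqP.
have [_ _ zj] := zc.
apply: lb => [|c]; first by rewrite omulBl phij // -omulA zj.
rewrite omulBr (linB ll) omulA key; last exact: Na.
by rewrite pa // subrr.
Qed.

Section FreeInjective.
Variables (T : choiceType) (j : T -> I) (d : T -> H) (Z : set T).
Local Notation F := (free s he j d Z).

Hypothesis Zperfect : forall t, Z t -> exists i h lam, perfect e s i (j t) h lam.

Lemma free_injective :
  (forall i h N (phi : A -> F), partial_hom i h N phi ->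
     exists X : {fset T}, forall n t, N n -> t \notin X -> coef (phi n) t = 0) ->
  injective_obj (C := C) F.
Proof.
move=> fin; apply: baer_criterion => i h N phi Np.
have [X X0] := fin i h N phi Np; have [Ng Ni pl pa ph] := Np.
have /choice[z zP] : forall t, exists z, [/\ cor e s i (j t) (h - d t) z,
    forall n, N n -> coef (phi n) t = n *o z & ~ Z t \/ t \notin X -> z = 0].
  move=> t; have z0 : (forall n, N n -> coef (phi n) t = 0) -> exists z,
      [/\ cor e s i (j t) (h - d t) z, forall n, N n -> coef (phi n) t = n *o z &
      ~ Z t \/ t \notin X -> z = 0].
    move=> n0; exists 0; split=> // [|n Nn]; last by rewrite omul0r n0.
    exact: (cor_sub e s _ _ _).1.
  have [tX|/negP tX] := pselect (t \in X); last by apply: z0 => n Nn; exact: X0.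
  have [Zt|Zt] := pselect (Z t); last by apply: z0 => n _; exact: coef_Z.
  have [i' [l [lam lP]]] := Zperfect Zt.
  have [||z [zc zE]] := perfect_baer lP (i := i) (h := h - d t) (N := N)
      (phi := fun n => coef (phi n) t).
  - split=> // [c u v Nu Nv|a n Nn|k n Nn kn]; first by rewrite pl.
      by rewrite pa.
    by rewrite addrA; apply: coef_homog; exact: ph.
  - by move=> n _; exact: coef_e.
  - by exists z; split=> // -[/(_ Zt)//|/negP].
have [||u [ui uE]] := free_mkE (s := s) he (j := j) (d := d) (Z := Z) (F := z) (i := i) (h := h).
- split=> [t|t|t Zt|]; [by have [[]] := zP t|by have [[]] := zP t| |].
    by have [_ _] := zP t; apply; left.
  apply: sub_finite_set (finite_fset X) => t /=; apply: contraNT => tX.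
  by have [_ _ ->] := zP t => //; right.
- by move=> t; have [[_]] := zP t.
exists u; split=> // n Nn; apply: coefI => t.
by rewrite coef_act uE; have [_ ->] := zP t.
Qed.

Lemma free_finite_injective : finite_set Z -> injective_obj (C := C) F.
Proof.
move=> /finite_fsetP[X ZX]; apply: free_injective => i h N phi _.
by exists X => n t _ tX; apply: coef_Z; rewrite ZX; exact/negP.
Qed.

(** The simple socles of the summands give coordinates on the socle. *)
Lemma free_finite_cogenerated : finite_set Z -> finitely_cogenerated F.
Proof.
move=> /finite_fsetP[X ZX].
have XZ t : t \in X -> Z t by rewrite ZX.
have /choice[sg sgP] : forall t, exists sg : A, t \in X -> [/\ exists h, homog h sg,
    sg *o e (j t) = sg, sg <> 0 & forall h b, homog h b -> b *o e (j t) = b ->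
      b <> 0 -> exists a k, homog k a /\ a *o b = sg].
  move=> t; have [tX|tX] := boolP (t \in X); last by exists 0.
  have [i [h [lam lP]]] := Zperfect (XZ _ tX).
  have [u ue] := corep_essential he (perfect_corep he lP 0).
  have [[uh _] u0 _] := ue; exists (coef u tt) => _; split.
  - by exists (h + 0 - 0); exact: coef_homog uh.
  - exact: coef_e.
  - by move=> cu; apply: u0; apply: coefI => -[].
  move=> l b lb bj b0.
  have cb : coef (b ** pgen he s (j t) 0) tt = b by rewrite coef_act coef_pgen.
  have [||a [k [ka ab]]] := essential_homog ue (h := l + 0) (y := b ** pgen he s (j t) 0).
  - by apply: act_comp => //; case: (in_piece_pgen he s (j t) 0).
  - by move=> y0; apply: b0; rewrite -cb y0.
  by exists a, k; split=> //; rewrite -ab coef_act cb.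
have bE t u : t \in X -> coef (sg t ** bas s he j d Z t) u = if u == t then sg t else 0.
  move=> tX; rewrite coef_act coef_basZ; last exact: XZ.
  by case: eqP => _; [have [_ ->] := sgP t tX|exact: omul0r].
apply: (coordinates_finitely_cogenerated he (V := A) (Z := X) (p := fun t u => coef u t)
  (tau := fun t => sg t ** bas s he j d Z t)).
- exact: coef_lin.
- by move=> t a u u0; rewrite coef_act u0 omul0r.
- move=> u u0; apply: coefI => t; have [tX|tX] := boolP (t \in X); first exact: u0.
  by apply: coef_Z; rewrite ZX; exact/negP.
- move=> t tX; have [[h hs] _ _ _] := sgP t tX; exists (h + d t); apply: act_comp => //.
  by case: (in_piece_bas s he j d (XZ _ tX)).
- by move=> t u tX uX tu; rewrite bE //; case: eqP.
- by move=> t tX; rewrite bE // eqxx; case: (sgP t tX).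
- move=> t h u tX hu ut; have [_ _ _ ess] := sgP t tX.
  have [a [k [ka au]]] := ess _ _ (coef_homog t hu) (coef_e u t) ut.
  by exists a, k; split=> //; rewrite bE // eqxx coef_act.
Qed.

End FreeInjective.

End Baer.

(** * Free families in an injective module *)

Section Retracts.
Variables (K : fieldType) (H : zmodType) (A : gralgebra K H) (I : choiceType).
Variables (e : I -> A) (s : side) (he : distinguished_family e).
Implicit Types M N : grmod A s.

Lemma socle_sub M : is_subspace (graded_socle M).
Proof.
split=> [|c _ _ [n [y [yS ->]]] [n' [y' [yS' ->]]]].
  by exists 0, (fun=> 0); split=> [[]//|]; rewrite big_ord0.
exists (n + n')%N, (fun k => match fintype.split k with inl i => c *: y i | inr i => y' i end).
split.
  move=> k; case: (fintype.split k) => i; last exact: yS'.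
  have [S Ss Sy] := yS i; exists S => //; have [[[Sl _] _] _ _] := Ss.
  exact: subZ.
rewrite big_split_ord scaler_sumr; congr (_ + _); apply: eq_bigr => i _.
  by rewrite (unsplitK (inl _ i)).
by rewrite (unsplitK (inr _ i)).
Qed.

Lemma simple_socle M (S : set M) x :
  simple_graded_submodule S -> S x -> graded_socle M x.
Proof. by move=> Ss Sx; exists 1%N, (fun=> x); split=> [_|]; [exists S|rewrite big_ord1]. Qed.

Lemma gsub_preim M N (f : grhom M N) (L : set N) :
  graded_submodule L -> graded_submodule [set x | L (f x)].
Proof.
move=> /gsubP[Ls Lh La]; apply/gsubP; split=> [|h x Lx|a x Lx].
- split=> [|c x y Lx Ly]; first by rewrite /= hom0; exact: Ls.1.
  by rewrite /= grhom_lin; exact: Ls.2.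
- by rewrite /= -gcomp_hom; exact: Lh.
- by rewrite /= grhom_act; exact: La.
Qed.

Lemma gsubI M (P Q : set M) :
  graded_submodule P -> graded_submodule Q -> graded_submodule (P `&` Q).
Proof.
move=> /gsubP[Ps Ph Pa] /gsubP[Qs Qh Qa]; apply/gsubP; split=> [|h x [Px Qx]|a x [Px Qx]].
- split=> [|c x y [Px Qx] [Py Qy]]; first by split; [exact: Ps.1|exact: Qs.1].
  by split; [exact: Ps.2|exact: Qs.2].
- by split; [exact: Ph|exact: Qh].
- by split; [exact: Pa|exact: Qa].
Qed.

Lemma gsub0 M : graded_submodule [set (0 : M)].
Proof.
apply/gsubP; split=> [|h x ->|a x ->]; last by rewrite act0r.
  by split=> // c x y -> ->; rewrite scaler0 addr0.
by rewrite (lin0 (gcomp_lin h)).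
Qed.

Lemma gsub_ker M N (f : grhom M N) : graded_submodule [set x | f x = 0].
Proof. exact: (gsub_preim f (gsub0 N)). Qed.

Lemma hom_socle M N (f : grhom M N) x : graded_socle M x -> graded_socle N (f x).
Proof.
move=> [n [y [yS ->]]]; rewrite (lin_sum (grhom_lin f)).
apply: sub_sum => [|k _]; first exact: socle_sub.
have [S Ss Sy] := yS k; have [Sg _ Smin] := Ss.
have [->|fy] := pselect (f (y k) = 0); first exact: (socle_sub _).1.
apply: (@simple_socle _ [set f x | x in S]); last by exists (y k).
split; [exact: gsub_range|by apply: (gsub_n0 (x := f (y k))) => //; exists (y k)|].
move=> L Lg LS; have Pg := gsubI Sg (gsub_preim f Lg).
have [|P0|PS] := Smin _ Pg; first by move=> z [].
  left; apply/seteqP; split=> [z Lz|_ ->]; last by case: Lg => [[[]]].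
  have [u Su uz] := LS _ Lz; have : (S `&` [set x | L (f x)]) u by split; rewrite //= uz.
  by rewrite P0 => u0; rewrite -uz u0 hom0.
right; apply/seteqP; split=> // _ [u Su <-].
by move: Su; rewrite -PS => -[].
Qed.

Lemma retract_finitely_cogenerated M N (i : grhom N M) (r : grhom M N) :
  (forall x, r (i x) = x) -> finitely_cogenerated M -> finitely_cogenerated N.
Proof.
move=> ri [[n [g [gS gE]]] Mess]; split.
  exists n, (fun k => r (g k)); split=> [k|y /(hom_socle i) /gE[a ay]].
    exact: hom_socle.
  exists a; rewrite -[LHS]ri ay (lin_sum (grhom_lin r)).
  by apply: eq_bigr => k _; rewrite grhom_act.
move=> L Lg L0.
have [k [h [x [Lx _ x0]]]] := gsub_neq0 he Lg L0.
have iL0 : [set i y | y in L] <> [set 0].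
  apply: (gsub_n0 (x := i x)); first by exists x.
  by move=> ix; apply: x0; rewrite -[x]ri ix hom0.
have := Mess _ (gsub_range i Lg) iL0; set P := _ `&` _ => P0.
have [_ [[y Ly <-] yS] iy0] : exists2 z, P z & z <> 0.
  apply: contrapT => nz; apply: P0; apply/seteqP; split=> [z Pz|_ ->].
    by apply: contrapT => z0; apply: nz; exists z.
  by split; [case: (gsub_range i Lg) => [[[]]]|exact: (socle_sub _).1].
apply: (gsub_n0 (x := y)); last by move=> y0; apply: iy0; rewrite y0 hom0.
by split=> //; rewrite -[y]ri; exact: hom_socle.
Qed.

Lemma surj_finitely_generated M N (f : grhom M N) : (forall y, exists x, f x = y) ->
  finitely_generated [set: M] -> finitely_generated [set: N].
Proof.
move=> fs [n [g [_ gE]]]; exists n, (fun k => f (g k)); split=> // y _.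
have [x <-] := fs y; have [a ->] := gE x Logic.I; exists a.
by rewrite (lin_sum (grhom_lin f)); apply: eq_bigr => k _; rewrite grhom_act.
Qed.

Lemma free_finitely_generated (T : choiceType) (j : T -> I) (d : T -> H) (Z : set T) :
  finite_set Z -> finitely_generated [set: free s he j d Z].
Proof.
move=> /finite_fsetP[X ZX]; exists (size (X : seq T)).
exists (fun k => bas s he j d Z (tnth (in_tuple X) k)); split=> // u _.
exists (fun k => coef u (tnth (in_tuple X) k)).
have X0 t : t \notin X -> coef u t = 0.
  by move=> tX; apply: coef_Z; rewrite ZX; exact/negP.
by rewrite [LHS](free_expand X0) big_tnth.
Qed.

End Retracts.

Section Families.
Variables (K : fieldType) (H : zmodType) (A : gralgebra K H) (I : choiceType).
Variables (e : I -> A) (s : side) (he : weakly_basic e).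
Variable E : grmod A s.

Local Notation "a *o b" := (sided_mul s a b) (at level 40, left associativity).
Local Notation C := (grmod_cat A s).

(** Families of homogeneous elements of E are sets of triples (i, h, x), which
stand for the component of x in e_i E_h. *)
Local Notation T := (I * H * E)%type.
Definition tidx (t : T) : I := t.1.1.
Definition tdeg (t : T) : H := t.1.2.
Definition telt (t : T) : E := piece e (tidx t) (tdeg t) t.2.

Lemma in_piece_telt t : in_piece e (tidx t) (tdeg t) (telt t).
Proof. exact: (in_piece_piece he). Qed.

Definition ffree (Z : set T) : grmod A s := free s he tidx tdeg Z.

Definition ev (Z : set T) : grhom (ffree Z) E :=
  free_hom he (fun t (_ : Z t) => in_piece_telt t).

Lemma ev_bas Z t : Z t -> ev Z (bas s he tidx tdeg Z t) = telt t.
Proof. exact: free_hom_bas. Qed.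

Lemma ev_gsub Z : graded_submodule (range (ev Z)).
Proof. exact: (gsub_range _ (gsubT _)). Qed.

Lemma ev_support Z (u : ffree Z) : exists X : {fset T}, [/\ forall t, t \in X -> Z t,
  forall t, t \notin X -> coef u t = 0 & ev Z u = \sum_(t <- X) (coef u t ** telt t)].
Proof.
have [X X0] := coef_fin u; pose Y := [fset t in X | `[< Z t >]]%fset.
have Y0 t : t \notin Y -> coef u t = 0.
  rewrite !inE negb_and => /orP[/X0//|/asboolP]; exact: coef_Z.
exists Y; split=> //; last exact: free_evalE.
by move=> t; rewrite !inE => /andP[_ /asboolP].
Qed.

Lemma ev_telt Z t : Z t -> range (ev Z) (telt t).
Proof. by move=> Zt; exists (bas s he tidx tdeg Z t) => //; exact: ev_bas. Qed.

Lemma ev_sum Z (X : {fset T}) (c : T -> A) : (forall t, t \in X -> Z t) ->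
  range (ev Z) (\sum_(t <- X) (c t ** telt t)).
Proof.
move=> XZ; have /gsubP[Es _ Ea] := ev_gsub Z.
rewrite big_seq; apply: sub_sum => // t /XZ Zt; exact/Ea/ev_telt.
Qed.

Lemma ev_mono (Z Z' : set T) : Z `<=` Z' -> range (ev Z) `<=` range (ev Z').
Proof.
move=> ZZ' _ [u _ <-]; have [X [XZ _ ->]] := ev_support u.
by apply: ev_sum => t /XZ /ZZ'.
Qed.

Definition indep (Z : set T) : Prop := forall (X : {fset T}) (c : T -> A),
  (forall t, t \in X -> Z t) -> (forall t, c t *o e (tidx t) = c t) ->
  \sum_(t <- X) (c t ** telt t) = 0 -> forall t, t \in X -> c t = 0.

Lemma ev_inj Z : indep Z -> injective (ev Z).
Proof.
move=> Zi; apply: hom_inj => u; have [X [XZ X0 ->]] := ev_support u => u0.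
apply: coefI => t; have [tX|/X0//] := boolP (t \in X).
by rewrite (Zi X (coef u)) // => t'; exact: coef_e.
Qed.

Lemma indep0 : indep set0.
Proof. by move=> X c X0 _ _ t /X0. Qed.

Lemma ev_total x : exists X : {fset T}, range (ev [set` X]) x.
Proof.
apply: (piece_ind (P := fun x => exists X : {fset T}, range (ev [set` X]) x) he) => [|i h].
  split=> [|c u v [X Xu] [Y Yv]].
    by exists fset0; case: (ev_gsub [set` fset0]) => [[[]]].
  have XY (W : {fset T}) : (W `<=` X `|` Y)%fset -> [set` W] `<=` [set` (X `|` Y)%fset].
    by move=> /fsubsetP WXY t /= /WXY.
  exists (X `|` Y)%fset; have [[[_ El] _] _] := ev_gsub [set` (X `|` Y)%fset].
  apply: El.
    by apply: ev_mono Xu; apply: XY; exact: fsubsetUl.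
  by apply: ev_mono Yv; apply: XY; exact: fsubsetUr.
by exists [fset (i, h, x)]%fset; apply: (ev_telt (t := (i, h, x))); rewrite /= inE.
Qed.

Lemma finitely_generated_ev : finitely_generated [set: E] ->
  exists2 Z : set T, finite_set Z & forall y, exists u, ev Z u = y.
Proof.
move=> [n [g [_ gE]]]; have /choice[X XP] := fun k => ev_total (g k).
exists (\bigcup_(k in [set: 'I_n]) [set` X k]).
  by apply: bigcup_finite => // k _; exact: finite_fset.
move=> y; have [a ->] := gE y Logic.I.
have /gsubP[Es _ Ea] := ev_gsub (\bigcup_(k in [set: 'I_n]) [set` X k]).
suff [u _ uE] : range (ev (\bigcup_(k in [set: 'I_n]) [set` X k])) (\sum_k a k ** g k).
  by exists u.
apply: sub_sum => // k _; apply: Ea; apply: ev_mono (XP k).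
by move=> t tX; exists k.
Qed.

Section Step.
Hypothesis Ei : injective_obj (C := C) E.
Hypothesis Ip : forall i, exists j d lam, perfect e s i j d lam.

Variable Z : set T.
Hypotheses (Zi : indep Z) (Zinj : injective_obj (C := C) (ffree Z)).

(** Let pi be the projection of E along the span of Z. The dual of e_i A, with i
an index at which pi S is nonzero, is some A e_j up to a shift, and contains a
copy of pi S; the inverse of the embedding extends to a map from A e_j to pi E,
injective because the socle of A e_j is essential. *)
Lemma indep_extend (S : set E) : simple_graded_submodule S -> ~ S `<=` range (ev Z) ->
  exists t, [/\ ~ Z t, indep (Z `|` [set t]), S `<=` range (ev (Z `|` [set t])) &
    exists i d lam, perfect e s i (tidx t) d lam].
Proof.
move=> Ss SZ; have [Sg S0 Smin] := Ss.
have [r rev] := injective_retract Zinj (ev_inj Zi).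
have pl : linear (fun y => y - ev Z (r y)).
  by move=> c y y'; rewrite !grhom_lin scalerBr opprD addrACA.
have pa a y : a ** y - ev Z (r (a ** y)) = a ** (y - ev Z (r y)).
  by rewrite !grhom_act actBr.
have ph h y : homog h y -> homog h (y - ev Z (r y)).
  by move=> hy; apply: (subB (homog_sub _ _)) => //; do 2!apply: grhom_comp.
pose p : grhom E E := GrHom pl pa ph.
have pE y : p y = y - ev Z (r y) by [].
have pev u : p (ev Z u) = 0 by rewrite pE rev subrr.
have pp y : p (p y) = p y by rewrite [p y in LHS]pE (linB (grhom_lin p)) pev subr0.
have [y Sy py0] : exists2 y, S y & p y <> 0.
  apply: contrapT => ny; apply: SZ => y Sy; exists (r y) => //.
  apply/esym/eqP; rewrite -subr_eq0; apply/eqP.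
  by apply: contrapT => py; apply: ny; exists y.
have [i [h pc0]] := piece_neq0 he py0.
have [c [Sc ci pc_c]] : exists c, [/\ S c, in_piece e i h c & p c <> 0].
  exists (piece e i h y); split; last by rewrite -piece_hom.
    exact: (gsub_piece _ _ _ Sg Sy).
  exact: (in_piece_piece he).
have pci : in_piece e i h (p c) by exact: in_piece_hom.
have [||g0 [gl0 _ g1]] := @sep_form K E [set 0] (p c) => //.
  by split=> // k u v -> ->; rewrite scaler0 addr0.
have [j [d [lam lP]]] := Ip i.
have := perfect_corep he lP (h - d); rewrite [d + _]addrC subrK => PL.
have [ss se] := corep_essential he PL.
have [||psi psiE] := corep_hom he PL (g := fun y => g0 (piece e i h y)).
- exact: lin_comp gl0 (piece_lin _ _ _).
- by move=> z; rewrite (piece_id (in_piece_piece he _ _ _)).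
have psic : psi (p c) <> 0.
  move=> E0; have := psiE (p c); rewrite E0 piece_id // g1.
  have [Ll _ _ _] := PL; rewrite (lin0 Ll) => /esym/eqP.
  by rewrite oner_eq0.
have psi0 z : S z -> psi (p z) = 0 -> z = 0.
  have [|/seteqP[SP _]|PS] := Smin _ (gsubI Sg (gsub_preim p (gsub_ker psi))).
  - by move=> x [].
  - by move=> Sz pz; apply: SP; split.
  - by move: Sc; rewrite -PS => -[_ /psic].
(* psi embeds p S; injectivity of E extends the inverse of this embedding to chi. *)
have S'g := gsub_range p Sg.
pose inc := submod_incl he S'g.
have inc_p (u : submod he S'g) : exists2 z, S z & inc u = p z.
  by have [z Sz zE] := submod_in u; exists z.
have psi_inj : injective (grhom_compose psi inc).
  apply: hom_inj => u pu; have [z Sz zE] := inc_p u.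
  have z0 : z = 0 by apply: psi0 => //; rewrite -zE.
  have iu0 : inc u = inc 0 by apply: (etrans zE); rewrite z0 !hom0.
  exact: submod_incl_inj iu0.
have [chi chiE0] := Ei inc (inj_mono psi_inj).
have chiE u : chi (psi (inc u)) = inc u.
  exact: (congr1 (fun f : grhom _ E => f u) chiE0).
have chip z : S z -> chi (psi (p z)) = p z.
  move=> Sz; have [|u uE] := submod_inclP he S'g (x := p z); first by exists z.
  by rewrite -uE chiE.
(* Applying p makes the new element independent of the span of Z. *)
pose x := p (chi (pgen he s j (h - d))).
have xi : in_piece e j (h - d) x by do 2!apply: in_piece_hom; exact: in_piece_pgen.
pose t : T := (j, h - d, x).
have tE : telt t = x by exact: piece_id.
have [a aE] : exists a, a ** psi (p c) = ss.
  by have [_ _ sess] := se; apply: (sess h) => //; apply: grhom_comp; case: pci.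
have pchi_inj : injective (grhom_compose p chi).
  have pcs : p (chi ss) <> 0.
    rewrite -aE !grhom_act chip // pp => ac.
    by have [_ s0 _] := se; apply: s0; rewrite -aE -grhom_act ac hom0.
  exact: (essential_inj (f := grhom_compose p chi) he se pcs).
have px : p x = x by rewrite pp.
have evt b : (b ** x = 0) -> b *o e j = b -> b = 0.
  move=> bx bj; have : b ** pgen he s j (h - d) = 0.
    by apply: pchi_inj; rewrite hom0 -[LHS]/(p (chi _)) !grhom_act.
  by move=> /(congr1 (fun u : pfree he s j (h - d) => coef u tt)); rewrite coef_act coef_pgen bj.
have Zt : ~ Z t.
  move=> /ev_telt[u _ uE]; suff ej0 : e j = 0 by exact: e_neq0 he j ej0.
  apply: evt; last exact: (e_idem s he).
  by rewrite -px -tE -uE pev act0r.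
have prange y' : range (ev Z) y' -> p y' = 0 by move=> [u _ <-].
exists t; split=> //.
- move=> X b XZ bE.
  have bx : \sum_(t' <- X) b t' ** telt t' = 0 ->
      t \in X -> b t = 0 /\ \sum_(t' <- (X `\ t)%fset) b t' ** telt t' = 0.
    move=> b0 tX; move: b0; rewrite (big_fsetD1 t) //=; set y' := \sum_(_ <- _) _ => b0.
    have y'r : range (ev Z) y'.
      by apply: ev_sum => t'; rewrite !inE => /andP[/eqP tt' /XZ[]].
    have bt : b t = 0.
      apply: evt; last exact: bE.
      have := congr1 p b0; rewrite (linD (grhom_lin p)) (prange _ y'r) addr0 hom0.
      by rewrite tE grhom_act px.
    by split=> //; move: b0; rewrite bt act0l add0r.
  move=> b0 t' tX'; have [tX|tX] := boolP (t \in X).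
    have [bt b0'] := bx b0 tX; have [->//|tt'] := eqVneq t' t.
    apply: (Zi (X := (X `\ t)%fset)) => //; last by rewrite !inE tt'.
    by move=> t''; rewrite !inE => /andP[/eqP tt'' /XZ[]].
  apply: (Zi (X := X)) => // t'' tX''; have [//|tt''] := XZ _ tX''.
  by rewrite -tt'' tX'' in tX.
- move=> z Sz; rewrite -[z](subrK (p z)).
  have /gsubP[Es _ Ea] := ev_gsub (Z `|` [set t]).
  apply: subD => //.
    by rewrite pE subKr; apply: (ev_mono (Z := Z)); [exact: subsetUl|exists (r z)].
  have -> : p z = p (chi (psi (p z))) by rewrite chip // pp.
  rewrite [psi (p z)]pfree_expand !grhom_act -/x -tE.
  by apply/Ea/ev_telt; right.
- by exists i, d, lam.
Qed.

End Step.

End Families.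

(** * Finitely generated projectives and finitely cogenerated injectives *)

Section FinitelyGenerated.
Variables (K : fieldType) (H : zmodType) (A : gralgebra K H) (I : choiceType).
Variables (e : I -> A) (s : side) (he : weakly_basic e).

Local Notation "a *o b" := (sided_mul s a b) (at level 40, left associativity).
Local Notation C := (grmod_cat A s).

Definition left_perfect : Prop := forall i, exists j d lam, perfect e s i j d lam.
Definition right_perfect : Prop := forall j, exists i d lam, perfect e s i j d lam.

Lemma nakayama_perm_left : nakayama_perm e s -> left_perfect.
Proof. by move=> [nu [_ nuP]] i; exists (nu i). Qed.

Lemma nakayama_perm_right : nakayama_perm e s -> right_perfect.
Proof.
move=> [nu [[mu _ munu] nuP]] j; exists (mu j).
by have := nuP (mu j); rewrite munu.
Qed.

Lemma fg_projective_cogenerated (M : grmod A s) : right_perfect ->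
  finitely_generated [set: M] -> projective (C := C) M ->
  finitely_cogenerated M /\ injective_obj (C := C) M.
Proof.
move=> Jp Mfg Mp; have [Z Zfin Zs] := finitely_generated_ev he Mfg.
have [i iE] := projective_section Mp Zs.
have Zp t : Z t -> exists i h lam, perfect e s i (tidx t) h lam by [].
split.
  apply: (retract_finitely_cogenerated he iE).
  exact: (free_finite_cogenerated he _ Zp Zfin).
apply: (retract_injective iE).
exact: (free_finite_injective Zp Zfin).
Qed.

Lemma ev_bij_projective (E : grmod A s) (Z : set (I * H * E)) :
  indep e Z -> (forall y, exists u, ev he Z u = y) -> projective (C := C) E.
Proof.
move=> Zi Zs; have [g [gE _]] := bij_hom_inv (ev_inj (he := he) Zi) Zs.
apply: (retract_projective gE); exact: free_projective.
Qed.

Lemma cogenerated_fg_projective (E : grmod A s) : left_perfect ->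
  finitely_cogenerated E -> injective_obj (C := C) E ->
  finitely_generated [set: E] /\ projective (C := C) E.
Proof.
move=> Ip [[n [g [gS gE]]] Eess] Ei.
pose G (Z : set (I * H * E)) := [/\ finite_set Z, indep e Z &
  forall t, Z t -> exists i d lam, perfect e s i (tidx t) d lam].
have Ginj Z : G Z -> injective_obj (C := C) (ffree he Z).
  by move=> [Zfin _ Zp]; exact: (free_finite_injective Zp Zfin).
have G0 : G set0 by split=> //; exact: indep0.
have simple_ext Z (S : set E) : G Z -> simple_graded_submodule S ->
    exists Z', [/\ G Z', Z `<=` Z' & S `<=` range (ev he Z')].
  move=> ZG Ss; have [SZ|SZ] := pselect (S `<=` range (ev he Z)); first by exists Z; split.
  have [Zfin Zi Zp] := ZG.
  have [t [_ ti tS tp]] := indep_extend Ei Ip Zi (Ginj _ ZG) Ss SZ.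
  exists (Z `|` [set t]); split; [|exact: subsetUl|exact: tS].
  split=> //; first by rewrite finite_setU; split.
  by move=> t' [/Zp//|->].
have socle_ext Z y : G Z -> graded_socle E y ->
    exists Z', [/\ G Z', Z `<=` Z' & range (ev he Z') y].
  move=> ZG [m [y' [y'S ->]]].
  elim: (index_enum _) => [|k r [Z1 [Z1G ZZ1 Z1r]]].
    exists Z; split=> //; rewrite big_nil.
    by case: (ev_gsub he Z) => [[[]]].
  have [S Ss Sy] := y'S k.
  have [Z2 [Z2G Z12 SZ2]] := simple_ext Z1 S Z1G Ss.
  exists Z2; split=> //; first exact: subset_trans Z12.
  rewrite big_cons; have /gsubP[Es _ _] := ev_gsub he Z2.
  by apply: subD => //; [exact: SZ2|exact: ev_mono Z1r].
have [Z [ZG Zg]] : exists Z, G Z /\ forall k, range (ev he Z) (g k).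
  suff /(_ (enum 'I_n))[Z [ZG Zg]] : forall r : seq 'I_n, exists Z, G Z /\
      forall k, k \in r -> range (ev he Z) (g k).
    by exists Z; split=> // k; apply: Zg; rewrite mem_enum.
  elim=> [|k r [Z [ZG Zr]]]; first by exists set0.
  have [Z' [Z'G ZZ' gk]] := socle_ext Z _ ZG (gS k).
  exists Z'; split=> // k'; rewrite inE => /orP[/eqP ->//|/Zr].
  exact: ev_mono.
have [_ Zi _] := ZG; have Zinj := Ginj Z ZG.
have [r rE] := injective_retract Zinj (ev_inj (he := he) Zi).
have Zs y : exists u, ev he Z u = y.
  exists (r y); apply/esym/eqP; rewrite -subr_eq0; apply/eqP; apply: contrapT => y0.
  have ry : [set x | r x = 0] (y - ev he Z (r y)).
    by rewrite /= (linB (grhom_lin r)) rE subrr.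
  apply: (Eess _ (gsub_ker r) (gsub_n0 ry y0)).
  apply/seteqP; split=> [z [rz /gE[a zE]]|_ ->]; last first.
    split; first by rewrite /= hom0.
    exact: (socle_sub _).1.
  have [u _ uz] : range (ev he Z) z.
    have /gsubP[Es _ Ea] := ev_gsub he Z.
    by rewrite zE; apply: sub_sum => // k _; exact: Ea.
  by move: rz; rewrite /= -uz rE => ->; rewrite hom0.
split; last exact: ev_bij_projective Zi Zs.
apply: (surj_finitely_generated Zs); apply: free_finitely_generated.
by case: ZG.
Qed.

Lemma cdual_cogenerated i d : finitely_cogenerated (cdual s he i d).
Proof.
have [x xe] := corep_essential he (cdual_corep s he i d).
exact: (essential_cogenerated he xe).
Qed.

(** The dual of e_i A is finitely cogenerated and injective, hence projective,
which gives i |-> j. Conversely A e_j is then finitely cogenerated and injective,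
so it contains, and splits off, a copy of some A e_k with k in the image; the
splitting is an idempotent of the local ring e_j A_0 e_j, so j = k. *)
Lemma coincidence_nakayama_perm :
  (forall M : C, (finitely_generated (M := M) (@setT M) /\ projective M) <->
     (finitely_cogenerated M /\ injective_obj M)) -> nakayama_perm e s.
Proof.
move=> A3.
have Ip : left_perfect.
  move=> i; apply: (projective_perfect (he := he)).
  have [_ /(_ _)[]//] := A3 (cdual s he i 0); split.
    exact: cdual_cogenerated.
  exact: corep_injective (cdual_corep s he i 0).
apply: (nakayama_perm_intro he) => // j.
pose P := pfree he s j 0; pose gn : P := pgen he s j 0.
have [Pcog Pi] : finitely_cogenerated P /\ injective_obj (C := C) P.
  apply/A3; split; last exact: free_projective.
  by apply: free_finitely_generated; apply: sub_finite_set (finite_set1 tt) => -[].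
have [S Ss] : exists S : set P, simple_graded_submodule S.
  have [_ ess] := Pcog; apply: contrapT => /forallNP noS.
  have gn0 : gn <> 0.
    move=> g0; suff ej0 : e j = 0 by exact: e_neq0 he j ej0.
    by rewrite -(coef_pgen he s j 0) [pgen _ _ _ _]g0.
  apply: (ess _ (gsubT P) (gsub_n0 (x := gn) Logic.I gn0)).
  apply/seteqP; split=> [x [_ [[|n] [y [yS ->]]]]|_ ->].
  - by rewrite big_ord0.
  - by have [S Ss _] := yS ord0; case: (noS S).
  - by split=> //; exact: (socle_sub _).1.
have [Sg S0 _] := Ss.
have inj0 : injective_obj (C := C) (ffree he (set0 : set (I * H * P))).
  by apply: free_finite_injective.
have [|t [_ ti _ [i [d [lam lP]]]]] := indep_extend Pi Ip (@indep0 _ _ _ _ e s P) inj0 Ss.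
  move=> SZ; apply: S0; apply/seteqP; split=> [x /SZ[u _ <-]|_ ->].
    have [X [X0 _ ->]] := ev_support u.
    by rewrite big1_seq // => t /andP[_ /X0].
  by case: Sg => [[[]]].
rewrite set0U in ti; exists i, d, lam.
suff -> : j = tidx t by [].
have tinj : injective_obj (C := C) (ffree he [set t]).
  by apply: free_finite_injective => // _ ->; exists i, d, lam.
have [r rE] := injective_retract tinj (ev_inj (he := he) ti).
pose k := tidx t.
pose x := coef (telt e t : P) tt; pose y := coef (r gn) t.
have xc : cor e s k j (tdeg t) x.
  have [ht kt] := in_piece_telt he t; split; last exact: coef_e.
    by rewrite -[tdeg t]subr0; exact: coef_homog.
  by rewrite -coef_act kt.
have yc : cor e s j k (- tdeg t) y.
  have [hg jg] : in_piece e j 0 (r gn) by apply: in_piece_hom; exact: in_piece_pgen.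
  split; last exact: coef_e.
    by rewrite -sub0r; exact: coef_homog.
  by rewrite -coef_act jg.
have xy : x *o y = e k.
  rewrite -coef_act -grhom_act -pfree_expand.
  by rewrite -(ev_bas he (Z := [set t])) // rE coef_basZ // eqxx.
(* As x y = e_k, the element y x is a nonzero idempotent. *)
have yxc : cor e s j j 0 (y *o x) by have := cor_mul yc xc; rewrite addNr.
apply: (cor_iso_eq he yc xc) => //.
have [|yx0|//] := corner_idem he yxc.
  by rewrite -omulA (omulA s x) xy; have [_ _ <-] := yc; rewrite -!omulA (omulA s (e k) (e k)) (e_idem s he).
suff ek0 : e k = 0 by case: (e_neq0 he ek0).
have -> : e k = (x *o y) *o (x *o y) by rewrite xy (e_idem s he).
by rewrite -omulA (omulA s y) yx0 omul0l omul0r.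
Qed.

Lemma nakayama_perm_coincidence : nakayama_perm e s ->
  forall M : C, (finitely_generated (M := M) (@setT M) /\ projective M) <->
     (finitely_cogenerated M /\ injective_obj M).
Proof.
move=> nak M; split=> [[Mfg Mp]|[Mcog Mi]].
  exact: fg_projective_cogenerated (nakayama_perm_right nak) Mfg Mp.
exact: cogenerated_fg_projective (nakayama_perm_left nak) Mcog Mi.
Qed.

End FinitelyGenerated.

(** * The Noetherian case *)

Section Noetherian.
Variables (K : fieldType) (H : zmodType) (A : gralgebra K H) (I : choiceType).
Variables (e : I -> A) (he : weakly_basic e).

(** A family without a maximal member would contain a strictly increasing chain, by
dependent choice. *)
Lemma acc_max (P Q : set A -> Prop) : ACC P -> (forall N, Q N -> P N) ->
  (exists N, Q N) -> exists N, Q N /\ forall N', Q N' -> N `<=` N' -> N' = N.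
Proof.
move=> acc QP [N0 QN0]; apply: contrapT => /forallNP nomax.
have /choice[f fP] : forall N, exists N', Q N -> [/\ Q N', N `<=` N' & N' <> N].
  move=> N; have [QN|QN] := pselect (Q N); last by exists N.
  apply: contrapT => /forallNP nf; apply: (nomax N); split=> // N' QN' NN'.
  by apply: contrapT => ne; apply: (nf N').
pose c n := iter n f N0.
have Qc n : Q (c n) by elim: n => //= n /fP[].
have [n|n|n nE] := acc c; first exact/QP/Qc.
  by have [] := fP _ (Qc n).
by have [_ _] := fP _ (Qc n); apply; exact: (nE n.+1 (leqnSn n)).
Qed.

Definition acc_ideals s i : Prop := ACC (fun N : set A =>
  graded_submodule (N : set (regular he s)) /\
  forall n, N n -> sided_mul s n (e i) = n).

Lemma noetherian_acc s i : graded_locally_noetherian e -> acc_ideals s i.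
Proof.
move=> noeth; have [accl accr] := noeth i.
case: s => N NP Nincr.
  apply: accl => // n; have [Ng Ni] := NP n; split=> // x /Ni xi.
  by exists x.
apply: accr => // n; have [Ng Ni] := NP n; split=> // x /Ni xi.
by exists x.
Qed.

Section Sided.
Variable s : side.
Local Notation "a *o b" := (sided_mul s a b) (at level 40, left associativity).
Local Notation C := (grmod_cat A s).

(** A left ideal below A e_i is finitely generated, so its image in a direct sum
meets finitely many summands. *)
Lemma free_noetherian_injective (T : choiceType) (j : T -> I) (d : T -> H) (Z : set T) :
  (forall i, acc_ideals s i) -> right_perfect e s ->
  injective_obj (C := C) (free s he j d Z).
Proof.
move=> acc Jp; apply: free_injective => // i h N phi Np.
have [Ng Ni pl pa ph] := Np; have /gsubP[Ns Nh Na] := Ng.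
pose NX (X : {fset T}) : set A :=
  [set n | N n /\ forall t, t \notin X -> coef (phi n) t = 0].
pose Q M := exists X, M = NX X.
have p0 : phi 0 = 0.
  have := pl (-1) 0 0 Ns.1 Ns.1.
  by rewrite scaler0 addr0 scaleN1r addNr.
have [||M [[X ->] Xmax]] := acc_max (Q := Q) (acc i).
- move=> _ [X ->]; split=> [|n [/Ni]//].
  apply/gsubP; split=> [|k n [Nn n0]|a n [Nn n0]].
  + split=> [|c u v [Nu u0] [Nv v0]].
      by split=> [|t _]; [exact: Ns.1|rewrite p0].
    split; first exact: Ns.2.
    by move=> t tX; rewrite pl // coef_lin u0 // v0 // scaler0 addr0.
  + split; first exact: Nh.
    move=> t tX; rewrite (partial_hom_gcomp Np) // coef_gcomp n0 //.
    exact: lin0 (gcomp_lin _).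
  + split; first exact: Na.
    by move=> t tX; rewrite pa // coef_act n0 // omul0r.
- by exists (NX fset0), fset0.
exists X => n t Nn tX; have [Y Y0] := coef_fin (phi n).
have XY : NX (X `|` Y)%fset = NX X.
  apply: Xmax => [|m [Nm m0]]; first by exists (X `|` Y)%fset.
  by split=> // u; rewrite inE negb_or => /andP[/m0].
have : NX X n.
  rewrite -XY; split=> // u; rewrite inE negb_or => /andP[_ /Y0//].
by case=> _; apply.
Qed.

(** ** Descending chains by duality *)

Section Perp.
Variables (i j : I) (d : H) (lam : A -> K^o).
Hypothesis lP : perfect e s i j d lam.

Definition perp (L : set A) : set A :=
  [set a | e i *o a = a /\ forall n, L n -> lam (a *o n) = 0].

Let lam_mul a n l : lam (a *o gcomp l n) = lam (gcomp (d - l) a *o n).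
Proof.
have [ll _ _ _] := lP.
have -> : lam (a *o gcomp l n) = lam (gcomp (d - l) a *o gcomp l n).
  apply: (lin_gcomp (g := fun a => lam (a *o gcomp l n))).
    exact: lin_comp ll (@sided_mul_linl _ _ A s _).
  move=> k kd; apply: (perfect_deg lP (homog_mul s (gcomp_in k a) (gcomp_in l n))).
  by move=> E; apply: kd; rewrite -E addrK.
apply/esym; apply: (lin_gcomp (g := fun n => lam (gcomp (d - l) a *o n))).
  exact: lin_comp ll (@sided_mul_linr _ _ A s _).
move=> k kd; apply: (perfect_deg lP (homog_mul s (gcomp_in (d - l) a) (gcomp_in k n))).
by move=> E; apply: kd; apply: (addrI (d - l)); rewrite E subrK.
Qed.

Lemma perp_gsub (L : set A) : graded_submodule (L : set (regular he s)) ->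
  graded_submodule (perp L : set (regular he (opp_side s))).
Proof.
move=> /gsubP[_ Lh La]; have [ll _ _ _] := lP.
apply/gsubP; split=> [|h a [ia a0]|c a [ia a0]].
- split=> [|c a b [ia a0] [ib b0]].
    by split=> [|n _]; [exact: omul0r|rewrite omul0l (lin0 ll)].
  split=> [|n Ln]; first by rewrite omulDr omulZr ia ib.
  by rewrite omulDl omulZl ll a0 // b0 // scaler0 addr0.
- split=> [|n Ln]; first by rewrite -(gcomp_el s he) ia.
  by rewrite -[h](subKr d) -lam_mul; apply: a0; exact: Lh.
- split=> [|n Ln]; first by rewrite /= sided_mul_opp omulA ia.
  by rewrite /= sided_mul_opp -omulA; apply: a0; exact: La.
Qed.

(** Graded submodules of A e_j are determined by their orthogonals, degree by
degree, as in a finite dimensional space. *)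
Lemma perp_perp (L : set A) : graded_submodule (L : set (regular he s)) ->
  (forall n, L n -> n *o e j = n) ->
  forall b, b *o e j = b -> (forall a, perp L a -> lam (a *o b) = 0) -> L b.
Proof.
move=> Lg Lj b bj b0; have /gsubP[Ls Lh La] := Lg.
have /gsubP[_ Ph Pa] := perp_gsub Lg; have [ll lc lb _] := lP.
apply: (crn_ind he bj Ls) => k l.
pose c := crn e s k j l b; have cc : cor e s k j l c by exact: (cor_crn s he).
have c0 a : perp L a -> lam (a *o c) = 0.
  move=> aP; rewrite /c /crn -omulA -(gcomp_er s he) bj omulA lam_mul; apply: b0.
  by apply: Ph; have := Pa (e k) a aP; rewrite /= sided_mul_opp.
pose Q := [set f : A -> K^o | exists2 n, L n /\ cor e s k j l n &
  f = fun a => lam (a *o n)].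
have Qs : is_subspace Q.
  split=> [|x _ _ [n [Ln nc] ->] [n' [Ln' nc'] ->]].
    exists 0; first by split; [exact: Ls.1|exact: (cor_sub e s _ _ _).1].
    by apply/funext => a; rewrite omul0r (lin0 ll).
  exists (x *: n + n').
    by split; [exact: Ls.2|exact: (cor_sub e s _ _ _).2].
  by apply/funext => a; rewrite omulDr omulZr ll.
have [|||_ [n [Ln nc] ->] nE] := finite_dim_bidual (cor_sub e s i k (d - l))
    (cor_finite_dim he s i k (d - l)) Qs _ (s0 := fun a => lam (a *o c)) _.
- by move=> _ [n _ ->]; exact: (lin_comp ll (@sided_mul_linl _ _ A s n)).
- by move=> x u v _ _; rewrite omulDl omulZl ll.
- move=> r rc rQ; apply: c0; split=> [|n Ln]; first by case: rc.
  rewrite -lc (crn_mull he _ _ _ rc) subKr.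
  apply: (rQ (fun a => lam (a *o crn e s k j l n))).
  exists (crn e s k j l n) => //; split; last exact: (cor_crn s he).
  by rewrite /crn -omulA -(gcomp_er s he) Lj //; exact/La/Lh.
rewrite -/c; suff -> : c = n by [].
have [_ _ cj] := cc; have [_ _ nj] := nc.
apply/eqP; rewrite -subr_eq0; apply/eqP; apply: lb => [|a].
  by rewrite omulBl cj nj.
rewrite omulBr (linB ll) -lc -[X in _ - X]lc (crn_mulr he _ _ _ cc).
rewrite (crn_mulr he _ _ _ nc) nE ?subrr //.
exact: (cor_crn s he).
Qed.

(** A maximal orthogonal comes from a minimal submodule, since a submodule is
determined by its orthogonal. *)
Lemma dcc_min (Q : set A -> Prop) : acc_ideals (opp_side s) i ->
  (forall L, Q L -> graded_submodule (L : set (regular he s)) /\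
     forall n, L n -> n *o e j = n) ->
  (exists L, Q L) -> exists L, Q L /\ forall L', Q L' -> L' `<=` L -> L' = L.
Proof.
move=> acc QP [L0 QL0].
have [_ [L QL ->]||_ [[L QL ->] Lmax]] :=
    acc_max (Q := fun P => exists2 L, Q L & P = perp L) acc.
- split; first by case: (QP L QL) => Lg _; exact: perp_gsub.
  by move=> a [ia _]; rewrite sided_mul_opp.
- by exists (perp L0), L0.
exists L; split=> // L' QL' L'L; apply/seteqP; split=> // x Lx.
have [Lg Lj] := QP L QL; have [L'g L'j] := QP L' QL'.
apply: (perp_perp L'g L'j (Lj _ Lx)) => a.
have -> : perp L' = perp L.
  apply: Lmax; first by exists L'.
  by move=> b [ib b0]; split=> // n /L'L; exact: b0.
by case=> _; apply.
Qed.

(** Take L minimal among the graded submodules of A e_j with L c nonzero; then L c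
is simple, because the preimage in L of a smaller submodule is smaller than L. *)
Lemma exists_simple (E : grmod A s) h (c : E) : acc_ideals (opp_side s) i ->
  in_piece e j h c -> c <> 0 -> exists S, simple_graded_submodule S /\
    S `<=` [set a ** c | a in [set: A]].
Proof.
move=> acc [hc jc] c0.
pose Q (L : set A) := [/\ graded_submodule (L : set (regular he s)),
  forall n, L n -> n *o e j = n & exists2 a, L a & a ** c <> 0].
have [L [Lg Lj _]||L [[Lg Lj [a0 La0 ac0]] Lmin]] := dcc_min (Q := Q) acc.
- by [].
- exists [set a | a *o e j = a]; split=> //.
    apply/gsubP; split=> [|k n|b n].
    + split=> [|k u v]; first exact: omul0l.
      by move=> /= uj vj; rewrite omulDl omulZl uj vj.
    + by move=> /= nj; rewrite -(gcomp_er s he) nj.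
    + by move=> /= nj; rewrite -omulA nj.
  by exists (e j); [exact: (e_idem s he)|rewrite jc].
have /gsubP[Ls Lh La] := Lg.
exists [set a ** c | a in L]; split; last by move=> _ [a _ <-]; exists a.
have Sg : graded_submodule [set a ** c | a in L].
  apply/gsubP; split=> [|k _ [a Lla <-]|b _ [a Lla <-]].
  - split=> [|k _ _ [a Lla <-] [b Lb <-]]; first by exists 0; [exact: Ls.1|exact: act0l].
    by exists (k *: a + b); [exact: Ls.2|rewrite act_linl].
  - by exists (gcomp (k - h) a); [exact: Lh|rewrite (gcomp_actr _ _ hc)].
  - by exists (b *o a); [exact: La|rewrite act_assoc].
split=> //; first by apply: (gsub_n0 (x := a0 ** c)) => //; exists a0.
move=> N Ng NS; have [->|N0] := pselect (N = [set 0]); [by left|right].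
have [k [l [x [Nx [lx _] x0]]]] := gsub_neq0 he Ng N0.
have /gsubP[Ns Nh Na] := Ng.
have <- : [set a | L a /\ N (a ** c)] = L.
  apply: Lmin; last by move=> a [].
  split=> [|n [/Lj]//|].
    apply/gsubP; split=> [|m a [Lla Nac]|b a [Lla Nac]].
    - split=> [|m u v [Lu Nu] [Lv Nv]]; first by split; [exact: Ls.1|rewrite act0l; exact: Ns.1].
      by split; [exact: Ls.2|rewrite act_linl; exact: Ns.2].
    - split; first exact: Lh.
      by have := Nh (m + h) _ Nac; rewrite (gcomp_actr _ _ hc) addrK.
    - split; first exact: La.
      by have := Na b _ Nac; rewrite act_assoc.
  have [a Lla ax] := NS _ Nx; exists a; last by rewrite ax.
  by split; rewrite ?ax.
apply/seteqP; split=> [y Ny|_ [a [_ Nac] <-]//].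
have [a Lla ay] := NS _ Ny; exists a => //.
by split; rewrite ?ay.
Qed.

End Perp.

(** ** Projective and injective objects coincide *)

Lemma noetherian_projective_injective (M : grmod A s) :
  (forall i, acc_ideals s i) -> right_perfect e s ->
  projective (C := C) M -> injective_obj (C := C) M.
Proof.
move=> acc Jp Mp; have [p ps] := cover_surj he M.
have [i pi] := projective_section Mp ps.
by apply: (retract_injective pi); exact: free_noetherian_injective.
Qed.

(** A maximal free family in an injective module spans it: otherwise the kernel
of the projection onto its span contains a simple submodule, along which the
family can be extended. *)
Lemma noetherian_injective_projective (E : grmod A s) :
  (forall i, acc_ideals s i) -> (forall i, acc_ideals (opp_side s) i) ->
  left_perfect e s -> right_perfect e s ->
  injective_obj (C := C) E -> projective (C := C) E.
Proof.
move=> acc acc' Ip Jp Ei.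
have [|F [X0 FX0] FP Ft|Z [Zi _ Zmax]] := @Zorn_above (I * H * E)%type (@indep _ _ _ _ e s E) set0.
- exact: indep0.
- move=> X c XF; suff [Y FY XY] : exists2 Y, F Y & forall t, t \in (X : seq _) -> Y t.
    exact: (FP Y FY).1.
  have : forall t, t \in (X : seq _) -> (\bigcup_(X in F) X) t by move=> t tX; exact: XF.
  elim: (X : seq _) => [_|t r IH rF]; first by exists X0.
  have [|Y FY rY] := IH; first by move=> u ur; apply: rF; rewrite inE ur orbT.
  have [W FW Wt] : (\bigcup_(X in F) X) t by apply: rF; rewrite inE eqxx.
  have [YW|WY] := Ft _ _ FY FW.
    by exists W => // u; rewrite inE => /orP[/eqP ->//|/rY/YW].
  by exists Y => // u; rewrite inE => /orP[/eqP ->|/rY//]; exact: WY.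
have Zinj : injective_obj (C := C) (ffree he Z) by exact: free_noetherian_injective.
have [r rE] := injective_retract Zinj (ev_inj (he := he) Zi).
apply: (ev_bij_projective Zi) => y; exists (r y); apply/esym/eqP.
rewrite -subr_eq0; apply/eqP; apply: contrapT => y0.
have ry : [set x | r x = 0] (y - ev he Z (r y)).
  by rewrite /= (linB (grhom_lin r)) rE subrr.
have kg := gsub_ker r.
have [j [h [c [rc ci c0]]]] := gsub_neq0 he kg (gsub_n0 ry y0).
have [i [d [lam lP]]] := Jp j.
have [S [Ss Sc]] := exists_simple lP (acc' i) ci c0.
have [Sg S0 _] := Ss.
have [k [l [x [Sx _ x0]]]] := gsub_neq0 he Sg S0.
have [|t [Zt ti _ _]] := indep_extend Ei Ip Zi Zinj Ss.
  move=> /(_ x Sx)[u _ ux]; apply: x0.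
  have [a _ ax] := Sc _ Sx.
  have rx : r x = 0 by rewrite -ax grhom_act [r c]rc act0r.
  by move: rx; rewrite -ux rE => ->; rewrite hom0.
apply: Zt; rewrite -(Zmax _ ti); last exact: subsetUl.
by right.
Qed.

Lemma noetherian_frobenius : graded_locally_noetherian e -> nakayama_perm e s -> frobenius C.
Proof.
move=> noeth nak; have acc s' i : acc_ideals s' i by exact: noetherian_acc.
split; first exact: (grmod_enough_projectives he).
  exact: (grmod_enough_injectives he).
move=> M; split.
  apply: noetherian_projective_injective => //; exact: nakayama_perm_right.
apply: noetherian_injective_projective => //; first exact: nakayama_perm_left.
exact: nakayama_perm_right.
Qed.

End Sided.

End Noetherian.

(** * The dual of the regular module *)

Section DualRegular.
Variables (K : fieldType) (H : zmodType) (A : gralgebra K H) (I : choiceType).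
Variables (e : I -> A) (he : weakly_basic e) (s : side).

Local Notation "a *o b" := (sided_mul s a b) (at level 40, left associativity).
Local Notation D := (dual he (regular he s)).
Local Notation C := (grmod_cat A (opp_side s)).
Local Notation dform := (dual_form e (regular he s)).

Lemma deval_lin a : linear (fun f : D => (f : dform) a : K^o).
Proof. by []. Qed.

Lemma deval_act b (f : D) a : ((b ** f : D) : dform) a = (f : dform) (b *o a).
Proof. by []. Qed.

(** The components of phi are its restrictions to the A e_(i t). *)
Lemma dual_to_cofree (T : Type) (i : T -> I) :
  exists f : grhom D (cofree (opp_side s) he i (fun=> 0)),
    forall (phi : D) t a, cval (f phi) t a = (phi : dform) (a *o e (i t)).
Proof.
have [f fE] := cofree_hom he i (fun=> 0) (X := D)
  (g := fun t (phi : D) => (phi : dform) (e (i t))) (fun t => deval_lin (e (i t))).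
exists f => phi t a; rewrite fE /piece deval_act (e_idem s he).
rewrite -(lin_gcomp (g := fun phi : D => (phi : dform) (e (i t)))) //.
move=> h h0.
have hh : dual_comp e (regular he s) h (gcomp h (a ** phi : D)) by exact: (@gcomp_in K H D h (a ** phi)).
apply: (hh 0); last exact: (df_deg0 he).
by rewrite eq_sym oppr_eq0; exact/eqP.
Qed.

(** Conversely a family of forms on the A e_(i t) can be summed, as long as each
element of A has finitely many nonzero components there. *)
Lemma cofree_to_dual (T : choiceType) (i : T -> I) :
  (forall a : A, exists X : {fset T}, forall t, t \notin X -> a *o e (i t) = 0) ->
  exists f : grhom (cofree (opp_side s) he i (fun=> 0)) D,
    forall u a (X : {fset T}), (forall t, t \notin X -> a *o e (i t) = 0) ->
      (f u : dform) a = \sum_(t <- X) cval u t a.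
Proof.
move=> fin; set G := cofree _ _ _ _.
have c0 (u : G) t a : a *o e (i t) = 0 -> cval u t a = 0.
  by move=> a0; rewrite -cval_e sided_mul_opp a0 (lin0 (cval_lin u t)).
pose F (u : G) a : K^o := \sum_(t \in [set: T]) cval u t a.
have FE u a (X : {fset T}) : (forall t, t \notin X -> a *o e (i t) = 0) ->
    F u a = \sum_(t <- X) cval u t a.
  by move=> X0; rewrite /F; apply: fsbigTE => t /X0 /c0.
have F0 u a : (forall t, cval u t a = 0) -> F u a = 0.
  by move=> u0; have [X X0] := fin a; rewrite (FE _ _ _ X0) big1.
have Fl u : linear (F u).
  move=> c a b; have [X X0] := fin a; have [Y Y0] := fin b.
  have XY t : t \notin (X `|` Y)%fset -> a *o e (i t) = 0 /\ b *o e (i t) = 0.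
    by rewrite inE negb_or => /andP[/X0 -> /Y0 ->].
  have cXY t : t \notin (X `|` Y)%fset -> (c *: a + b) *o e (i t) = 0.
    by move=> /XY[a0 b0]; rewrite omulDl omulZl a0 b0 scaler0 addr0.
  rewrite (FE _ _ _ cXY) (FE u a (X `|` Y)%fset) => [|t /XY[]//].
  rewrite (FE u b (X `|` Y)%fset) => [|t /XY[]//].
  by rewrite scaler_sumr -big_split; apply: eq_bigr => t _; exact: cval_lin.
have Flu a : linear (fun u => F u a).
  move=> c u v; have [X X0] := fin a; rewrite !(FE _ _ _ X0).
  by rewrite scaler_sumr -big_split; apply: eq_bigr => t _; exact: cval_linu.
have FD u : F u \in dual_pred e (regular he s).
  apply/asboolP; split; first exact: Fl.
  apply: (piece_ind (P := fun u : G => finite_set [set p : I * H |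
      exists2 x : regular he s, homog p.2 x & F u (e p.1 ** x) != 0]) he) => [|k h].
    split=> [|c v w vf wf].
      apply: sub_finite_set (finite_set0 _) => p [x _].
      by rewrite F0 ?eqxx.
    apply: sub_finite_set (_ : finite_set (_ `|` _)); last first.
      by rewrite finite_setU; split; [exact: vf|exact: wf].
    move=> p [x px vwx]; have [vx|vx] := eqVneq (F v (e p.1 ** x)) 0.
      right; exists x => //; apply: contraNneq vwx => wx.
      by rewrite Flu vx wx scaler0 addr0.
    by left; exists x.
  apply: sub_finite_set (finite_set1 (k, - h)) => -[k' h'] [x hx vx].
  have [hv kv] := in_piece_piece he k h u; move: (piece e k h u) hv kv vx => v hv kv /= vx.
  have vE t a : cval v t a = cval v t (e k *o a).
    by rewrite -{1}kv cval_act sided_mul_opp.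
  congr (_, _).
    apply: contrapT => kk; move/eqP: vx; apply; apply: F0 => t.
    transitivity (cval v t (e k *o (e k' *o x))); first exact: vE.
    by rewrite omulA (e_orth s he) ?omul0l ?(lin0 (cval_lin v t)) //; exact: nesym.
  apply: contrapT => hh; move/eqP: vx; apply; apply: F0 => t.
  apply: (cval_homog hv (homog_el s he k' hx)).
  by rewrite sub0r.
pose f (u : G) : D := DualForm (FD u).
have fl : linear f by move=> c u v; apply: dual_formP => a; exact: Flu.
have fa b u : f (b ** u) = b ** f u.
  by apply: dual_formP => a; rewrite deval_act /= /F;
    apply: eq_fsbigr => t _; rewrite cval_act sided_mul_opp.
have fh h u : homog h u -> homog h (f u).
  move=> hu; suff : dual_comp e (regular he s) h (DualForm (FD u)) by [].
  move=> k a kh ka; apply: F0 => t; apply: (cval_homog hu ka).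
  by rewrite sub0r; exact/eqP.
by exists (GrHom fl fa fh).
Qed.

(** D(A) is the graded product of the duals of the corners, a cofree module. *)
Lemma dual_regular_injective : injective_obj (C := C) D.
Proof.
have [f fE] := dual_to_cofree (@id I).
have [|g gE] := @cofree_to_dual I id.
  move=> a; have [X X0] := df_fin he (opp_side s) a; exists X => t /X0.
  by rewrite sided_mul_opp.
apply: (retract_injective (i := f) (r := g)); last exact: cofree_injective.
move=> phi; apply: dual_formP => a.
have [X X0] := df_fin he (opp_side s) a.
rewrite (gE _ _ X) => [|t /X0]; last by rewrite sided_mul_opp.
rewrite [in RHS](df_expand he X0) (lin_sum (dual_lin _)).
by apply: eq_bigr => t _; rewrite fE sided_mul_opp.
Qed.

Lemma dual_regular_cdual_projective i : projective (C := C) D ->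
  projective (C := C) (cdual (opp_side s) he i 0).
Proof.
move=> Dp; have [f fE] := dual_to_cofree (fun _ : unit => i).
have [|g gE] := @cofree_to_dual unit (fun=> i).
  by move=> a; exists [fset tt]%fset => -[]; rewrite inE eqxx.
apply: (retract_projective (i := g) (r := f)) Dp => u.
apply: cvalI => -[] a; rewrite fE (gE _ _ [fset tt]%fset) => [|[]]; last first.
  by rewrite inE eqxx.
by rewrite big_seq_fset1 -cval_e sided_mul_opp -omulA (e_idem s he) -sided_mul_opp cval_e.
Qed.

Lemma perfect_form i j d lam : perfect e (opp_side s) i j d lam ->
  exists f : D, in_piece e j (- d) f /\ forall a, (f : dform) a = lam a.
Proof.
move=> lP; have [ll lc _ _] := lP.
have lD : (lam : regular he s -> K^o) \in dual_pred e (regular he s).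
  apply/asboolP; split=> //.
  apply: sub_finite_set (finite_set1 (j, d)) => -[k h] [x /= hx lx].
  congr (_, _).
    apply: contrapT => kj; move/eqP: lx; apply.
    rewrite -(perfect_er he _ lP) sided_mul_opp omulA (e_orth s he); last exact: nesym.
    by rewrite omul0l (lin0 ll).
  apply: contrapT => hd; move/eqP: lx; apply.
  exact: (perfect_deg lP (homog_el s he k hx)).
exists (DualForm lD); split=> //; split.
  suff : dual_comp e (regular he s) (- d) (DualForm lD) by [].
  move=> k x kd kx; apply: (perfect_deg lP kx).
  by move=> kd'; move: kd; rewrite kd' opprK eqxx.
by apply: dual_formP => a; rewrite deval_act /= -sided_mul_opp (perfect_er he _ lP).
Qed.

(** In the locally bounded case D(A) is the direct sum of the duals of the e_i A,
that is, of the A e_(nu i) up to shift. *)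
Lemma dual_regular_projective : graded_locally_bounded e ->
  nakayama_perm e (opp_side s) -> projective (C := C) D.
Proof.
move=> [_ bdd] [nu [_ /choice[d /choice[lam lP]]]].
have /choice[x xP] := fun i => perfect_form (lP i).
have xi t : [set: I] t -> in_piece e (nu t) (- d t) (x t) by have [] := xP t.
pose F := free (opp_side s) he nu (fun t => - d t) [set: I].
pose theta : grhom F D := free_hom he xi.
have ll t : linear (lam t) by have [] := lP t.
have thE (u : F) (X : {fset I}) a : (forall t, t \notin X -> coef u t = 0) ->
    (theta u : dform) a = \sum_(t <- X) lam t (coef u t *o a).
  move=> X0; rewrite [theta u](free_evalE _ X0) dual_sum.
  by apply: eq_bigr => t _; rewrite deval_act (xP t).2.
have th_inj : injective theta.
  apply: hom_inj => u u0; apply: coefI => t; have [X X0] := coef_fin u.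
  have [_ _ lb _] := lP t; apply: lb => [|a]; first exact: coef_e.
  have := thE u X (a *o e t) X0; rewrite u0 => /esym.
  rewrite (fset_sum1 (t := t)) => [|t' _ tt'|/X0 ->]; last first.
  - by rewrite omul0l (lin0 (ll t)).
  - rewrite -(perfect_el he _ (lP t')) sided_mul_opp -!omulA (e_orth s he).
      by rewrite !omul0r (lin0 (ll t')).
    exact: nesym.
  by rewrite omulA -sided_mul_opp (perfect_el he _ (lP t)) sided_mul_opp.
have th_surj f : exists u, theta u = f.
  suff [u _ uf] : range theta f by exists u.
  apply: (piece_ind he) => [|k h].
    by have /gsubP[] := gsub_range theta (gsubT F).
  have [hf kf] := in_piece_piece he k h f; move: (piece e k h f) hf kf => {}f hf kf.
  have fl : linear (f : dform) by exact: dual_lin.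
  have /choice[b bP] : forall t, exists b, cor e (opp_side s) k (nu t) (d t + h) b /\
      forall a, cor e (opp_side s) t k (- h) a -> lam t (b *o a) = (f : dform) a.
    move=> t; have [b [bc bE]] := perfect_full he (lP t) k (- h) fl.
    rewrite opprK in bc; exists b; split=> // a /bE <-.
    by rewrite sided_mul_opp.
  have /finite_fsetP[X XE] : finite_set [set t | b t != 0].
    have : finite_set [set t | cor e (opp_side s) t k (- h) <> [set 0]].
      have [fr fl'] := bdd k (- h); case: (s) => /=; last first.
        by apply: sub_finite_set fl' => t; rewrite /= cor_l.
      by apply: sub_finite_set fr => t; rewrite /= cor_r cor_l.
    apply: sub_finite_set => t /= /eqP bt ct; apply: bt.
    have [bc bE] := bP t; have [_ lc lb _] := lP t.
    apply: lb => [|a]; first by case: bc.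
    rewrite -lc (crn_mulr he _ _ _ bc) opprD addNKr.
    have : cor e (opp_side s) t k (- h) (crn e (opp_side s) t k (- h) a).
      exact: (cor_crn (opp_side s) he).
    by rewrite ct => ->; rewrite omul0l (lin0 (ll t)).
  have X0 t : t \notin X -> b t = 0.
    move=> tX; apply/eqP; apply: contraNT tX => bt.
    by have : [set` X] t by rewrite -XE.
  have [||u [_ uE]] := free_mkE (s := opp_side s) he (j := nu) (d := fun t => - d t)
      (Z := [set: I]) (F := b) (i := k) (h := h).
  - split=> [t|t|t nt|]; [|by have [[]] := bP t|by case: nt|].
      by have [[+ _ _] _] := bP t; rewrite opprK addrC.
    by rewrite XE; exact: finite_fset.
  - by move=> t; have [[]] := bP t.
  exists u => //; apply: dual_formP => a.
  have [Y Y0] := df_fin he (opp_side s) a.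
  have XY0 t : t \notin (X `|` Y)%fset -> coef u t = 0 /\ sided_mul (opp_side s) (e t) a = 0.
    by rewrite inE negb_or uE => /andP[/X0 -> /Y0].
  rewrite (thE u (X `|` Y)%fset) => [|t /XY0[]//].
  rewrite [in RHS](@df_expand _ _ _ _ _ he (opp_side s) a (X `|` Y)%fset) => [|t /XY0[]//].
  rewrite (lin_sum fl); apply: eq_bigr => t _; rewrite uE.
  have [bc bE] := bP t; have [_ lc _ _] := lP t.
  rewrite -(sided_mul_opp s a) -lc (crn_mulr he _ _ _ bc) opprD addNKr.
  rewrite sided_mul_opp bE; last exact: (cor_crn (opp_side s) he).
  rewrite /crn !sided_mul_opp -deval_act kf -(gcomp_er s he).
  apply/esym/(lin_gcomp (g := (f : dform) : A -> K^o)) => // l lh.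
  have hf' : dual_comp e (regular he s) h f by exact: hf.
  by apply: (hf' l); [exact/eqP|exact: gcomp_in].
have [g [thg gth]] := bij_hom_inv th_inj th_surj.
by apply: (retract_projective thg); exact: free_projective.
Qed.

End DualRegular.

Theorem theorem3p1 (K : fieldType) (H : zmodType) (A : gralgebra K H)
    (I : choiceType) (e : I -> A) (he : weakly_basic e) :
  let assertion1 :=
    frobenius (grmod_cat A lside) /\ frobenius (grmod_cat A rside) in
  let assertion2 :=
    projective (C := grmod_cat A rside) (dual he (regular he lside)) /\
    projective (C := grmod_cat A lside) (dual he (regular he rside)) in
  let assertion3 (s : side) :=
    forall M : grmod_cat A s,
      (finitely_generated (M := M) (@setT M) /\ projective M) <->
      (finitely_cogenerated M /\ injective_obj M) in
  let assertion4 :=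
    exists B : {biscalar A}, graded_nakayama_form e B in
  forall s : side,
  [/\ assertion1 -> assertion2,
      assertion2 -> assertion3 s,
      assertion3 s <-> assertion4,
      graded_locally_bounded e -> assertion4 -> assertion2 &
      graded_locally_noetherian e ->
        [/\ assertion1 <-> assertion2, assertion2 <-> assertion3 s &
            assertion3 s <-> assertion4]].
Proof.
move=> assertion1 assertion2 assertion3 assertion4 s.
have a12 : assertion1 -> assertion2.
  move=> [[_ _ frl] [_ _ frr]]; split.
    apply/frr; exact: (@dual_regular_injective K H A I e he lside).
  apply/frl; exact: (@dual_regular_injective K H A I e he rside).
have a4n s' : assertion4 -> nakayama_perm e s'.
  by move=> [B /(nakayama_form_perm he)]; exact: nakayama_perm_side.
have na4 s' : nakayama_perm e s' -> assertion4.
  by move=> /(nakayama_perm_side lside); exact: nakayama_perm_form.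
have a2n : assertion2 -> nakayama_perm e lside.
  move=> [pr pl]; apply: (nakayama_perm_intro he) => [i|j].
    have := @dual_regular_cdual_projective K H A I e he rside i pl.
    exact: projective_perfect.
  have := @dual_regular_cdual_projective K H A I e he lside j pr.
  move=> /projective_perfect[i [d [lam lP]]].
  by exists i, d, lam; exact: (perfect_opp lP).
have n3 s' : nakayama_perm e s' -> assertion3 s' by exact: nakayama_perm_coincidence.
have a3n s' : assertion3 s' -> nakayama_perm e s' by exact: coincidence_nakayama_perm.
have a34 s' : assertion3 s' <-> assertion4.
  by split=> [/a3n/na4|/a4n/n3].
have a23 : assertion2 -> assertion3 s by move=> /a2n/(nakayama_perm_side s)/n3.
split=> // [bdd a4|noeth].
  split.
    exact: (@dual_regular_projective K H A I e he lside bdd (a4n _ a4)).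
  exact: (@dual_regular_projective K H A I e he rside bdd (a4n _ a4)).
have a31 : assertion3 s -> assertion1.
  move=> /a34 a4; split; exact: noetherian_frobenius noeth (a4n _ a4).
by split=> //; split=> // a; [exact/a31/a23|exact/a12/a31].
Qed.
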